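(* Let $(M,I,J,K)$ be a hypercomplex manifold of real dimension $4n$ with a quaternionic Hermitian metric $g$, and let $$\omega_I(X,Y)=g(X,Y\circ I),\qquad \Omega(X,Y)=-\bigl(g(X,Y\circ J)-\sqrt{-1}\,g(X,Y\circ K)\bigr).$$ Let $f,\phi$ be real-valued smooth functions on $M$ and $A$ a real constant. Then the quaternionic Monge-Ampère equation $$(\Omega+\partial\partial_J\phi)^n=A\,e^f\,\Omega^n$$ is equivalent to the equation $$(\omega_I-\sqrt{-1}\,\partial\bar\partial\phi)^n\wedge P_+(\omega_I^n)=A\,e^f\,\omega_I^n\wedge P_+(\omega_I^n).$$
   Context: A hypercomplex manifold is a smooth manifold $M$ with (integrable) complex structures $I,J,K$ satisfying $IJ=-JI=K$, acting on the right on $TM$, so that $(X\circ I)\circ J=X\circ K$. $\partial,\bar\partial$ are the Dolbeault differentials of the complex manifold $(M,I)$. $J$ acts on 1-forms by $(J\eta)(X)=\eta(X\circ J)$ and on all forms multiplicatively. Put $\partial_J:=J^{-1}\circ\bar\partial\circ J$ on $(p,0)$-forms; on functions $\partial_J\phi=J^{-1}(\bar\partial\phi)$. A Riemannian metric $g$ is quaternionic Hermitian if it is invariant under the group $SU(2)$ of unit quaternions acting on $TM$. The group $SU(2)$ of unit quaternions acts on the left on $\Lambda^*(M)$. For $r\le 2n$, $\Lambda^r_+(M)\subset\Lambda^r(M)$ is the maximal $SU(2)$-invariant subspace (subbundle) on which $SU(2)$ acts with weight $r$ (the highest possible weight on $r$-forms), and $P_+:\Lambda^r(M)\to\Lambda^r_+(M)$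 is the $SU(2)$-equivariant projection whose kernel is the sum of all subrepresentations of weight less than $r$. *)

(* Defs.v *)
From HB Require Import structures.
From mathcomp Require Import all_boot all_order all_algebra perm.
From mathcomp Require Import all_classical reals topology normedtype sequences derive exp.
From mathcomp Require Import complex.

Set Implicit Arguments.
Unset Strict Implicit.
Unset Printing Implicit Defensive.

Import Order.TTheory GRing.Theory Num.Theory.
Import numFieldNormedType.Exports.

Local Open Scope classical_set_scope.
Local Open Scope complex_scope.
Local Open Scope ring_scope.

Fixpoint Ck (R : realType) (m k : nat) (U : set 'rV[R]_m) (f : 'rV[R]_m -> R)
    : Prop :=
  (forall y, U y -> {for y, continuous f}) /\
  if k is l.+1 then
    forall a : 'I_m, (forall y, U y -> derivable f y 'e_a)
                     /\ Ck l U (fun y => 'D_('e_a) f y)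
  else True.

Definition smooth_on (R : realType) (m : nat) (U : set 'rV[R]_m)
  (f : 'rV[R]_m -> R) : Prop := forall k, Ck k U f.

Definition smooth_mx_on (R : realType) (m p q : nat) (U : set 'rV[R]_m)
    (F : 'rV[R]_m -> 'M[R]_(p, q)) : Prop :=
  forall i j, smooth_on U (fun y => F y i j).

Record chart (R : realType) (m : nat) (M : topologicalType) := Chart {
  cdom : set M;
  cmap : M -> 'rV[R]_m;
  cinv : 'rV[R]_m -> M;
  cdom_open : open cdom;
  cimg_open : open (cmap @` cdom);
  cmapK : forall x, cdom x -> cinv (cmap x) = x;
  cmap_cont : {within cdom, continuous cmap};
  cinv_cont : {within cmap @` cdom, continuous cinv}
}.

Definition cimg (R : realType) (m : nat) (M : topologicalType)
  (c : chart R m M) : set 'rV[R]_m := cmap c @` cdom c.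

Definition overlap (R : realType) (m : nat) (M : topologicalType)
  (c d : chart R m M) : set 'rV[R]_m := cmap c @` (cdom c `&` cdom d).

Definition transition (R : realType) (m : nat) (M : topologicalType)
  (c d : chart R m M) : 'rV[R]_m -> 'rV[R]_m := fun y => cmap d (cinv c y).

Record manifold (R : realType) (m : nat) := Manifold {
  mtop :> topologicalType;
  _ : hausdorff_space mtop;
  _ : @second_countable mtop;
  cidx : Type;
  atlas : cidx -> chart R m mtop;
  _ : forall x, exists c, cdom (atlas c) x;
  _ : forall c d, smooth_mx_on (overlap (atlas c) (atlas d))
                               (transition (atlas c) (atlas d))
}.

Arguments atlas {R m} M c : rename.
Arguments cidx {R m} M : rename.

Definition smooth_fun (R : realType) (m : nat) (M : manifold R m) (f : M -> R)
    : Prop :=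
  forall c, smooth_on (cimg (atlas M c)) (fun y => f (cinv (atlas M c) y)).

(* Tensor fields are given by their components in every chart of the atlas,
   as functions of the coordinate y in [cimg c]; values outside are junk.
   Tangent vectors are row vectors, on which endomorphisms act on the right by
   [*m]; a vector v at y reads v *m jacobian _ y in another chart. *)
Definition mxfield (R : realType) (m : nat) (M : manifold R m) :=
  cidx M -> 'rV[R]_m -> 'M[R]_m.

Definition endo_field (R : realType) (m : nat) (M : manifold R m)
    (E : mxfield M) : Prop :=
  (forall c, smooth_mx_on (cimg (atlas M c)) (E c)) /\
  (forall c d y, overlap (atlas M c) (atlas M d) y ->
     let t := transition (atlas M c) (atlas M d) in
     E c y *m jacobian t y = jacobian t y *m E d (t y)).

Definition riemannian_metric (R : realType) (m : nat) (M : manifold R m)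
    (g : mxfield M) : Prop :=
  [/\ forall c, smooth_mx_on (cimg (atlas M c)) (g c),
      forall c d y, overlap (atlas M c) (atlas M d) y ->
        let t := transition (atlas M c) (atlas M d) in
        g c y = jacobian t y *m g d (t y) *m (jacobian t y)^T,
      forall c y, cimg (atlas M c) y -> (g c y)^T = g c y
    & forall c y, cimg (atlas M c) y ->
        forall v : 'rV[R]_m, v != 0 -> 0 < (v *m g c y *m v^T) 0 0].

Definition lie_bracket (R : realType) (m : nat)
    (X Y : 'rV[R]_m -> 'rV[R]_m) : 'rV[R]_m -> 'rV[R]_m :=
  fun y => 'D_(X y) Y y - 'D_(Y y) X y.

(* the Nijenhuis tensor of E vanishes *)
Definition integrable_field (R : realType) (m : nat) (M : manifold R m)
    (E : mxfield M) : Prop :=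
  forall c (X Y : 'rV[R]_m -> 'rV[R]_m),
    smooth_mx_on (cimg (atlas M c)) X -> smooth_mx_on (cimg (atlas M c)) Y ->
    let XE := fun z => X z *m E c z in
    let YE := fun z => Y z *m E c z in
    forall y, cimg (atlas M c) y ->
      lie_bracket XE YE y - lie_bracket XE Y y *m E c y
        - lie_bracket X YE y *m E c y - lie_bracket X Y y = 0.

(* X *m (I *m J) is (X o I) o J, so that hc_IJ is (X o I) o J = X o K *)
Record hypercomplex (R : realType) (m : nat) (M : manifold R m) := Hypercomplex {
  hcI : mxfield M;
  hcJ : mxfield M;
  hcK : mxfield M;
  hc_endo : [/\ endo_field hcI, endo_field hcJ & endo_field hcK];
  hc_sq : forall c y, cimg (atlas M c) y ->
    [/\ hcI c y *m hcI c y = - 1%:M, hcJ c y *m hcJ c y = - 1%:M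
      & hcK c y *m hcK c y = - 1%:M];
  hc_IJ : forall c y, cimg (atlas M c) y ->
    hcI c y *m hcJ c y = hcK c y /\ - (hcJ c y *m hcI c y) = hcK c y;
  hc_int : [/\ integrable_field hcI, integrable_field hcJ
             & integrable_field hcK]
}.

Definition unit_quat (R : realType) (a0 a1 a2 a3 : R) : Prop :=
  a0 ^+ 2 + a1 ^+ 2 + a2 ^+ 2 + a3 ^+ 2 = 1.

Definition quaternionic_hermitian (R : realType) (m : nat) (M : manifold R m)
    (H : hypercomplex M) (g : mxfield M) : Prop :=
  riemannian_metric g /\
  forall c y, cimg (atlas M c) y ->
  forall a0 a1 a2 a3 : R, unit_quat a0 a1 a2 a3 ->
    let q := a0%:M + a1 *: hcI H c y + a2 *: hcJ H c y + a3 *: hcK H c y in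
    q *m g c y *m q^T = g c y.

(* The argument of an r-form is the r x m matrix whose rows are the r complex
   tangent vectors. *)
Definition form (R : realType) (m r : nat) := 'M[R[i]]_(r, m) -> R[i].

(* multilinearity is phrased as in [determinant_multilinear] *)
Definition Lambda (R : realType) (m r : nat) : set (form R m r) :=
  [set eta |
    (forall (X Y Z : 'M[R[i]]_(r, m)) (k : 'I_r) (a b : R[i]),
       row k X = a *: row k Y + b *: row k Z ->
       row' k Y = row' k X -> row' k Z = row' k X ->
       eta X = a * eta Y + b * eta Z)
    /\ (forall (X : 'M[R[i]]_(r, m)) (k l : 'I_r),
          k != l -> row k X = row l X -> eta X = 0)].

Definition wedge (R : realType) (m r s : nat)
    (alpha : form R m r) (beta : form R m s) : form R m (r + s) :=
  fun X => (r`! * s`!)%:R^-1 *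
    \sum_(p : 'S_(r + s)) (-1) ^+ p * alpha (usubmx (row_perm p X))
                                    * beta (dsubmx (row_perm p X)).

Fixpoint wpow (R : realType) (m r : nat) (alpha : form R m r) (n : nat)
    : form R m (n * r) :=
  if n is k.+1 return form R m (n * r) then wedge alpha (@wpow R m r alpha k)
  else fun=> 1.
Arguments wpow {R m r} alpha n X : rename.

Definition act (R : realType) (m r : nat) (U : 'M[R[i]]_m) (eta : form R m r)
    : form R m r :=
  fun X => eta (X *m U).

(* projections of TM (x) C on the eigenspaces of I for i and - i *)
Definition proj10 (R : realType) (m : nat) (I : 'M[R[i]]_m) : 'M[R[i]]_m :=
  2%:R^-1 *: (1%:M - 'i%C *: I).
Definition proj01 (R : realType) (m : nat) (I : 'M[R[i]]_m) : 'M[R[i]]_m :=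
  2%:R^-1 *: (1%:M + 'i%C *: I).

(* the component of bidegree (p, r - p) of an r-form *)
Definition bidegree (R : realType) (m r : nat) (I : 'M[R[i]]_m) (p : nat)
    (eta : form R m r) : form R m r :=
  fun X => \sum_(S : {set 'I_r} | #|S| == p)
    eta (\matrix_(k < r) (row k X *m (if k \in S then proj10 I else proj01 I))).

Definition quat_mx (R : realType) (m : nat) (I J K : 'M[R[i]]_m)
    (a0 a1 a2 a3 : R) : 'M[R[i]]_m :=
  a0%:C%:M + a1%:C *: I + a2%:C *: J + a3%:C *: K.

(* the fundamental representation V_1: the isomorphism of the group of unit
   quaternions with SU(2) *)
Definition su2_mx (R : realType) (a0 a1 a2 a3 : R) : 'M[R[i]]_2 :=
  \matrix_(i < 2, j < 2)
    if i == 0 then (if j == 0 then a0 +i* a1 else a2 +i* a3)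
    else (if j == 0 then (- a2) +i* a3 else a0 -i* a1).

(* S^k(V_1) is the space of binary forms of degree k on row vectors v, with
   coefficient vector u, where q sends P to (v |-> P (v q)). *)
Definition binary_form (R : realType) (k : nat) (u : 'rV[R[i]]_k.+1)
    (v : 'rV[R[i]]_2) : R[i] :=
  \sum_(i < k.+1) u 0 i * v 0 0 ^+ i * v 0 1 ^+ (k - i).

Section Weights.
Context {R : realType} {m : nat} (I J K : 'M[R[i]]_m) {r : nat}.
Implicit Types (W S : set (form R m r)) (k : nat).

Definition subrep W : Prop :=
  [/\ W `<=` @Lambda R m r, W (fun=> 0),
      forall alpha beta, W alpha -> W beta -> W (fun X => alpha X + beta X),
      forall (z : R[i]) alpha, W alpha -> W (fun X => z * alpha X)
    & forall a0 a1 a2 a3 alpha, unit_quat a0 a1 a2 a3 -> W alpha ->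
        W (act (quat_mx I J K a0 a1 a2 a3) alpha)].

(* W is isomorphic to S^k(V_1) *)
Definition irrep_of_weight k W : Prop :=
  subrep W /\
  exists T : 'rV[R[i]]_k.+1 -> form R m r,
    [/\ forall z u v, T (z *: u + v) = (fun X => z * T u X + T v X),
        injective T,
        W = range T
      & forall a0 a1 a2 a3 u u', unit_quat a0 a1 a2 a3 ->
          (forall v, binary_form u' v
                     = binary_form u (v *m su2_mx a0 a1 a2 a3)) ->
          T u' = act (quat_mx I J K a0 a1 a2 a3) (T u)].

Definition finite_sums S : set (form R m r) :=
  [set eta | exists (N : nat) (e : 'I_N -> form R m r),
     (forall j, S (e j)) /\ eta = (fun X => \sum_(j < N) e j X)].

(* SU(2) acts on W with weight k: W is a sum of irreducibles of weight k *)
Definition has_weight k W : Prop :=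
  subrep W /\
  W = finite_sums (\bigcup_(V in [set V | irrep_of_weight k V /\ V `<=` W]) V).

(* Subrepresentations of weight r are stable under sums, so that their union is
   the largest one. *)
Definition Lambda_plus : set (form R m r) :=
  \bigcup_(W in [set W | has_weight r W]) W.

Definition Lambda_lower : set (form R m r) :=
  finite_sums
    (\bigcup_(W in [set W | exists2 k, (k < r)%N & has_weight k W]) W).

(* The projection on Lambda_plus along Lambda_lower: the summand alpha of
   eta = alpha + (eta - alpha) in this direct sum. *)
Definition Pplus (eta : form R m r) : form R m r :=
  xget (fun=> 0) [set alpha | Lambda_plus alpha
                              /\ Lambda_lower (fun X => eta X - alpha X)].

End Weights.

Definition cmx (R : realType) (p q : nat) (A : 'M[R]_(p, q)) : 'M[R[i]]_(p, q) :=
  map_mx (real_complex R) A.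

Definition cpartial (R : realType) (m : nat) (a : 'I_m)
    (h : 'rV[R]_m -> R[i]) (y : 'rV[R]_m) : R[i] :=
  ('D_('e_a) (fun z => complex.Re (h z)) y)
    +i* ('D_('e_a) (fun z => complex.Im (h z)) y).

Definition ext_d (R : realType) (m r : nat) (omega : 'rV[R]_m -> form R m r)
    : 'rV[R]_m -> form R m r.+1 :=
  fun y X => \sum_(k < r.+1) (-1) ^+ k *
    \sum_(a < m) X k a * cpartial a (fun z => omega z (row' k X)) y.

(* complex r-forms, by their expression in every chart; the expressions used
   below are built naturally from tensor fields, hence agree on overlaps *)
Definition dform (R : realType) (m : nat) (M : manifold R m) (r : nat) :=
  cidx M -> 'rV[R]_m -> form R m r.

Section Forms.
Context {R : realType} {m : nat} {M : manifold R m}.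

Definition form_eq r (alpha beta : dform M r) : Prop :=
  forall c y, cimg (atlas M c) y -> forall X, alpha c y X = beta c y X.

Definition form_add r (alpha beta : dform M r) : dform M r :=
  fun c y X => alpha c y X + beta c y X.

Definition form_scale r (z : R[i]) (alpha : dform M r) : dform M r :=
  fun c y X => z * alpha c y X.

Definition form_mulf r (h : M -> R) (alpha : dform M r) : dform M r :=
  fun c y X => (h (cinv (atlas M c) y))%:C * alpha c y X.

Definition form_wedge r s (alpha : dform M r) (beta : dform M s) : dform M (r + s) :=
  fun c y => wedge (alpha c y) (beta c y).

Definition form_pow r (alpha : dform M r) n : dform M (n * r) :=
  fun c y => wpow (alpha c y) n.

Definition form_fun (h : M -> R) : dform M 0 :=
  fun c y _ => (h (cinv (atlas M c) y))%:C.

Context (H : hypercomplex M).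

(* On (p,q)-forms, del and delbar are the components of d of bidegree (p+1,q)
   and (p,q+1). *)
Definition del r (omega : dform M r) : dform M r.+1 :=
  fun c y X => \sum_(p < r.+1)
    bidegree (cmx (hcI H c y)) p.+1
      (ext_d (fun z => bidegree (cmx (hcI H c z)) p (omega c z)) y) X.

Definition delbar r (omega : dform M r) : dform M r.+1 :=
  fun c y X => \sum_(p < r.+1)
    bidegree (cmx (hcI H c y)) p
      (ext_d (fun z => bidegree (cmx (hcI H c z)) p (omega c z)) y) X.

Definition actJ r (omega : dform M r) : dform M r :=
  fun c y => act (cmx (hcJ H c y)) (omega c y).

Definition actJV r (omega : dform M r) : dform M r :=
  fun c y => act (invmx (cmx (hcJ H c y))) (omega c y).

Definition delJ r (omega : dform M r) : dform M r.+1 :=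
  actJV (delbar (actJ omega)).

Definition form_Pplus r (omega : dform M r) : dform M r :=
  fun c y => Pplus (cmx (hcI H c y)) (cmx (hcJ H c y)) (cmx (hcK H c y))
                   (omega c y).

(* the bilinear form (X, Y) |-> g (X, Y o E) *)
Definition metric_form (g E : mxfield M) : dform M 2 :=
  fun c y X =>
    (row 0 X *m cmx (g c y) *m (row 1 X *m cmx (E c y))^T) 0 0.

Definition omegaI (g : mxfield M) : dform M 2 := metric_form g (hcI H).

Definition Omega (g : mxfield M) : dform M 2 :=
  fun c y X => - (metric_form g (hcJ H) c y X - 'i%C * metric_form g (hcK H) c y X).

End Forms.

Arguments form_pow {R m M r} alpha n c y X : rename.

(* Main.v *)
Require Import Defs.
From mathcomp Require Import all_boot all_order all_algebra perm.
From mathcomp Require Import all_classical reals topology normedtype sequences derive exp.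
From mathcomp Require Import complex.
From mathcomp Require Import ring zify.
Require Import Defs.

(** Both equations are pointwise statements about exterior forms on a complex
   vector space with an action of the quaternions.

   Put [om' = omega_I - i del delbar phi] and [Om' = Omega + del del_J phi].
   The raising operator of sl(2, C) maps [om'] to a multiple of [Om'], as it maps
   [omega_I] to a multiple of [Omega]: for the metric this is a computation, and
   for the Hessians of [phi] it follows from the vanishing of the Nijenhuis
   tensors of [I] and [J], the second derivatives of [phi] cancelling.

   [P_+ (omega_I ^ n)] lies in the sum of the representations of weight 2n and is
   thus determined by its values on vectors of type (1,0), that is, by its highest
   weight part [Omega ^ n].  In an expansion over the conjugates of [Omega ^ n]
   by unipotent elements of SL(2, C), moving a conjugating element from one factor
   of the wedge product to the other replaces [om' ^ n] by its own highest weight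
   part, a multiple of [Om' ^ n].  Hence [om' ^ n /\ P_+ (omega_I ^ n)] is the
   value of [Om' ^ n] on a frame of type (1,0), up to a factor that does not
   depend on [om'] and is nonzero because [Omega] is nondegenerate. *)

Set Implicit Arguments.
Unset Strict Implicit.
Unset Printing Implicit Defensive.

Import Order.TTheory GRing.Theory Num.Theory.
Import numFieldNormedType.Exports.
Local Open Scope complex_scope.
Local Open Scope ring_scope.

(** * Alternating forms, wedge products and determinant forms *)

Section Multilinear.
Variables (R : realType) (m : nat).
Local Notation C := R[i].

(** [Pplus] is a choice with default value 0, so nothing is known about it until r-forms are shown
    to decompose into weight r and lower weights. This is done by hand, without invariant
    integration: an r-form is a sum of antisymmetrised multilinear maps on r copies of the standard
    representation, and swapping two neighbouring arguments changes such a map by a contraction,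
    which has two arguments fewer.

    Only the compact group acts on the irreducibles, whereas unipotent elements are wanted. The
    bridge is the basis of binary forms given by the powers of v0 + l v1, l = 0, ..., k: each of
    these linear forms is a real multiple of an SU(2)-translate of v0, and homogeneity turns the
    translate into a unipotent element. The inverse of the matrix of this basis supplies the
    coefficients in the expansion of [Pplus], and its n-th row the final constant. In place of Lie
    algebra weights, coefficients of polynomials on the unit circle are compared. *)

Definition setrow r (X : 'M[C]_(r, m)) k (v : 'rV[C]_m) : 'M[C]_(r, m) :=
  \matrix_i (if i == k then v else row i X).

Lemma row_setrow r (X : 'M[C]_(r, m)) k v i :
  row i (setrow X k v) = if i == k then v else row i X.
Proof. by rewrite rowK. Qed.

Lemma row'_setrow r (X : 'M[C]_(r, m)) k v : row' k (setrow X k v) = row' k X.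
Proof.
by apply/row_matrixP => i; rewrite !row_rowsub row_setrow eq_sym (negPf (neq_lift _ _)).
Qed.

Lemma Lambda_lin r (eta : form R m r) : Lambda eta ->
  forall X k a b u v, eta (setrow X k (a *: u + b *: v)) =
     a * eta (setrow X k u) + b * eta (setrow X k v).
Proof.
move=> [L _] X k a b u v; apply: (L _ _ _ k).
- by rewrite !row_setrow eqxx.
- by rewrite !row'_setrow.
- by rewrite !row'_setrow.
Qed.

Lemma Lambda_add r (eta : form R m r) : Lambda eta ->
  forall X k u v, eta (setrow X k (u + v)) = eta (setrow X k u) + eta (setrow X k v).
Proof. by move=> L X k u v; have := Lambda_lin L X k 1 1 u v; rewrite !scale1r !mul1r. Qed.

Lemma Lambda_alt r (eta : form R m r) : Lambda eta ->
  forall X (k l : 'I_r), k != l -> row k X = row l X -> eta X = 0.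
Proof. by move=> [_ ?]. Qed.

Lemma Lambda_row0 r (eta : form R m r) : Lambda eta ->
  forall X (k : 'I_r), row k X = 0 -> eta X = 0.
Proof.
move=> [L _] X k Xk; rewrite (L X X X k 0 0) ?scale0r ?addr0 //.
by rewrite !mul0r addr0.
Qed.

Lemma setrow_row r (X : 'M[C]_(r, m)) k : setrow X k (row k X) = X.
Proof. by apply/row_matrixP => i; rewrite row_setrow; case: eqP => // ->. Qed.

Lemma LambdaI r (eta : form R m r) :
  (forall X k a b u v, eta (setrow X k (a *: u + b *: v)) =
     a * eta (setrow X k u) + b * eta (setrow X k v)) ->
  (forall X (k l : 'I_r), k != l -> row k X = row l X -> eta X = 0) -> Lambda eta.
Proof.
move=> L A; split=> // X Y Z k a b Xk Y' Z'.
rewrite -[X](setrow_row X k) Xk L.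
by congr (_ * eta _ + _ * eta _); apply/row_matrixP => i; rewrite row_setrow;
  case: eqP => [->//|/eqP ik]; case: (unliftP k i) ik => [j ->|->]; rewrite ?eqxx // => _;
  rewrite -!row_rowsub ?(row_rowsub (lift k)); move/row_matrixP: Y' => /(_ j);
  move/row_matrixP: Z' => /(_ j); rewrite !row_rowsub.
Qed.

Lemma Lambda_split r (eta : form R m r) (P Q : 'M[C]_m) : Lambda eta -> P + Q = 1%:M ->
  forall X k, eta X = eta (setrow X k (row k X *m P)) + eta (setrow X k (row k X *m Q)).
Proof. by move=> L PQ X k; rewrite -(Lambda_add L) -mulmxDr PQ mulmx1 setrow_row. Qed.

Lemma Lambda_sum r (eta : form R m r) : Lambda eta ->
  forall X k (J : finType) (c : J -> C) (u : J -> 'rV_m),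
  eta (setrow X k (\sum_j c j *: u j)) = \sum_j c j * eta (setrow X k (u j)).
Proof.
move=> L X k J c u; elim/big_rec2 : _ => [|j y v _ <-].
  by apply: (Lambda_row0 L (k := k)); rewrite row_setrow eqxx.
by have := Lambda_lin L X k (c j) 1 (u j) v; rewrite scale1r mul1r.
Qed.

Lemma row_row_perm r (X : 'M[C]_(r, m)) (s : 'S_r) i :
  row i (row_perm s X) = row (s i) X.
Proof. by apply/rowP => j; rewrite !mxE. Qed.

Lemma Lambda_swap r (eta : form R m r) : Lambda eta ->
  forall X (k l : 'I_r), k != l -> eta (row_perm (tperm k l) X) = - eta X.
Proof.
move=> L X k l kl.
have lk : l != k by rewrite eq_sym.
pose S u v := setrow (setrow X k u) l v.
have SE u v u' v' : eta (S (u + u') (v + v')) =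
   eta (S u v) + eta (S u v') + (eta (S u' v) + eta (S u' v')).
  have e x : S (u + u') x = setrow (setrow X l x) k (u + u').
    apply/row_matrixP => i; rewrite !row_setrow.
    by case: eqP => [->|//]; rewrite (negPf lk).
  have e' x y : S x y = setrow (setrow X l y) k x.
    apply/row_matrixP => i; rewrite !row_setrow.
    by case: eqP => [->|//]; rewrite (negPf lk).
  by rewrite e (Lambda_add L) -!e' {1 2}/S !(Lambda_add L).
have S0 u : eta (S u u) = 0.
  by apply: (Lambda_alt L kl); rewrite !row_setrow eqxx (negPf kl) !eqxx.
have := SE (row k X) (row k X) (row l X) (row l X).
rewrite !S0 addr0 add0r => /esym/eqP; rewrite addr_eq0 => /eqP.
have -> : S (row k X) (row l X) = X.
  by apply/row_matrixP => i; rewrite !row_setrow; case: eqP => [->//|_]; case: eqP => [->|].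
move=> ->; rewrite opprK; congr eta; apply/row_matrixP => i.
rewrite !row_setrow row_row_perm; case: tpermP => [->|->|].
- by rewrite (negPf kl) eqxx.
- by rewrite eqxx.
by move=> /eqP/negPf-> /eqP/negPf->.
Qed.

Lemma Lambda_perm r (eta : form R m r) : Lambda eta ->
  forall X (s : 'S_r), eta (row_perm s X) = (-1) ^+ s * eta X.
Proof.
move=> L X s; have [ts -> dts] := prod_tpermP s.
elim: ts dts X => [_|t ts IH] X.
  by rewrite big_nil row_perm1 odd_perm1 expr0 mul1r.
case/andP: X => t12 /IH{}IH X; rewrite big_cons row_permM.
rewrite /perm.dpair /= in t12.
by rewrite Lambda_swap // IH odd_permM odd_tperm t12 signr_addb expr1 mulN1r mulNr.
Qed.

(** The rows in [l] are expanded one after the other. Outside [l] the index function is forced to be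
    the identity, so that all stages sum over the same finite type of functions. *)
Lemma Lambda_expand r (eta : form R m r) : Lambda eta ->
  forall (U : 'M_r) X (l : seq 'I_r), uniq l -> forall Y,
  eta (\matrix_i (if i \in l then row i (U *m X) else row i Y)) =
  \sum_(f in family (fun i => if i \in l then predT else pred1 i))
     (\prod_(i <- l) U i (f i)) *
     eta (\matrix_i (if i \in l then row (f i) X else row i Y)).
Proof.
move=> L U X; elim=> [_ Y|k l IH /andP[kl ul] Y].
  rewrite (big_pred1 (finfun id)) => [|f]; last first.
    apply/familyP/eqP => [fE|-> i]; last by rewrite ffunE inE.
    by apply/ffunP => i; have := fE i; rewrite inE ffunE => /eqP.
  by rewrite big_nil mul1r; congr eta; apply/row_matrixP => i; rewrite !rowK.
have -> : (\matrix_i (if i \in k :: l then row i (U *m X) else row i Y)) =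
  setrow (\matrix_i (if i \in l then row i (U *m X) else row i Y)) k
    (\sum_j U k j *: row j X).
  apply/row_matrixP => i; rewrite row_setrow !rowK inE; case: eqP => [->|//].
  apply/rowP => j; rewrite !mxE summxE; apply: eq_bigr => q _; by rewrite !mxE.
rewrite (Lambda_sum L) (partition_big (fun f : {ffun 'I_r -> 'I_r} => f k) predT) //=.
apply: eq_bigr => j _.
have -> : setrow (\matrix_i (if i \in l then row i (U *m X) else row i Y)) k (row j X) =
  \matrix_i (if i \in l then row i (U *m X) else row i (setrow Y k (row j X))).
  apply/row_matrixP => i; rewrite !rowK; case: eqP => // ->.
  by rewrite (negPf kl).
rewrite (IH ul) big_distrr /=.
rewrite [RHS](reindex_onto (fun f : {ffun 'I_r -> 'I_r} => [ffun i => if i == k then j else f i])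
  (fun f : {ffun 'I_r -> 'I_r} => [ffun i => if i == k then k else f i])) /=; last first.
  move=> f /andP[_ /eqP fk]; apply/ffunP => i; rewrite !ffunE; case: eqP => // ->.
  by rewrite fk.
apply: eq_big => [f|f fF].
  rewrite ffunE eqxx eqxx andbT; apply/familyP/andP => [fF|[/familyP fF /eqP fE] i].
    split.
      apply/familyP => i; rewrite !ffunE inE; case: eqP => [//|_] /=; exact: fF.
    apply/eqP/ffunP => i; rewrite !ffunE; case: eqP => // ->.
    by have := fF k; rewrite (negPf kl) inE => /eqP->.
  have := fF i; rewrite !ffunE inE; case: eqP => [->|_] /=; last by [].
  by move=> _; rewrite (negPf kl) -fE !ffunE eqxx inE.
rewrite big_cons ffunE eqxx -mulrA; congr (_ * (_ * eta _)).
  rewrite big_seq [RHS]big_seq; apply: eq_bigr => i il; rewrite ffunE.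
  by case: eqP il kl => // -> ->.
apply/row_matrixP => i; rewrite !rowK inE ffunE; case: eqP => // ->.
by rewrite (negPf kl).
Qed.

Lemma Lambda_det r (eta : form R m r) : Lambda eta ->
  forall (U : 'M_r) X, eta (U *m X) = \det U * eta X.
Proof.
move=> L U X.
have -> : eta (U *m X) = \sum_(f : {ffun 'I_r -> 'I_r})
    (\prod_i U i (f i)) * eta (\matrix_i row (f i) X).
  have := Lambda_expand L U X (enum_uniq 'I_r) 0.
  have -> : \matrix_i (if i \in enum 'I_r then row i (U *m X) else row i 0) = U *m X.
    by apply/row_matrixP => i; rewrite rowK mem_enum.
  move=> ->; apply: eq_big => [f|f _].
    by rewrite inE; apply/familyP => i; rewrite mem_enum.
  rewrite big_enum; congr (_ * eta _).
  by apply/row_matrixP => i; rewrite !rowK mem_enum.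
rewrite (bigID (fun f : {ffun 'I_r -> 'I_r} => injectiveb f)) /= [X in _ + X]big1 ?addr0; last first.
  move=> f /injectivePn[i [j ij fij]].
  by rewrite (Lambda_alt L ij) ?mulr0 // !rowK fij.
rewrite /determinant big_distrl /=.
rewrite (reindex_onto (fun s : 'S_r => pval s) (fun f => insubd (1%g : 'S_r) f)) /=; last first.
  by move=> f fi; exact: (insubdK (1%g : 'S_r) fi).
apply: eq_big => [s|s _].
  by rewrite (valP s) (valKd (1%g : 'S_r) s) eqxx.
rewrite -mulrA mulrCA -(Lambda_perm L); congr (_ * eta _).
  by apply: eq_bigr => i _; rewrite pvalE.
by apply/row_matrixP => i; rewrite rowK row_row_perm pvalE.
Qed.

Lemma row_perm_setrow r (X : 'M[C]_(r, m)) (p : 'S_r) k v :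
  row_perm p (setrow X (p k) v) = setrow (row_perm p X) k v.
Proof.
by apply/row_matrixP => i; rewrite row_row_perm !row_setrow (inj_eq perm_inj) row_row_perm.
Qed.

Lemma usubmx_setrow r s (X : 'M[C]_(r + s, m)) k v :
  usubmx (setrow X k v) =
  if fintype.split k is inl i then setrow (usubmx X) i v else usubmx X.
Proof.
apply/row_matrixP => i; rewrite row_usubmx row_setrow.
by case: (split_ordP k) => j -> /=; rewrite ?eq_shift ?row_setrow row_usubmx.
Qed.

Lemma dsubmx_setrow r s (X : 'M[C]_(r + s, m)) k v :
  dsubmx (setrow X k v) =
  if fintype.split k is inr i then setrow (dsubmx X) i v else dsubmx X.
Proof.
apply/row_matrixP => i; rewrite row_dsubmx row_setrow.
by case: (split_ordP k) => j -> /=; rewrite ?eq_shift ?row_setrow row_dsubmx.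
Qed.

Lemma wedge_Lambda r s (alpha : form R m r) (beta : form R m s) :
  Lambda alpha -> Lambda beta -> Lambda (wedge alpha beta).
Proof.
move=> La Lb; apply: LambdaI => [X k a b u v|X k l kl Xkl].
  rewrite /wedge mulrCA [b * _]mulrCA -mulrDr; congr (_ * _).
  rewrite !big_distrr -big_split /=; apply: eq_bigr => p _.
  have [q ->] : exists q, k = p q by exists (p^-1%g k); rewrite permKV.
  rewrite !row_perm_setrow !usubmx_setrow !dsubmx_setrow.
  case: (fintype.split q) => j.
    by rewrite (Lambda_lin La) mulrDr mulrDl; congr (_ + _); rewrite mulrCA -!mulrA.
  by rewrite (Lambda_lin Lb) mulrDr; congr (_ + _); rewrite mulrCA.
rewrite /wedge [X in _ * X](_ : _ = 0) ?mulr0 //.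
set S := LHS; have : S = - S.
  rewrite {1}/S (reindex_inj (mulIg (tperm k l))) /= -sumrN.
  apply: eq_bigr => p _; rewrite odd_permM odd_tperm kl signr_addb expr1 mulrN1 !mulNr.
  suff -> : row_perm (p * tperm k l)%g X = row_perm p X by [].
  apply/row_matrixP => i; rewrite !row_row_perm permM.
  by case: tpermP => // ->.
by move/eqP; rewrite -addr_eq0 -mulr2n mulrn_eq0 => /eqP.
Qed.

Lemma wpow_Lambda r (alpha : form R m r) n : Lambda alpha -> Lambda (wpow alpha n).
Proof.
move=> La; elim: n => [|n IH] /=; last exact: wedge_Lambda.
by split=> [X Y Z []|X []].
Qed.

Lemma act_wedge r s U (alpha : form R m r) (beta : form R m s) X :
  wedge alpha beta (X *m U) = wedge (act U alpha) (act U beta) X.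
Proof.
congr (_ * _); apply: eq_bigr => p _.
by rewrite /act mul_usub_mx mul_dsub_mx !row_permE mulmxA.
Qed.

Lemma act_Lambda r U (alpha : form R m r) : Lambda alpha -> Lambda (act U alpha).
Proof.
have E (X : 'M[C]_(r, m)) k v : setrow X k v *m U = setrow (X *m U) k (v *m U).
  by apply/row_matrixP => i; rewrite row_mul !row_setrow row_mul; case: ifP.
move=> La; apply: LambdaI => [X k a b u v|X k l kl Xkl]; rewrite /act.
  by rewrite !E mulmxDl -!scalemxAl (Lambda_lin La).
by apply: (Lambda_alt La kl); rewrite !row_mul Xkl.
Qed.

Lemma wedge_scale r s (a b : C) (alpha alpha' : form R m r) (beta beta' : form R m s) :
  (forall X, alpha' X = a * alpha X) -> (forall X, beta' X = b * beta X) ->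
  forall X, wedge alpha' beta' X = a * b * wedge alpha beta X.
Proof.
move=> Ea Eb X; rewrite /wedge mulrCA; congr (_ * _).
rewrite big_distrr /=; apply: eq_bigr => p _; rewrite Ea Eb.
by rewrite -!mulrA (mulrCA _ a); congr (_ * _); rewrite (mulrCA _ b) (mulrCA _ b).
Qed.

Lemma act_wpow r U (alpha : form R m r) n X :
  wpow alpha n (X *m U) = wpow (act U alpha) n X.
Proof.
elim: n X => [//|n IH] X; rewrite [LHS]act_wedge [RHS]/=; congr wedge.
by apply/funext => Y; exact: IH.
Qed.

Lemma wpow_scale r (a : C) (alpha alpha' : form R m r) n :
  (forall X, alpha' X = a * alpha X) -> forall X, wpow alpha' n X = a ^+ n * wpow alpha n X.
Proof.
move=> Ea; elim: n => [|n IH] X; first by rewrite mul1r.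
by rewrite exprS; apply: wedge_scale.
Qed.

(** The wedge product of the covectors in the columns of [A]. *)
Definition detform r (A : 'M[C]_(m, r)) : form R m r := fun X => \det (X *m A).

Lemma detform_Lambda r (A : 'M[C]_(m, r)) : Lambda (detform A).
Proof.
have E (X : 'M[C]_(r, m)) k v : setrow X k v *m A = \matrix_i (if i == k then v *m A else row i (X *m A)).
  by apply/row_matrixP => i; rewrite row_mul !rowK row_mul; case: ifP.
apply: LambdaI => [X k a b u v|X k l kl Xkl]; rewrite /detform.
  apply: (determinant_multilinear (i0 := k)); rewrite !E.
  - by rewrite !rowK eqxx mulmxDl -!scalemxAl.
  - by apply/row_matrixP => i; rewrite !row_rowsub !rowK eq_sym (negPf (neq_lift _ _)).
  - by apply/row_matrixP => i; rewrite !row_rowsub !rowK eq_sym (negPf (neq_lift _ _)).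
apply: (determinant_alternate kl) => j.
have := congr1 (fun v => (v *m A) 0 j) Xkl; rewrite -!row_mul.
by rewrite !mxE.
Qed.

(** If both diagonal blocks are nonsingular, the permutation preserves the two blocks; its sign is
    then the product of the two determinants, and the left side is the square of a sign. *)
Lemma det_perm_blocks r s (p : 'S_(r + s)) :
  let P := perm_mx p : 'M[C]_(r + s) in
  (-1) ^+ p * \det (ulsubmx P) * \det (drsubmx P) =
  (\det (ulsubmx P) * \det (drsubmx P) != 0)%:R.
Proof.
move=> P; have [d0|nz] := eqVneq (\det (ulsubmx P) * \det (drsubmx P)) 0.
  by rewrite -mulrA d0 mulr0.
suff P0 : ursubmx P = 0.
  have E : \det P = \det (ulsubmx P) * \det (drsubmx P).
    by rewrite -{1}(submxK P) P0 det_lblock.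
  by rewrite -mulrA -E det_perm -signr_addb addbb.
apply/matrixP => i j; rewrite !mxE; case: (p (lshift s i) =P rshift r j) => [pij|//].
case/eqP: nz; rewrite (expand_det_row _ i) big1 ?mul0r // => k _.
by rewrite !mxE pij eq_rlshift mul0r.
Qed.

(** The ratio of a wedge of two determinant forms to the determinant form of the joined columns: a
    normalised count of block-preserving permutations. *)
Definition laplace r s : C :=
  (r`! * s`!)%:R^-1 * \sum_(p : 'S_(r + s))
   (\det (ulsubmx (perm_mx p : 'M[C]_(r + s))) * \det (drsubmx (perm_mx p : 'M[C]_(r + s))) != 0)%:R.

Lemma laplace_neq0 r s : laplace r s != 0.
Proof.
rewrite mulf_neq0 // ?invr_neq0 ?pnatr_eq0 -?lt0n ?muln_gt0 ?fact_gt0 //.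
rewrite -natr_sum pnatr_eq0 -lt0n (bigD1 (1%g : 'S_(r + s))) //= perm_mx1 (scalar_mx_block r s 1).
by rewrite block_mxKul block_mxKdr !det1 mulr1 oner_eq0.
Qed.

End Multilinear.

(** Both sides depend on [X] only through its product with [row_mx A B], a square matrix in whose
    rows they are alternating; [Lambda_det] then reduces the claim to the identity matrix. *)
Lemma wedge_detform (R : realType) m r s (A : 'M[R[i]]_(m, r)) (B : 'M_(m, s)) X :
  wedge (detform A) (detform B) X = laplace R r s * detform (row_mx A B) X.
Proof.
pose Y := X *m row_mx A B.
have -> : wedge (detform A) (detform B) X =
    wedge (detform (col_mx 1%:M 0 : 'M_(r + s, r))) (detform (col_mx 0 1%:M : 'M_(r + s, s))) Y.
  congr (_ * _); apply: eq_bigr => p _; rewrite /detform !mul_usub_mx !mul_dsub_mx.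
  rewrite /Y !row_permE -!mulmxA !mul_row_col !mulmx1 !mulmx0 addr0 add0r.
  by rewrite !mulmxA.
rewrite -[Y in LHS]mulmx1 Lambda_det; last by apply: wedge_Lambda; apply: detform_Lambda.
rewrite mulrC; congr (_ * _); congr (_ * _); apply: eq_bigr => p _.
rewrite /detform -det_perm_blocks !row_permE mulmx1.
by rewrite -{1 2}(submxK (perm_mx p)) block_mxEv col_mxKu col_mxKd !mul_row_col
  !mulmx1 !mulmx0 addr0 add0r.
Qed.

(** * Powers of a 2-form in Darboux form *)

Section Symplectic.
Variables (R : realType) (m n : nat).
Local Notation C := R[i].

Lemma half_ord_subproof k (i : 'I_(k * 2)) : (i./2 < k)%N.
Proof. by have := ltn_ord i; lia. Qed.

(* Row or column [j] of the symplectic pair number [k] sits at position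
   [2 k + j]; [unpair] sends this position to [k] or to [n + k]. *)
Definition unpair k (i : 'I_(k * 2)) : 'I_(k + k) :=
  let h := Ordinal (half_ord_subproof i) in if odd i then rshift k h else lshift k h.

Lemma unpair_inj k : injective (@unpair k).
Proof.
move=> i j; rewrite /unpair; case: ifP => oi; case: ifP => oj /(congr1 val) /= e;
  apply/val_inj => /=; move: e oi oj; have := ltn_ord i; have := ltn_ord j; lia.
Qed.

Lemma det_mxsub_bij (S : comNzRingType) a b (h : 'I_a -> 'I_b) (M : 'M[S]_b) :
  a = b -> injective h -> \det (mxsub h h M) = \det M.
Proof.
move=> e; subst b => hi.
have -> : mxsub h h M = row_perm (perm hi) (col_perm (perm hi) M).
  by apply/matrixP => i j; rewrite !mxE !permE.
rewrite row_permE col_permE !det_mulmx !det_perm odd_permV mulrCA -signr_addb addbb.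
by rewrite mulr1.
Qed.

Lemma wedge_sum r s (I J : finType) (alpha : I -> form R m r) (beta : J -> form R m s) X :
  wedge (fun Y => \sum_i alpha i Y) (fun Y => \sum_j beta j Y) X =
  \sum_i \sum_j wedge (alpha i) (beta j) X.
Proof.
under eq_bigr do rewrite -big_distrr /= exchange_big /=.
rewrite -big_distrr /= exchange_big /=; congr (_ * _); apply: eq_bigr => p _.
rewrite -mulrA big_distrl big_distrr /=; apply: eq_bigr => i _.
by rewrite mulrA big_distrr.
Qed.

Variables (L M : 'M[C]_(m, n)).

(** Tuples of pair indices, as iterated products that follow the recursion of [wpow]; [smx t] has
    the corresponding basis vectors as columns. *)
Fixpoint sidx k : finType :=
  if k is l.+1 then ('I_n * sidx l)%type : finType else unit : finType.

Fixpoint smx k : sidx k -> 'M[C]_(n, k) :=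
  if k is l.+1 return sidx k -> 'M[C]_(n, k)
  then fun t => row_mx (delta_mx t.1 0 : 'M_(n, 1)) (smx t.2) else fun=> 0.

(** The columns of [L] and [M] selected by [F], in alternation, so that the wedge product of all
    columns is a product of 2-forms L_a /\ M_a. *)
Definition pairmx k (F : 'M[C]_(n, k)) : 'M[C]_(m, k * 2) :=
  colsub (@unpair k) (row_mx (L *m F) (M *m F)).

Lemma pairmx_cons k a (F : 'M[C]_(n, k)) :
  pairmx (row_mx (delta_mx a 0 : 'M_(n, 1)) F : 'M_(n, k.+1)) =
  row_mx (row_mx (col a L) (col a M)) (pairmx F) :> 'M_(m, 2 + k * 2).
Proof.
have mulE (N : 'M_(m, n)) : N *m (row_mx (delta_mx a 0 : 'M_(n, 1)) F : 'M_(n, k.+1)) =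
    row_mx (col a N) (N *m F) by rewrite colE -(mul_mx_row N (delta_mx a 0) F).
apply/matrixP => i j; rewrite /pairmx [LHS]mxE !mulE.
pose u := @unpair k.+1 : 'I_(2 + k * 2) -> 'I_((1 + k) + (1 + k)).
rewrite -/u; pose sl := @lshift (1 + k) (1 + k); pose sr := @rshift (1 + k) (1 + k).
have [j' ->|j' ->] := split_ordP (j : 'I_(2 + k * 2)); rewrite ?row_mxEl ?row_mxEr.
  have [o ->|o ->] := split_ordP (j' : 'I_(1 + 1)).
    have -> : u (@lshift 2 (k * 2) (@lshift 1 1 o)) = sl (lshift k o).
      by apply/val_inj; rewrite /u /unpair /= (ord1 o).
    by rewrite /sl row_mxEl (row_mxEl (col a L) (L *m F)) (row_mxEl (col a L) (col a M)).
  have -> : u (@lshift 2 (k * 2) (@rshift 1 1 o)) = sr (lshift k o).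
    by apply/val_inj; rewrite /u /unpair /= (ord1 o).
  by rewrite /sr row_mxEr (row_mxEl (col a M) (M *m F)) (row_mxEr (col a L) (col a M)).
rewrite [RHS]mxE.
have [o oE|o oE] := split_ordP (unpair j'); rewrite oE.
  have -> : u (@rshift 2 (k * 2) j') = sl (rshift 1 o).
    apply/val_inj; move/(congr1 val): oE; rewrite /u /unpair /= negbK.
    by case: ifP => /=; have := ltn_ord o; lia.
  by rewrite /sl !row_mxEl (row_mxEr (col a L) (L *m F)).
have -> : u (@rshift 2 (k * 2) j') = sr (rshift 1 o).
  apply/val_inj; move/(congr1 val): oE; rewrite /u /unpair /= negbK.
  by case: ifP => /=; have := ltn_ord o; have := ltn_ord j'; lia.
by rewrite /sr !row_mxEr (row_mxEr (col a M) (M *m F)).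
Qed.

Lemma wpow_sum_detform (Om : form R m 2) :
  (forall X, Om X = \sum_a detform (row_mx (col a L) (col a M)) X) ->
  forall k, exists2 c : C, c != 0 &
    forall X, wpow Om k X = c * \sum_(t : sidx k) detform (pairmx (smx t)) X.
Proof.
move=> OmE; elim=> [|k [c c0 IH]].
  exists 1; rewrite ?oner_eq0 // => X.
  rewrite mul1r (bigD1 tt) //= big1 ?addr0; last by case.
  by rewrite /detform det_mx00.
exists (c * laplace R 2 (k * 2)); first by rewrite mulf_neq0 ?laplace_neq0.
move=> X; rewrite -mulrA big_distrr /=.
rewrite -(pair_big predT predT (fun a t => laplace R 2 (k * 2) * detform (pairmx (row_mx (delta_mx a 0 : 'M_(n, 1)) (smx t))) X)) /=.
under eq_bigr => a _ do under eq_bigr => t _ do rewrite pairmx_cons -wedge_detform.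
rewrite -wedge_sum -[c in RHS]mul1r; apply: wedge_scale => Y; first by rewrite mul1r OmE.
exact: IH.
Qed.

Lemma smx_surj k (f : 'I_k -> 'I_n) :
  exists t : sidx k, smx t = \matrix_(i, j) (i == f j)%:R.
Proof.
elim: k f => [|k IH] f; first by exists tt; apply/matrixP => ? [].
have [t tE] := IH (fun j => f (lift ord0 j)).
exists (f ord0, t); apply/matrixP => i j; rewrite [RHS]mxE /= tE [LHS]mxE.
case: (split_ordP (j : 'I_(1 + k))) => o -> /=; rewrite !mxE.
  by rewrite (ord1 o) eqxx andbT; congr (_ == f _)%:R; apply/val_inj.
by congr (_ == f _)%:R; apply/val_inj.
Qed.

Lemma smx_real k (t : sidx k) i j : smx t i j \is Num.real.
Proof.
elim: k t j => [|k IH] t j; first by case: j.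
rewrite mxE; case: (fintype.split _) => o /=; last exact: IH.
by rewrite mxE.
Qed.

(** On the interleaved dual basis the term of index [t] is the square of the real number
    [\det (smx t)]. No term is negative and the identity selection contributes 1, so the sum is
    nonzero. *)
Lemma wpow_symplectic (Om : form R m 2) (P Q : 'M[C]_(n, m)) :
  (forall X, Om X = \sum_a detform (row_mx (col a L) (col a M)) X) ->
  P *m L = 1%:M -> P *m M = 0 -> Q *m L = 0 -> Q *m M = 1%:M ->
  wpow Om n (rowsub (@unpair n) (col_mx P Q)) != 0.
Proof.
move=> OmE PL PM QL QM; have [c c0 ->] := wpow_sum_detform OmE n.
rewrite mulf_neq0 //.
have E (F : 'M[C]_n) : detform (pairmx F) (rowsub (@unpair n) (col_mx P Q)) = \det F ^+ 2.
  rewrite /detform /pairmx.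
  have -> : rowsub (@unpair n) (col_mx P Q) *m colsub (@unpair n) (row_mx (L *m F) (M *m F))
     = mxsub (@unpair n) (@unpair n) (block_mx F 0 0 F).
    rewrite -[in RHS](mul1mx F).
    have -> : block_mx (1%:M *m F) 0 0 (1%:M *m F) = col_mx P Q *m row_mx (L *m F) (M *m F).
      by rewrite mul_col_row !mulmxA PL PM QL QM !mul0mx.
    by apply/matrixP => i j; rewrite !mxE; apply: eq_bigr => k _; rewrite !mxE.
  rewrite det_mxsub_bij; [|lia|exact: unpair_inj].
  by rewrite det_ublock expr2.
under eq_bigr do rewrite E.
have [t tE] := smx_surj (@id 'I_n).
have sq_ge0 t' : 0 <= \det (smx t') ^+ 2 :> C.
  rewrite real_exprn_even_ge0 //; apply: rpred_sum => s _.
  by rewrite realM ?realX ?realN ?real1 //; apply: rpred_prod => i _; apply: smx_real.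
rewrite gt_eqF // (bigD1 t) //= ltr_pwDl ?sumr_ge0 //.
rewrite tE (_ : \matrix_(i, j) _ = 1%:M) ?det1 ?expr1n ?ltr01 //.
by apply/matrixP => i j; rewrite !mxE.
Qed.
End Symplectic.

(** * Binary forms, characters of the circle and powers of linear forms *)

Section BinaryForms.
Variable (R : realType).
Local Notation C := R[i].

Lemma coef0_of_roots k (c : 'I_k.+1 -> C) (w : nat -> C) : injective w ->
  (forall t, (t <= k)%N -> \sum_i c i * w t ^+ i = 0) -> forall i, c i = 0.
Proof.
move=> wi c0 i; pose p := \poly_(j < k.+1) c (inord j).
suff p0 : p = 0.
  have := coef_poly k.+1 (fun j => c (inord j)) i; rewrite -/p p0 coef0 ltn_ord.
  by rewrite inord_val.
apply: (roots_geq_poly_eq0 (rs := mkseq w k.+1)).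
- apply/allP => _ /mapP[t tk ->]; rewrite mem_iota /= add0n in tk.
  rewrite /root horner_poly -[X in _ == X](c0 t tk).
  by apply/eqP; apply: eq_bigr => j _; rewrite inord_val.
- by rewrite map_inj_uniq ?iota_uniq.
by rewrite size_mkseq size_poly.
Qed.

(** Points of the real unit circle with the distinct coordinate ratios 0, 1, 2, ..., enough to test
    homogeneous polynomials of every degree. *)
Lemma unit_pairs : exists s : nat -> R,
  forall t, s t != 0 /\ (t%:R / s t) ^+ 2 + (1 / s t) ^+ 2 = 1.
Proof.
exists (fun t => Num.sqrt (t%:R ^+ 2 + 1)) => t; set s := Num.sqrt _.
have lt0 : 0 < t%:R ^+ 2 + 1 :> R by rewrite ltr_wpDl ?sqr_ge0.
have s2 : s ^+ 2 = t%:R ^+ 2 + 1 by rewrite sqr_sqrtr // ltW.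
split; first by rewrite sqrtr_eq0 -ltNge.
by rewrite !expr_div_n -mulrDl s2 expr1n divff ?gt_eqF.
Qed.

Lemma homog_coef0 k (c : 'I_k.+1 -> C) (x y : nat -> C) :
  (forall t, y t != 0) -> injective (fun t => x t / y t) ->
  (forall t, \sum_i c i * (x t ^+ i * y t ^+ (k - i)) = 0) -> forall i, c i = 0.
Proof.
move=> y0 wi c0; apply: (coef0_of_roots wi) => t _.
apply: (mulIf (expf_neq0 k (y0 t))); rewrite mul0r -[RHS](c0 t) big_distrl /=.
apply: eq_bigr => i _; rewrite -mulrA expr_div_n; congr (_ * _).
have -> : y t ^+ k = y t ^+ i * y t ^+ (k - i) by rewrite -exprD subnKC // -ltnS.
by rewrite mulrA divfK ?expf_neq0.
Qed.

Lemma real_circle_coef0 k (c : 'I_k.+1 -> C) :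
  (forall x y : R, x ^+ 2 + y ^+ 2 = 1 ->
     \sum_i c i * (x%:C ^+ i * y%:C ^+ (k - i)) = 0) -> forall i, c i = 0.
Proof.
move=> c0.
have [s sE] := unit_pairs.
apply: (homog_coef0 (x := fun t => (t%:R / s t)%:C) (y := fun t => (1 / s t)%:C)) => [t|t u /=|t].
- by rewrite (inj_eq (@complexI R)) mulf_neq0 ?oner_eq0 ?invr_neq0; have [] := sE t.
- have [s0 _] := sE t; have [u0 _] := sE u.
  rewrite -!fmorph_div => /complexI/eqP; rewrite !invf_div !divr1 !divfK // eqr_nat.
  by move/eqP.
by apply: c0; have [_] := sE t.
Qed.

(** The monomials in z and its conjugate are distinct characters of the circle of unit complex
    numbers; the points of [unit_pairs] have distinct ratios of z to its conjugate. *)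
Lemma complex_circle_coef0 k (c : 'I_k.+1 -> C) :
  (forall x y : R, x ^+ 2 + y ^+ 2 = 1 ->
     \sum_i c i * ((x +i* y) ^+ i * (x -i* y) ^+ (k - i)) = 0) -> forall i, c i = 0.
Proof.
move=> c0.
have [s sE] := unit_pairs.
have y0 t : (1 / s t) -i* (t%:R / s t) != 0 :> C.
  apply/eqP => -[/eqP]; have [s0 _] := sE t.
  by rewrite mulf_eq0 oner_eq0 invr_eq0 (negPf s0).
apply: (homog_coef0 (x := fun t => (1 / s t) +i* (t%:R / s t))
                    (y := fun t => (1 / s t) -i* (t%:R / s t))) => [//|t u /eqP|t].
  rewrite eqr_div // => /eqP[_].
  have [s0 _] := sE t; have [u0 _] := sE u.
  move=> /eqP; rewrite -subr_eq0.
  have -> : 1 / s t * - (u%:R / s u) + t%:R / s t * (1 / s u) -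
    (1 / s u * - (t%:R / s t) + u%:R / s u * (1 / s t)) =
    (t%:R - u%:R) * (2 / (s t * s u)) by field; rewrite s0 u0.
  have /negPf nz : 2 / (s t * s u) != 0 by rewrite !(mulf_neq0, invr_neq0) // pnatr_eq0.
  rewrite mulf_eq0 nz orbF.
  by rewrite subr_eq0 eqr_nat => /eqP.
by apply: c0; have [_] := sE t; rewrite addrC.
Qed.

(** On the unit circle the two monomials are the characters of exponents a - b and a' - b'. If e > 0
    is the difference of the exponents, an e-th root of -1 lies on the circle and the characters
    take opposite values there. *)
Lemma weight_sep a b a' b' (c : C) :
  (forall x y : R, x ^+ 2 + y ^+ 2 = 1 ->
   (x +i* y) ^+ a * (x -i* y) ^+ b * c = (x +i* y) ^+ a' * (x -i* y) ^+ b' * c) ->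
  (a + b' != a' + b)%N -> c = 0.
Proof.
wlog ltab : a b a' b' / (a' + b < a + b')%N.
  move=> W E; rewrite neq_ltn => /orP[ltab|ltab].
    apply: (W _ _ _ _ ltab) => [x y xy|]; first by rewrite E.
    by rewrite neq_ltn ltab orbT.
  by apply: (W _ _ _ _ ltab) => //; rewrite neq_ltn ltab orbT.
move=> E _; pose e := (a + b' - (a' + b))%N.
have e0 : (0 < e)%N by rewrite subn_gt0.
pose z : C := e.-root (-1).
have ze : z ^+ e = -1 by rewrite rootCK.
have z1 : `|z| = 1.
  by apply/eqP; rewrite -(@pexpr_eq1 _ _ e) ?normr_ge0 // -normrX ze normrN normr1.
case: z ze z1 => x y ze; rewrite normc_def => /complexI /= s1.
have xy : x ^+ 2 + y ^+ 2 = 1.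
  by rewrite -[LHS]sqr_sqrtr ?addr_ge0 ?sqr_ge0 // s1 expr1n.
have zz : (x +i* y) * (x -i* y) = 1.
  by apply/eqP; rewrite eq_complex /= mulrN opprK -!expr2 xy mulrN mulrC addNr !eqxx.
have := E x y xy => /(congr1 (fun w => (x +i* y) ^+ (b + b') * w)).
have zb d d' f : (x +i* y) ^+ (d + d') * ((x +i* y) ^+ f * (x -i* y) ^+ d * c) =
    (x +i* y) ^+ (f + d') * c.
  rewrite !mulrA -!exprD (_ : d + d' + f = f + d' + d)%N; last by lia.
  by rewrite exprD -[_ * _ * (x -i* y) ^+ d]mulrA -exprMn zz expr1n mulr1.
rewrite zb [(b + b')%N]addnC zb (_ : a + b' = a' + b + e)%N; last by rewrite /e; lia.
rewrite exprD ze mulrN1 mulNr => /eqP.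
rewrite eq_sym -addr_eq0 -mulr2n mulrn_eq0 /= mulf_eq0 expf_eq0.
suff /negPf-> : (x +i* y) != 0 :> C by rewrite andbF => /eqP.
by apply/eqP => z0; have /eqP := zz; rewrite z0 mul0r eq_sym oner_eq0.
Qed.

Lemma binary_form_lin k z (u v : 'rV[C]_k.+1) w :
  binary_form (z *: u + v) w = z * binary_form u w + binary_form v w.
Proof.
rewrite /binary_form big_distrr -big_split /=; apply: eq_bigr => i _.
by rewrite !mxE !mulrDl !mulrA.
Qed.

Lemma binary_form_inj k (u v : 'rV[C]_k.+1) :
  (forall w, binary_form u w = binary_form v w) -> u = v.
Proof.
move=> E; apply/rowP => i; apply/eqP; rewrite -subr_eq0; apply/eqP.
move: i; apply: (coef0_of_roots (w := fun t => t%:R)) => [t s /eqP|t _].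
  by rewrite eqr_nat => /eqP.
rewrite [LHS](eq_bigr (fun i : 'I_k.+1 => u 0 i * t%:R ^+ i - v 0 i * t%:R ^+ i)); last first.
  by move=> i _; rewrite mulrBl.
have bE (x : 'rV[C]_k.+1) : \sum_i x 0 i * t%:R ^+ i =
    binary_form x (\row_j (if j == 0 then t%:R else 1)).
  by apply: eq_bigr => i _; rewrite !mxE /= expr1n mulr1.
by rewrite sumrB !bE E subrr.
Qed.

(** Coefficient vector of the k-th power of the linear form with coefficients [a]. *)
Definition pw k (a : 'rV[C]_2) : 'rV[C]_k.+1 :=
  \row_i ('C(k, i)%:R * a 0 0 ^+ i * a 0 1 ^+ (k - i)).

Lemma binary_form_pw k a v : binary_form (pw k a) v = (a *m v^T) 0 0 ^+ k.
Proof.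
rewrite mxE !big_ord_recl big_ord0 addr0 !mxE addrC.
rewrite exprDn; apply: eq_bigr => i _; rewrite !mxE.
rewrite (_ : lift ord0 ord0 = 1 :> 'I_2); last exact/val_inj.
rewrite -mulr_natl !exprMn; ring.
Qed.

Definition pt (l : nat) : 'rV[C]_2 := \row_j (if j == 0 then 1 else l%:R).

Definition pwmx k : 'M[C]_k.+1 := \matrix_l pw k (pt l).

(** A Vandermonde argument: a vector orthogonal to all rows gives a polynomial in l of degree at
    most k with the roots 0, ..., k. *)
Lemma pwmx_unit k : pwmx k \in unitmx.
Proof.
rewrite -unitmx_tr -row_free_unit -kermx_eq0; apply/rowV0P => v /sub_kermxP vW.
(* The index is reversed because the i-th coefficient of [pw k (pt l)] contains l to the power k -
   i. *)
have c0 : forall i, v 0 (rev_ord i) * 'C(k, rev_ord i)%:R = 0.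
  apply: (coef0_of_roots (w := fun t => t%:R)) => [t s /eqP|t tk].
    by rewrite eqr_nat => /eqP.
  have lt : (t < k.+1)%N by [].
  transitivity ((v *m (pwmx k)^T) 0 (Ordinal lt)); last by rewrite vW mxE.
  rewrite mxE (reindex_inj rev_ord_inj) /=; apply: eq_bigr => i _.
  rewrite rev_ordK !mxE /= expr1n mulr1 !subSS -mulrA subKn //.
  by rewrite -ltnS.
apply/rowP => i; have /eqP := c0 (rev_ord i).
rewrite rev_ordK mulf_eq0 pnatr_eq0 -leqn0 leqNgt bin_gt0 -ltnS ltn_ord /= orbF mxE.
by move/eqP.
Qed.

(* coordinates on the basis of the powers of the linear forms [v0 + l v1] *)
Definition pwcoord k (u : 'rV[C]_k.+1) : 'rV[C]_k.+1 := u *m invmx (pwmx k).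

Lemma pwcoordK k (u : 'rV[C]_k.+1) : u = \sum_l pwcoord u 0 l *: pw k (pt l).
Proof.
rewrite -{1}(mulmxKV (pwmx_unit k) u) mulmx_sum_row; apply: eq_bigr => l _.
by rewrite rowK.
Qed.

Lemma binary_form_sum k n (c : 'I_n -> C) (u : 'I_n -> 'rV[C]_k.+1) w :
  binary_form (\sum_l c l *: u l) w = \sum_l c l * binary_form (u l) w.
Proof.
elim/big_rec2 : _ => [|l x y _ <-]; last exact: binary_form_lin.
by rewrite /binary_form big1 // => i _; rewrite mxE !mul0r.
Qed.

(** The substitution v |-> v M on coefficient vectors. It is defined on the basis of powers, where
    it merely transforms the linear form, and extended linearly. *)
Definition substu k (M : 'M[C]_2) (u : 'rV[C]_k.+1) : 'rV[C]_k.+1 :=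
  \sum_l pwcoord u 0 l *: pw k (pt l *m M^T).

Lemma binary_form_substu k M (u : 'rV[C]_k.+1) v :
  binary_form (substu M u) v = binary_form u (v *m M).
Proof.
rewrite {2}(pwcoordK u) !binary_form_sum; apply: eq_bigr => l _.
by rewrite !binary_form_pw trmx_mul mulmxA.
Qed.

Definition e0 : 'rV[C]_2 := \row_j (if j == 0 then 1 else 0).
Definition e1 : 'rV[C]_2 := \row_j (if j == 0 then 0 else 1).

Lemma row2E (a : 'rV[C]_2) : a = a 0 0 *: e0 + a 0 1 *: e1.
Proof.
apply/rowP => j; rewrite !mxE; case: j => [[|[|//]]] jlt; rewrite -val_eqE /=.
  by rewrite mulr1 mulr0 addr0; congr (a 0 _); apply/val_inj.
by rewrite mulr1 mulr0 add0r; congr (a 0 _); apply/val_inj.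
Qed.

Lemma pw_e0 k : pw k e0 = delta_mx 0 ord_max.
Proof.
apply/rowP => i; rewrite !mxE /= [i == ord_max]eq_sym -val_eqE /=.
case: eqP => [<-|]; first by rewrite binn subnn expr0 expr1n !mulr1.
move=> ki; rewrite expr0n subn_eq0 leqNgt.
by rewrite (_ : i < k)%N ?mulr0 // ltn_neqAle eq_sym; apply/andP; split; [apply/eqP|rewrite -ltnS].
Qed.

Lemma su2_mx_real (x y : R) :
  su2_mx x 0 y 0 = \matrix_(i, j) (if i == j then x%:C else if i == 0 then y%:C else - y%:C).
Proof.
apply/matrixP => i j; rewrite !mxE; case: i => [[|[|//]]] ?; case: j => [[|[|//]]] ? //=.
  by rewrite -rmorphN.
by rewrite oppr0.
Qed.

(** Rotations by unit quaternions a0 + a2 J take [e0] to every real direction. Thus an equivariant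
    map on binary forms is determined by its value on the highest weight vector [pw k e0]. *)
Lemma pt_unit l : exists (s : C) (a0 a2 : R),
  unit_quat a0 0 a2 0 /\ pt l = s *: (e0 *m (su2_mx a0 0 a2 0)^T).
Proof.
have [s /(_ l)[s0 sl]] := unit_pairs.
exists (s l)%:C, (1 / s l), (- (l%:R / s l)); split.
  by rewrite /unit_quat expr0n sqrrN !addr0 addrC.
rewrite su2_mx_real; apply/rowP => j; rewrite !mxE !big_ord_recl !big_ord0 !mxE /=.
rewrite mul0r mul1r !addr0; case: j => [[|[|//]]] ? /=.
  by rewrite -rmorphM mul1r divff.
by rewrite rmorphN opprK -rmorphM mulrC divfK // rmorph_nat.
Qed.

End BinaryForms.

(** * Finite sums of forms *)

Section FiniteSums.
Variables (R : realType) (m r : nat).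
Local Notation C := R[i].
Local Open Scope classical_set_scope.
Implicit Types S : set (form R m r).

Lemma finite_sums0 S : finite_sums S (fun=> 0).
Proof.
exists 0, (fun=> fun=> 0); split=> [[]//|]; apply/funext => X.
by rewrite big_ord0.
Qed.

Lemma finite_sums1 S eta : S eta -> finite_sums S eta.
Proof.
move=> Se; exists 1, (fun=> eta); split=> //; apply/funext => X.
by rewrite big_ord1.
Qed.

Lemma finite_sumsD S alpha beta : finite_sums S alpha -> finite_sums S beta ->
  finite_sums S (fun X => alpha X + beta X).
Proof.
move=> [N [e [eS ->]]] [N' [e' [eS' ->]]].
exists (N + N')%N, (fun j => match fintype.split j with inl i => e i | inr i => e' i end).
split=> [j|]; first by case: (fintype.split j).
apply/funext => X; rewrite big_split_ord /=; congr (_ + _); apply: eq_bigr => j _.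
  by case: split_ordP => i /eqP; rewrite eq_shift // => /eqP->.
by case: split_ordP => i /eqP; rewrite eq_shift // => /eqP->.
Qed.

Lemma finite_sums_ind S (P : form R m r -> Prop) :
  P (fun=> 0) -> (forall alpha beta, P alpha -> P beta -> P (fun X => alpha X + beta X)) ->
  (forall eta, S eta -> P eta) -> forall eta, finite_sums S eta -> P eta.
Proof.
move=> P0 PD PS eta [N [e [eS ->]]].
elim: N e eS => [|N IH] e eS.
  by rewrite (_ : (fun X => _) = (fun=> 0)) //; apply/funext => X; rewrite big_ord0.
rewrite (_ : (fun X => _) = (fun X => e ord0 X + \sum_(j < N) e (lift ord0 j) X)).
  by apply: PD (PS _ (eS _)) (IH _ _).
by apply/funext => X; rewrite big_ord_recl.
Qed.

Lemma finite_sumsZ S z eta : (forall w alpha, S alpha -> S (fun X => w * alpha X)) ->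
  finite_sums S eta -> finite_sums S (fun X => z * eta X).
Proof.
move=> SZ; elim/finite_sums_ind => [|alpha beta Sa Sb|alpha Sa].
- by under eq_fun do rewrite mulr0; apply: finite_sums0.
- by under eq_fun do rewrite mulrDr; apply: finite_sumsD.
by apply: finite_sums1; apply: SZ.
Qed.

Lemma Lambda0 : @Lambda R m r (fun=> 0).
Proof. by split=> [*|//]; rewrite !mulr0 addr0. Qed.

Lemma LambdaD alpha beta : @Lambda R m r alpha -> @Lambda R m r beta ->
  @Lambda R m r (fun X => alpha X + beta X).
Proof.
move=> La Lb; apply: LambdaI => [X k a b u v|X k l kl Xkl].
  by rewrite (Lambda_lin La) (Lambda_lin Lb) !mulrDr addrACA.
by rewrite (Lambda_alt La kl) ?(Lambda_alt Lb kl) // addr0.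
Qed.

Lemma LambdaZ z alpha : @Lambda R m r alpha -> @Lambda R m r (fun X => z * alpha X).
Proof.
move=> La; apply: LambdaI => [X k a b u v|X k l kl Xkl].
  by rewrite (Lambda_lin La) mulrDr; congr (_ + _); rewrite mulrCA.
by rewrite (Lambda_alt La kl) // mulr0.
Qed.

End FiniteSums.

(** * The quaternions on the complexified tangent space *)

Section QuatRep.
Variables (R : realType) (m : nat) (I J K : 'M[R[i]]_m).
Local Notation C := R[i].
Hypotheses (hI : I *m I = - 1%:M) (hJ : J *m J = - 1%:M).
Hypotheses (hK : I *m J = K) (hJI : J *m I = - K).

Local Notation p10 := (proj10 I).
Local Notation p01 := (proj01 I).
Local Notation ii := ('i%C : C).

Lemma sqr_iC : ii * ii = -1.
Proof. by rewrite -expr2 sqr_i. Qed.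

Lemma complex_addE (x y : R) : x +i* y = x%:C + y%:C * ii.
Proof. by rewrite [LHS]complexE mulrC. Qed.

Lemma complex_subE (x y : R) : x -i* y = x%:C - y%:C * ii.
Proof. by rewrite complex_addE rmorphN mulNr. Qed.


Lemma proj10_addproj01 : p10 + p01 = 1%:M.
Proof.
rewrite /proj10 /proj01 -scalerDr addrACA addNr addr0 -mulr2n -[1%:M *+ 2]scaler_nat scalerA.
by rewrite mulVf ?scale1r // pnatr_eq0.
Qed.

Lemma proj10_mulI : p10 *m I = ii *: p10.
Proof.
rewrite /proj10 -scalemxAl mulmxBl mul1mx -scalemxAl hI scalerA mulrC -scalerA.
by congr (_ *: _); rewrite scalerBr scalerA sqr_iC scaleN1r opprK scalerN opprK addrC -scalemx1.
Qed.

Lemma mulI_proj10 : I *m p10 = ii *: p10.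
Proof. by rewrite -proj10_mulI /proj10 -scalemxAl -scalemxAr mulmxBl mulmxBr mul1mx mulmx1 -scalemxAl -scalemxAr. Qed.

Lemma proj01_mulI : p01 *m I = - (ii *: p01).
Proof.
rewrite /proj01 -scalemxAl mulmxDl mul1mx -scalemxAl hI scalerA mulrC -scalerA -scalerN.
by congr (_ *: _); rewrite scalerDr scalerA sqr_iC scaleN1r scalerN opprD opprK addrC -scalemx1.
Qed.

Lemma mulI_proj01 : I *m p01 = - (ii *: p01).
Proof. by rewrite -proj01_mulI /proj01 -scalemxAl -scalemxAr mulmxDl mulmxDr mul1mx mulmx1 -scalemxAl -scalemxAr. Qed.

Lemma proj10_id : p10 *m p10 = p10.
Proof.
rewrite {1}/proj10 -scalemxAl mulmxBl mul1mx -scalemxAl mulI_proj10 scalerA sqr_iC.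
rewrite scaleN1r opprK -mulr2n -[p10 *+ 2]scaler_nat scalerA.
by rewrite mulVf ?scale1r // pnatr_eq0.
Qed.

Lemma proj10_proj01 : p10 *m p01 = 0.
Proof. by have := congr1 (mulmx p10) proj10_addproj01; rewrite mulmxDr proj10_id mulmx1 => /(canRL (addKr _)); rewrite addNr. Qed.

Lemma proj01_id : p01 *m p01 = p01.
Proof. by have := congr1 (mulmx^~ p01) proj10_addproj01; rewrite mulmxDl proj10_proj01 mul1mx add0r. Qed.

Lemma proj10_mulJ : p10 *m J = J *m p01.
Proof.
rewrite /proj10 /proj01 -scalemxAl -scalemxAr mulmxBl mulmxDr mul1mx mulmx1 -scalemxAl -scalemxAr.
by rewrite hK hJI scalerN.
Qed.

Lemma proj01_mulJ : p01 *m J = J *m p10.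
Proof.
rewrite /proj10 /proj01 -scalemxAl -scalemxAr mulmxDl mulmxBr mul1mx mulmx1 -scalemxAl -scalemxAr.
by rewrite hK hJI scalerN opprK.
Qed.

Opaque proj10 proj01.

(* With [X = x + y J], [x] and [y] of type (1,0), one has [x = X *m p10] and
   [y = X *m yproj]; then [X *m ycomb a = a_0 x + a_1 y]. *)
Definition yproj : 'M[C]_m := - (p01 *m J).
Definition ycomb (a : 'rV[C]_2) : 'M[C]_m := a 0 0 *: p10 + a 0 1 *: yproj.

Lemma ycombE a : ycomb a = a 0 0 *: p10 + a 0 1 *: yproj.
Proof. by []. Qed.

Lemma yproj_p10 : yproj *m p10 = yproj.
Proof. by rewrite /yproj mulNmx -mulmxA -proj01_mulJ mulmxA proj01_id. Qed.

Lemma p10_yproj : p10 *m yproj = 0.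
Proof. by rewrite /yproj mulmxN mulmxA proj10_proj01 mul0mx oppr0. Qed.

Lemma yproj_yproj : yproj *m yproj = 0.
Proof. by rewrite -{1}yproj_p10 -mulmxA p10_yproj mulmx0. Qed.

Lemma yproj_J : yproj *m J = p01.
Proof. by rewrite /yproj mulNmx -mulmxA hJ mulmxN mulmx1 opprK. Qed.

Lemma quat_mul_p10 a0 a1 a2 a3 :
  quat_mx I J K a0 a1 a2 a3 *m p10 = (a0 +i* a1) *: p10 + ((- a2) +i* a3) *: yproj.
Proof.
have JE : J *m p10 = - yproj by rewrite /yproj opprK proj01_mulJ.
have KE : K *m p10 = ii *: yproj.
  by rewrite -hK -mulmxA JE mulmxN /yproj mulmxN opprK mulmxA mulI_proj01 mulNmx scalerN -(scalemxAl ii).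
rewrite /quat_mx !mulmxDl -!(scalemxAl (_%:C)) mul_scalar_mx mulI_proj10 JE KE !(scalerA (_%:C) ii) (scalerN _ yproj) -scaleNr.
by rewrite -scalerDl -addrA -scalerDl -rmorphN -!complex_addE.
Qed.

Lemma quat_mul_yproj a0 a1 a2 a3 :
  quat_mx I J K a0 a1 a2 a3 *m yproj = (a2 +i* a3) *: p10 + (a0 -i* a1) *: yproj.
Proof.
have IE : I *m yproj = - (ii *: yproj).
  by rewrite /yproj mulmxN mulmxA mulI_proj01 mulNmx scalerN -(scalemxAl ii).
have JE : J *m yproj = p10 by rewrite /yproj mulmxN mulmxA -proj10_mulJ -mulmxA hJ mulmxN mulmx1 opprK.
have KE : K *m yproj = ii *: p10 by rewrite -hK -mulmxA JE mulI_proj10.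
rewrite /quat_mx !mulmxDl -!(scalemxAl (_%:C)) mul_scalar_mx IE JE KE (scalerN _ (ii *: yproj)) !(scalerA (_%:C) ii) -(scaleNr (a1%:C * ii)).
by rewrite -(scalerDl yproj) -addrA -(scalerDl p10) -complex_addE -complex_subE addrC.
Qed.

(** The complexified tangent space is the tensor product of the (1,0)-space with the standard
    representation, and the coefficient pair [a] carries the latter. *)
Lemma quat_mul_ycomb a0 a1 a2 a3 a :
  quat_mx I J K a0 a1 a2 a3 *m ycomb a = ycomb (a *m (su2_mx a0 a1 a2 a3)^T).
Proof.
rewrite /ycomb mulmxDr -(scalemxAr (a 0 0)) -(scalemxAr (a 0 1)) quat_mul_p10 quat_mul_yproj !scalerDr !(scalerA (a 0 _)) addrACA -!scalerDl.
congr (_ *: _ + _ *: _); rewrite !mxE !big_ord_recl big_ord0 addr0 !mxE /=.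
  by rewrite (_ : lift ord0 ord0 = 1); [|exact/val_inj].
by rewrite (_ : lift ord0 ord0 = 1); [|exact/val_inj].
Qed.

Lemma p10_mul_quat a0 a1 a2 a3 :
  p10 *m quat_mx I J K a0 a1 a2 a3 = p10 *m ((a0 +i* a1)%:M + (a2 +i* a3) *: J).
Proof.
rewrite /quat_mx !mulmxDr -!(scalemxAr (_%:C)) !mul_mx_scalar proj10_mulI -hK mulmxA proj10_mulI.
rewrite -(scalemxAl ii) !(scalerA (_%:C) ii) -scalerDl -addrA -scalerDl.
by rewrite -!complex_addE -scalemxAr.
Qed.


Local Notation quat := (quat_mx I J K).

Lemma quat_complex x y : quat x y 0 0 = x%:C%:M + y%:C *: I.
Proof. by rewrite /quat_mx !scale0r !addr0. Qed.

Lemma unit_complex (x y : R) : x ^+ 2 + y ^+ 2 = 1 -> unit_quat x y 0 0.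
Proof. by rewrite /unit_quat => ->; rewrite expr0n /= !addr0. Qed.

Lemma quat_p10_ycomb a0 a1 a2 a3 :
  quat a0 a1 a2 a3 *m p10 = ycomb (e0 R *m (su2_mx a0 a1 a2 a3)^T).
Proof.
have {1}-> : p10 = ycomb (e0 R) by rewrite /ycomb !mxE /= scale1r scale0r addr0.
exact: quat_mul_ycomb.
Qed.

Lemma ycombZ z a : ycomb (z *: a) = z *: ycomb a.
Proof. by rewrite /ycomb !mxE scalerDr !(scalerA z). Qed.

(** * Types of arguments and characters of the circle *)

Section Weight.
Variables (r : nat) (eta : form R m r) (L : Lambda eta).

Lemma Lambda_scale (z : C) X : eta (z *: X) = z ^+ r * eta X.
Proof. by rewrite -mul_scalar_mx (Lambda_det L) det_scalar. Qed.

Lemma Lambda_rows (U : 'M[C]_m) :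
  (forall X k, eta (setrow X k (row k X *m U)) = eta X) ->
  forall X, eta (X *m U) = eta X.
Proof.
move=> E X; pose Y j := \matrix_k (if (k < j)%N then row k X *m U else row k X).
have YE j : eta (Y j) = eta X.
  elim: j => [|j <-]; first by congr eta; apply/row_matrixP => k; rewrite rowK.
  have [jr|rj] := ltnP j r; last first.
    congr eta; apply/row_matrixP => k; rewrite !rowK ltnS leq_eqVlt.
    by rewrite (ltn_eqF (leq_trans (ltn_ord k) rj)).
  rewrite -(E (Y j) (Ordinal jr)); congr eta; apply/row_matrixP => k.
  rewrite row_setrow !rowK ltnS leq_eqVlt -val_eqE /=.
  by case: eqP => [e|//] /=; rewrite ltnn (_ : Ordinal jr = k) //; apply/val_inj.
rewrite -(YE r); congr eta; apply/row_matrixP => k.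
by rewrite rowK ltn_ord row_mul.
Qed.

Section Pure.
(* [a] and [b] are the numbers of vectors of type (1,0) and (0,1) to which the
   weight of [eta] corresponds *)
Variables (a b : nat).
Hypothesis W : forall x y : R, x ^+ 2 + y ^+ 2 = 1 -> forall X,
  eta (X *m quat x y 0 0) = (x +i* y) ^+ a * (x -i* y) ^+ b * eta X.

Lemma p10_quat_complex x y : p10 *m quat x y 0 0 = (x +i* y) *: p10.
Proof.
rewrite quat_complex mulmxDr mul_mx_scalar -(scalemxAr y%:C) proj10_mulI (scalerA y%:C).
by rewrite -(scalerDl p10) -complex_addE.
Qed.

Lemma p01_quat_complex x y : p01 *m quat x y 0 0 = (x -i* y) *: p01.
Proof.
rewrite quat_complex mulmxDr mul_mx_scalar -(scalemxAr y%:C) proj01_mulI.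
by rewrite (scalerN _ (ii *: p01)) (scalerA y%:C) -(scaleNr (y%:C * ii)) -(scalerDl p01) -complex_subE.
Qed.

(** A unit complex number z scales the arguments of type (1,0) by z and those of type (0,1) by its
    conjugate; unless the value is zero, the resulting character must agree with the one prescribed
    by [W]. *)
Lemma weight_pure (t : 'I_r -> bool) X :
  (forall k, row k X *m (if t k then p10 else p01) = row k X) ->
  (#|[pred k | t k]| + b != #|[pred k | ~~ t k]| + a)%N -> eta X = 0.
Proof.
move=> pX ne; apply: (weight_sep (a := #|[pred k | t k]|) (b := #|[pred k | ~~ t k]|)
  (a' := a) (b' := b)); last by rewrite [X in _ != X]addnC.
move=> x y xy; rewrite -(W xy).
pose d := \row_k (if t k then x +i* y else x -i* y) : 'rV[C]_r.
have -> : X *m quat x y 0 0 = diag_mx d *m X.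
  apply/row_matrixP => k; rewrite !row_mul row_diag_mx -scalemxAl -rowE mxE.
  rewrite -[in LHS](pX k) -mulmxA; case: (t k) (pX k) => pXk.
    by rewrite p10_quat_complex -scalemxAr pXk.
  by rewrite p01_quat_complex -scalemxAr pXk.
rewrite (Lambda_det L) det_diag; congr (_ * _).
rewrite (bigID t) /=; congr (_ * _).
  by rewrite -prodr_const; apply: eq_big => [//|k]; rewrite inE mxE => ->.
by rewrite -prodr_const; apply: eq_big => [//|k]; rewrite inE mxE => /negPf->.
Qed.

Lemma weight_p10_eq0 X : (r + b != a)%N -> eta (X *m p10) = 0.
Proof.
move=> ne; apply: (weight_pure (t := xpredT)) => [k|].
  by rewrite row_mul -mulmxA proj10_id.
by rewrite [X in (X + b)%N]cardT size_enum_ord [X in (X + a)%N]eq_card0.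
Qed.

End Pure.

(** An argument of type (0,1) would lower the exponent of the character below [r]; hence only the
    (1,0)-parts of the arguments count. *)
Lemma highest_weight :
  (forall x y : R, x ^+ 2 + y ^+ 2 = 1 -> forall X,
     eta (X *m quat x y 0 0) = (x +i* y) ^+ r * eta X) ->
  forall X, eta (X *m p10) = eta X.
Proof.
move=> W.
have W' x y : x ^+ 2 + y ^+ 2 = 1 -> forall X,
    eta (X *m quat x y 0 0) = (x +i* y) ^+ r * (x -i* y) ^+ 0 * eta X.
  by move=> xy X; rewrite expr0 mulr1 W.
pose pure v := (v *m p10 == v) || (v *m p01 == v :> 'rV_m).
have pure0 X k0 : (forall k, pure (row k X)) -> row k0 X *m p01 = row k0 X -> eta X = 0.
  move=> pX X0; apply: (weight_pure W' (t := fun k => row k X *m p01 != row k X)) => [k|].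
    case: ifP => [/negPf n|/negbFE/eqP //].
    by have /orP[/eqP //|] := pX k; rewrite n.
  rewrite addn0 ltn_eqF // (leq_ltn_trans (max_card _)) // card_ord -[X in (X < _)%N]add0n.
  rewrite ltn_add2r; apply/card_gt0P; exists k0.
  by rewrite inE negbK X0.
have row0 X k0 : row k0 X *m p01 = row k0 X -> eta X = 0.
  (* Induction on the number [j] of leading rows that may be of mixed type; the last of them is
     split into its two parts. *)
  have : forall j (Y : 'M_(r, m)), (forall k : 'I_r, (j <= k)%N -> pure (row k Y)) ->
      row k0 Y *m p01 = row k0 Y -> eta Y = 0.
    elim=> [|j IH] Y pY Y0; first by apply: (pure0 _ k0) => // k; apply: pY.
    have [jr|rj] := ltnP j r; last first.
      by apply: IH => // k jk; have := ltn_ord k; rewrite ltnNge (leq_trans rj jk).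
    pose o := Ordinal jr.
    have [ok|ok] := eqVneq o k0.
      apply: IH => // k; rewrite leq_eqVlt => /orP[/eqP jk|]; last exact: pY.
      by rewrite (_ : k = k0) /pure ?Y0 ?eqxx ?orbT // -ok; apply/val_inj.
    have IHo P : (forall v, pure (v *m P)) -> eta (setrow Y o (row o Y *m P)) = 0.
      move=> pP; apply: IH => [k|]; last by rewrite row_setrow eq_sym (negPf ok).
      rewrite row_setrow leq_eqVlt -val_eqE /= [k == _ :> nat]eq_sym; case: eqP => //= _.
      exact: pY.
    rewrite (Lambda_split L proj10_addproj01 Y o) [X in X + _]IHo => [|v].
      rewrite add0r; apply: IHo => v.
      by apply/orP; right; rewrite -mulmxA proj01_id eqxx.
    by apply/orP; left; rewrite -mulmxA proj10_id eqxx.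
  by move=> /(_ r X); apply => k rk; have := ltn_ord k; rewrite ltnNge rk.
apply: Lambda_rows => X k.
rewrite (Lambda_split L proj10_addproj01 X k) [X in _ + X](row0 _ k) ?addr0 //.
by rewrite row_setrow eqxx -mulmxA proj01_id.
Qed.
End Weight.

(** * Equivariant maps from binary forms to r-forms *)

Section Equivariant.
Variables (r k : nat) (T : 'rV[C]_k.+1 -> form R m r).
Hypothesis T_lin : forall z u v, T (z *: u + v) = (fun X => z * T u X + T v X).
Hypothesis T_act : forall a0 a1 a2 a3 u u', unit_quat a0 a1 a2 a3 ->
  (forall v, binary_form u' v = binary_form u (v *m su2_mx a0 a1 a2 a3)) ->
  T u' = act (quat a0 a1 a2 a3) (T u).

Lemma T_0 X : T 0 X = 0.
Proof.
have /(congr1 (fun f : form R m r => f X))/= := T_lin 1 0 0.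
by rewrite scaler0 add0r mul1r => /eqP; rewrite -subr_eq0 opprD addNKr oppr_eq0 => /eqP.
Qed.

Lemma T_sum N (c : 'I_N -> C) (u : 'I_N -> 'rV_k.+1) X :
  T (\sum_l c l *: u l) X = \sum_l c l * T (u l) X.
Proof.
elim/big_rec2 : _ => [|l x y _ <-]; first exact: T_0.
by rewrite T_lin.
Qed.

Lemma T_scale z u X : T (z *: u) X = z * T u X.
Proof. by rewrite -[z *: u]addr0 T_lin T_0 addr0. Qed.

Lemma T_delta u X : T u X = \sum_i u 0 i * T (delta_mx 0 i) X.
Proof. by rewrite {1}(row_sum_delta u) T_sum. Qed.

Lemma T_pw (a0 a1 a2 a3 : R) (a : 'rV[C]_2) X : unit_quat a0 a1 a2 a3 ->
  T (pw k (a *m (su2_mx a0 a1 a2 a3)^T)) X = T (pw k a) (X *m quat a0 a1 a2 a3).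
Proof.
move=> q1; rewrite (T_act (u := pw k a) q1) // => v.
by rewrite !binary_form_pw trmx_mul mulmxA.
Qed.

Lemma binary_form_diag (x y : R) (u : 'rV[C]_k.+1) v :
  binary_form (\row_i (u 0 i * ((x +i* y) ^+ i * (x -i* y) ^+ (k - i))) : 'rV_k.+1) v =
  binary_form u (v *m su2_mx x y 0 0).
Proof.
apply: eq_bigr => i _; rewrite !mxE !big_ord_recl !big_ord0 !mxE /= oppr0.
rewrite (_ : lift ord0 ord0 = 1 :> 'I_2); last exact/val_inj.
rewrite (_ : 0 +i* 0 = 0 :> C) // !mulr0 !addr0 add0r !exprMn.
rewrite -![v 0 ord0]/(v 0 0); move: (v 0 0 ^+ i) (v 0 1 ^+ _) (_ ^+ i) (_ ^+ (k - i)) => *; ring.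
Qed.

Lemma T_diag (x y : R) i X : x ^+ 2 + y ^+ 2 = 1 ->
  T (delta_mx 0 i) (X *m quat x y 0 0) =
  (x +i* y) ^+ i * (x -i* y) ^+ (k - i) * T (delta_mx 0 i) X.
Proof.
move=> xy; rewrite -T_scale.
rewrite -[LHS]/(act (quat x y 0 0) (T (delta_mx 0 i)) X).
rewrite -(T_act (unit_complex xy) (binary_form_diag x y (delta_mx 0 i))).
congr (T _ X); apply/rowP => j; rewrite !mxE /=.
by case: eqP => [->|_]; rewrite ?mul0r ?mulr0 ?mul1r ?mulr1.
Qed.

(** The circle acts on the monomials by distinct characters, so that the kernel of [T] contains
    every monomial occurring in one of its elements. *)
Lemma T_coef0 u : (forall X, T u X = 0) -> forall i X, u 0 i != 0 -> T (delta_mx 0 i) X = 0.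
Proof.
move=> u0 i X; suff : u 0 i * T (delta_mx 0 i) X = 0.
  by move/eqP; rewrite mulf_eq0 => /orP[->//|/eqP].
move: i; apply: complex_circle_coef0 => x y xy.
transitivity (T (\row_i (u 0 i * ((x +i* y) ^+ i * (x -i* y) ^+ (k - i)))) X).
  by rewrite T_delta; apply: eq_bigr => i _; rewrite mxE mulrAC.
by rewrite (T_act (unit_complex xy) (binary_form_diag x y u)) /act u0.
Qed.

Lemma binary_form_delta i v :
  binary_form (delta_mx 0 i : 'rV[C]_k.+1) v = v 0 0 ^+ i * v 0 1 ^+ (k - i).
Proof.
rewrite /binary_form (bigD1 i) //= big1 ?addr0 => [|j ji].
  by rewrite mxE !eqxx mul1r.
by rewrite mxE eqxx (negPf ji) !mul0r.
Qed.

Lemma pw_scale z a : pw k (z *: a) = z ^+ k *: pw k a :> 'rV[C]_k.+1.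
Proof.
apply/rowP => i; rewrite !mxE !exprMn.
have ik : (i <= k)%N by rewrite -ltnS.
have -> : z ^+ k = z ^+ i * z ^+ (k - i) by rewrite -exprD subnKC.
move: (a 0 0 ^+ i) (a 0 1 ^+ _) (z ^+ i) (z ^+ _) 'C(k, i)%:R => *; ring.
Qed.

Lemma binary_form_10 (u : 'rV[C]_k.+1) :
  binary_form u (e0 R) = u 0 ord_max.
Proof.
rewrite /binary_form (bigD1 ord_max) //= big1 ?addr0 => [|i ik].
  by rewrite !mxE /= expr1n subnn expr0 !mulr1.
rewrite !mxE /= [X in _ * X]expr0n subn_eq0 leqNgt.
rewrite (_ : i < k)%N ?mulr0 // ltn_neqAle -[(i <= k)%N]ltnS ltn_ord andbT.
by move: ik; rewrite -val_eqE.
Qed.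

(** Irreducibility of S^k(V_1): a nonzero kernel contains a monomial, then the highest weight vector
    by a rotation, then all powers of the linear forms [pt l], and these span. *)
Lemma T_inj_or_zero : (forall u, (forall X, T u X = 0) -> u = 0) \/ (forall u X, T u X = 0).
Proof.
case: (pselect (forall u, (forall X, T u X = 0) -> u = 0)) => [|/existsNP[u]]; first by left.
move=> /not_implyP[Tu /eqP u0]; right.
have [i ui] : exists i, u 0 i != 0.
  apply/existsP; apply: contraNT u0 => /existsPn u0; apply/eqP/rowP => i.
  by rewrite mxE; apply/eqP; have := u0 i; rewrite negbK.
have Tk X : T (delta_mx 0 ord_max) X = 0.
  (* Any rotation without zero entries serves: the coefficient of v0^k in the rotated monomial is
     (3/5)^i (4/5)^(k-i). *)
  have q1 : @unit_quat R (3 / 5) 0 (4 / 5) 0 by rewrite /unit_quat; field.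
  pose u' := substu (su2_mx (3 / 5) 0 (4 / 5) 0) (delta_mx 0 i : 'rV[C]_k.+1).
  apply: (T_coef0 (u := u')) => [Y|].
    rewrite (T_act q1 (binary_form_substu _ _)) /act; exact: (T_coef0 Tu _ ui).
  rewrite -binary_form_10 binary_form_substu binary_form_delta su2_mx_real.
  rewrite !mxE !big_ord_recl !big_ord0 !mxE /= !mul1r !mul0r !addr0.
  by rewrite mulf_neq0 ?expf_neq0 // (inj_eq (@complexI R)) mulf_neq0 ?invr_neq0 ?pnatr_eq0.
have Tpt l X : T (pw k (pt R l)) X = 0.
  have [s [a0 [a2 [q1 ->]]]] := pt_unit R l.
  by rewrite pw_scale T_scale (T_pw _ _ q1) pw_e0 Tk mulr0.
move=> v X; rewrite {1}(pwcoordK v) T_sum big1 // => l _; by rewrite Tpt mulr0.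
Qed.

Hypothesis T_Lambda : forall u, Lambda (T u).

(** The i-th monomial has the character of exponent 2i - k, whereas r arguments of type (1,0) have
    exponent r; the condition forces 2i - k < r. *)
Lemma T_p10_eq0 (i : 'I_k.+1) X :
  (i + k < r + k)%N || (i < k)%N && (k <= r)%N -> T (delta_mx 0 i) (X *m p10) = 0.
Proof.
move=> ir; apply: (weight_p10_eq0 (T_Lambda _) (a := i) (b := k - i)) => [x y xy Y|].
  exact: T_diag.
by have := ltn_ord i; move: ir; lia.
Qed.

End Equivariant.

(** * Representations of the highest possible weight r *)

Section TopWeight.
Variables (r : nat) (T : 'rV[C]_r.+1 -> form R m r).
Hypothesis T_lin : forall z u v, T (z *: u + v) = (fun X => z * T u X + T v X).
Hypothesis T_act : forall a0 a1 a2 a3 u u', unit_quat a0 a1 a2 a3 ->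
  (forall v, binary_form u' v = binary_form u (v *m su2_mx a0 a1 a2 a3)) ->
  T u' = act (quat a0 a1 a2 a3) (T u).
Hypothesis T_Lambda : forall u, Lambda (T u).
Local Notation top := (T (delta_mx 0 ord_max)).

Lemma T_top_p10 X : top (X *m p10) = top X.
Proof.
apply: (highest_weight (T_Lambda _)) => x y xy Y.
by rewrite (T_diag T_lin T_act) //= subnn expr0 mulr1.
Qed.

(** Passage from the compact group to a complex matrix: [pt l] is s times a rotation of [e0], and
    the scalar s^r coming from the power is absorbed by the r arguments of [top]. *)
Lemma T_pt l X : T (pw r (pt R l)) X = top (X *m ycomb (pt R l)).
Proof.
have [s [a0 [a2 [q1 ->]]]] := pt_unit R l.
rewrite pw_scale (T_scale T_lin) (T_pw T_act _ _ q1) pw_e0 -T_top_p10 -mulmxA.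
by rewrite quat_p10_ycomb ycombZ -scalemxAr (Lambda_scale (T_Lambda _)).
Qed.

Lemma T_ycomb u X :
  T u X = \sum_l pwcoord u 0 l * top (X *m ycomb (pt R l)).
Proof. by rewrite {1}(pwcoordK u) (T_sum T_lin); under eq_bigr do rewrite T_pt. Qed.

(** On arguments of type (1,0) only the top coefficient survives; after the rotation it is the value
    of the binary form [u] at the first row of [su2_mx a0 a1 a2 a3]. *)
Lemma T_p10_quat a0 a1 a2 a3 u X : unit_quat a0 a1 a2 a3 ->
  T u (X *m p10 *m quat a0 a1 a2 a3) =
  \sum_i u 0 i * ((a0 +i* a1) ^+ i * (a2 +i* a3) ^+ (r - i)) * top X.
Proof.
move=> q1; pose u' := substu (su2_mx a0 a1 a2 a3) u.
transitivity (T u' (X *m p10)); first by rewrite (T_act q1 (binary_form_substu _ _)).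
rewrite (T_delta T_lin) (bigD1 ord_max) //= big1 ?addr0 => [|i ir]; last first.
  rewrite (T_p10_eq0 T_lin T_act T_Lambda) ?mulr0 // leqnn andbT orbC.
  by rewrite ltn_neqAle -[(i <= r)%N]ltnS ltn_ord andbT ir.
rewrite T_top_p10 -binary_form_10 binary_form_substu -big_distrl; congr (_ * _).
apply: eq_bigr => i _; rewrite !mxE !big_ord_recl !big_ord0 !mxE /=.
by rewrite !mul1r !mul0r !addr0 mulrA.
Qed.

End TopWeight.

(** * Decomposition of r-forms into weights, and the projection *)

Section Decomposition.
Variable r : nat.
Local Open Scope classical_set_scope.

Definition irreps k : set (form R m r) :=
  \bigcup_(V in [set V | irrep_of_weight I J K k V]) V.

Lemma irrepsZ k z eta : irreps k eta -> irreps k (fun X => z * eta X).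
Proof. by move=> [V kV Ve]; exists V => //; have [[_ _ _ VZ _] _] := kV; apply: VZ. Qed.

Lemma irreps_Lambda k eta : irreps k eta -> Lambda eta.
Proof. by move=> [V [[VL _ _ _ _] _] Ve]; apply: VL. Qed.

Lemma finite_irreps_Lambda k eta : finite_sums (irreps k) eta -> Lambda eta.
Proof.
elim/finite_sums_ind => [|alpha beta|alpha]; [exact: Lambda0|exact: LambdaD|].
exact: irreps_Lambda.
Qed.

(** Turns the union in [Lambda_plus] into a space of finite sums: the sum of all irreducibles of
    weight r is a member of the union and contains the others. *)
Lemma has_weight_irreps k : has_weight I J K k (finite_sums (irreps k)).
Proof.
split.
  split.
  - by move=> eta; apply: finite_irreps_Lambda.
  - exact: finite_sums0.
  - by move=> alpha beta; apply: finite_sumsD.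
  - by move=> z alpha; apply: finite_sumsZ => w beta; apply: irrepsZ.
  move=> a0 a1 a2 a3 alpha q1; elim/finite_sums_ind => [|beta gamma|beta [V kV Vb]].
  - exact: finite_sums0.
  - exact: finite_sumsD.
  apply: finite_sums1; exists V => //; have [[_ _ _ _ Va] _] := kV; exact: Va.
apply/seteqP; split=> eta.
  elim/finite_sums_ind => [|beta gamma|beta [V kV Vb]].
  - exact: finite_sums0.
  - exact: finite_sumsD.
  apply: finite_sums1; exists V => //; split=> // gamma Vg.
  by apply: finite_sums1; exists V.
elim/finite_sums_ind => [|beta gamma|beta [V [kV _] Vb]].
- exact: finite_sums0.
- exact: finite_sumsD.
by apply: finite_sums1; exists V.
Qed.

Lemma Lambda_plus_irreps eta : Lambda_plus I J K eta <-> finite_sums (irreps r) eta.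
Proof.
split=> [[W [_ WE] We]|]; last by exists (finite_sums (irreps r)) => //; apply: has_weight_irreps.
move: We; rewrite WE; elim/finite_sums_ind => [|beta gamma|beta [V [kV _] Vb]].
- exact: finite_sums0.
- exact: finite_sumsD.
by apply: finite_sums1; exists V.
Qed.

Lemma Lambda_lower_irreps k eta : (k < r)%N -> irreps k eta -> Lambda_lower I J K eta.
Proof.
move=> kr ke; apply: finite_sums1; exists (finite_sums (irreps k)).
  by exists k => //; apply: has_weight_irreps.
exact: finite_sums1.
Qed.

Definition weight_le f : set (form R m r) :=
  finite_sums (\bigcup_(k in [set k | (k <= f)%N]) irreps k).

Lemma weight_leZ f z eta : weight_le f eta -> weight_le f (fun X => z * eta X).
Proof. by apply: finite_sumsZ => w alpha [k kf ka]; exists k => //; apply: irrepsZ. Qed.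

Lemma weight_leD f alpha beta : weight_le f alpha -> weight_le f beta ->
  weight_le f (fun X => alpha X + beta X).
Proof. exact: finite_sumsD. Qed.

Lemma weight_leW f f' eta : (f <= f')%N -> weight_le f eta -> weight_le f' eta.
Proof.
move=> ff; elim/finite_sums_ind => [|beta gamma|beta [k kf kb]].
- exact: finite_sums0.
- exact: finite_sumsD.
by apply: finite_sums1; exists k => //; apply: leq_trans ff.
Qed.

(** By [T_inj_or_zero] the image of [T] is either zero or isomorphic to S^k(V_1). *)
Lemma weight_le_T k (T : 'rV[C]_k.+1 -> form R m r) :
  (forall z u v, T (z *: u + v) = (fun X => z * T u X + T v X)) ->
  (forall a0 a1 a2 a3 u u', unit_quat a0 a1 a2 a3 ->
    (forall v, binary_form u' v = binary_form u (v *m su2_mx a0 a1 a2 a3)) ->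
    T u' = act (quat a0 a1 a2 a3) (T u)) ->
  (forall u, Lambda (T u)) -> forall u, weight_le k (T u).
Proof.
move=> Tlin Tact TL u; have [Tinj|T0] := T_inj_or_zero Tlin Tact; last first.
  by rewrite (_ : T u = fun=> 0); [exact: finite_sums0|apply/funext => X; apply: T0].
apply: finite_sums1; exists k; first by rewrite /= leqnn.
exists (range T); last by exists u.
split.
  split.
  - by move=> _ [v _ <-].
  - by exists 0 => //; apply/funext => X; rewrite (T_0 Tlin).
  - by move=> _ _ [v _ <-] [w _ <-]; exists (1 *: v + w) => //; rewrite Tlin; under eq_fun do rewrite mul1r.
  - by move=> z _ [v _ <-]; exists (z *: v) => //; apply/funext => X; rewrite (T_scale Tlin).
  - move=> a0 a1 a2 a3 _ q1 [v _ <-]; exists (substu (su2_mx a0 a1 a2 a3) v) => //.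
    by rewrite (Tact _ _ _ _ _ _ q1 (binary_form_substu _ _)).
exists T; split=> // v w Tvw.
have : T (-1 *: w + v) = fun=> 0.
  by rewrite Tlin Tvw; apply/funext => X; rewrite mulN1r addNr.
move=> E; have := Tinj (-1 *: w + v) (fun X => congr1 (fun f : form R m r => f X) E).
by rewrite scaleN1r => /eqP; rewrite addrC subr_eq0 => /eqP.
Qed.

(** An equivariant multilinear map from f copies of V_1 to r-forms, given by its values on lists of
    f vectors; with lists, arguments can be inserted without a change of type. Values on lists of
    other lengths are unconstrained. *)
Record tensor_map f (G : seq 'rV[C]_2 -> form R m r) : Prop := TensorMap {
  tm_Lambda : forall s, size s = f -> Lambda (G s);
  tm_lin : forall s t a u v X, (size s + size t).+1 = f ->
    G (s ++ (a *: u + v) :: t) X = a * G (s ++ u :: t) X + G (s ++ v :: t) X;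
  tm_act : forall a0 a1 a2 a3 s X, unit_quat a0 a1 a2 a3 -> size s = f ->
    G s (X *m quat a0 a1 a2 a3) = G [seq v *m (su2_mx a0 a1 a2 a3)^T | v <- s] X }.

(** Inserts the SU(2)-invariant tensor of V_1 with itself, [e0] times [e1] minus [e1] times [e0], at
    position [p]. *)
Definition contract p (G : seq 'rV[C]_2 -> form R m r) u : form R m r :=
  fun X => G (take p u ++ [:: e0 R, e1 R & drop p u]) X
         - G (take p u ++ [:: e1 R, e0 R & drop p u]) X.

Lemma tm_row2 f G : tensor_map f G -> forall s t a X, (size s + size t).+1 = f ->
  G (s ++ a :: t) X = a 0 0 * G (s ++ e0 R :: t) X + a 0 1 * G (s ++ e1 R :: t) X.
Proof.
move=> tG s t a X st; rewrite {1}(row2E a) (tm_lin tG _ _ _ _ st); congr (_ + _).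
have G0 : G (s ++ 0 :: t) X = 0.
  have := tm_lin tG 1 0 0 X st; rewrite scaler0 addr0 mul1r => /eqP.
  by rewrite -subr_eq0 opprD addNKr oppr_eq0 => /eqP.
by have := tm_lin tG (a 0 1) (e1 R) 0 X st; rewrite G0 !addr0.
Qed.

Lemma det_su2 a0 a1 a2 a3 : unit_quat a0 a1 a2 a3 ->
  let M := (su2_mx a0 a1 a2 a3)^T in
  (e0 R *m M) 0 0 * (e1 R *m M) 0 1 - (e0 R *m M) 0 1 * (e1 R *m M) 0 0 = 1.
Proof.
move=> q1 M; rewrite !mxE !big_ord_recl !big_ord0 !mxE /= !mul1r !mul0r !addr0 !add0r.
apply/eqP; rewrite eq_complex /=; move: q1; rewrite /unit_quat => q1.
by apply/andP; split; apply/eqP; [rewrite -q1|]; ring.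
Qed.

Lemma contract_tensor_map f p G : (p <= f)%N ->
  tensor_map f.+2 G -> tensor_map f (contract p G).
Proof.
move=> pf tG.
have sz (u : seq 'rV[C]_2) a b : size u = f -> size (take p u ++ [:: a, b & drop p u]) = f.+2.
  by move=> uf; rewrite size_cat /= !addnS -size_cat cat_take_drop uf.
split.
- move=> s sf; rewrite /contract.
  have := LambdaD (tm_Lambda tG (sz s (e0 R) (e1 R) sf))
    (LambdaZ (-1) (tm_Lambda tG (sz s (e1 R) (e0 R) sf))).
  by under eq_fun do rewrite mulN1r.
- move=> s t a u v X st; rewrite /contract.
  have [ps|sp] := leqP p (size s).
    have dE w : drop p (s ++ w) = drop p s ++ w.
      rewrite drop_cat; case: ltnP => // sp; rewrite (_ : p - size s = 0)%N; last by lia.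
      by rewrite drop0 drop_oversize.
    rewrite !takel_cat // !dE.
    have E x y z : take p s ++ [:: x, y & drop p s ++ z :: t] =
        (take p s ++ [:: x, y & drop p s]) ++ z :: t by rewrite -catA.
    have szs x y : size (take p s ++ [:: x, y & drop p s]) = (size s).+2.
      by rewrite size_cat /= !addnS -size_cat cat_take_drop.
    rewrite !E !(tm_lin tG) ?szs /= -?st //; ring.
  have [q pq] : exists q, p = (size s + q.+1)%N by exists (p - (size s).+1)%N; lia.
  have E z : take p (s ++ z :: t) = s ++ z :: take q t.
    by rewrite pq take_cat ltnNge leq_addr /= addKn.
  have E' z : drop p (s ++ z :: t) = drop q t.
    by rewrite pq drop_cat ltnNge leq_addr /= addKn.
  have szt x y : size (take q t ++ [:: x, y & drop q t]) = (size t).+2.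
    by rewrite size_cat /= !addnS -size_cat cat_take_drop.
  rewrite !E !E' -!catA /= !(tm_lin tG) ?szt /= -?st ?addnS //; ring.
move=> a0 a1 a2 a3 s X q1 sf; rewrite /contract !(tm_act tG _ q1) ?sz // !map_cat /=.
rewrite !map_take !map_drop.
set s' := map _ s; set M := trmx _.
have s'f : size s' = f by rewrite size_map.
(* Both inserted vectors are expanded over [e0] and [e1]; the difference of the two orders leaves
   the determinant of [M], which is 1 by [det_su2]. *)
have E x y X' : G (take p s' ++ [:: x, y & drop p s']) X' =
   x 0 0 * (y 0 0 * G (take p s' ++ [:: e0 R, e0 R & drop p s']) X'
          + y 0 1 * G (take p s' ++ [:: e0 R, e1 R & drop p s']) X')
 + x 0 1 * (y 0 0 * G (take p s' ++ [:: e1 R, e0 R & drop p s']) X'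
          + y 0 1 * G (take p s' ++ [:: e1 R, e1 R & drop p s']) X').
  rewrite (tm_row2 tG) /=; last first.
    by rewrite addnS -size_cat cat_take_drop s'f.
  have E2 z : G (take p s' ++ [:: z, y & drop p s']) X' =
      y 0 0 * G (take p s' ++ [:: z, e0 R & drop p s']) X'
    + y 0 1 * G (take p s' ++ [:: z, e1 R & drop p s']) X'.
    rewrite (_ : take p s' ++ [:: z, y & drop p s'] = (take p s' ++ [:: z]) ++ y :: drop p s').
      rewrite (tm_row2 tG) -?catA //.
      by rewrite size_cat /= addn1 addSn -size_cat cat_take_drop s'f.
    by rewrite -catA.
  by rewrite !E2.
rewrite !(E (_ *m M)) -[RHS]mul1r -(det_su2 q1) -/M.
move: (G (_ ++ [:: e0 R, e0 R & _]) X) (G (_ ++ [:: e0 R, e1 R & _]) X)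
  (G (_ ++ [:: e1 R, e0 R & _]) X) (G (_ ++ [:: e1 R, e1 R & _]) X).
move: ((e0 R *m M) 0 0) ((e0 R *m M) 0 1) ((e1 R *m M) 0 0) ((e1 R *m M) 0 1) => *.
ring.
Qed.

Definition letters (w : seq bool) : seq 'rV[C]_2 := [seq if b then e1 R else e0 R | b <- w].

(** * Words in [e0] and [e1] modulo contractions *)

Section TensorWeight.
Variables (f : nat) (G : seq 'rV[C]_2 -> form R m r).
Hypothesis tG : tensor_map f G.
Local Notation g w := (G (letters w)).

(** Equality up to the space of weights at most [f], in which the contractions of [G] lie by
    [contractP]. *)
Definition eqw (alpha beta : form R m r) := weight_le f (fun X => alpha X - beta X).

Lemma eqw_refl alpha : eqw alpha alpha.
Proof. by rewrite /eqw; under eq_fun do rewrite subrr; apply: finite_sums0. Qed.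

Lemma eqw_sym alpha beta : eqw alpha beta -> eqw beta alpha.
Proof. by move=> /(weight_leZ (-1)); rewrite /eqw; under eq_fun do rewrite mulN1r opprB. Qed.

Lemma eqwD a1 b1 a2 b2 : eqw a1 b1 -> eqw a2 b2 ->
  eqw (fun X => a1 X + a2 X) (fun X => b1 X + b2 X).
Proof. by move=> e1 e2; have := weight_leD e1 e2; rewrite /eqw; under eq_fun do rewrite addrACA -opprD. Qed.

Lemma eqwZ z a b : eqw a b -> eqw (fun X => z * a X) (fun X => z * b X).
Proof. by move=> /(weight_leZ z); rewrite /eqw; under eq_fun do rewrite mulrBr. Qed.

Lemma eqw_trans b a c : eqw a b -> eqw b c -> eqw a c.
Proof. by move=> e1 e2; have := weight_leD e1 e2; rewrite /eqw; under eq_fun do rewrite addrA subrK. Qed.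

Lemma eqw_weight_le a b : eqw a b -> weight_le f b -> weight_le f a.
Proof. by move=> e1 e2; have := weight_leD e1 e2; under eq_fun do rewrite subrK. Qed.

Hypothesis contractP : forall p u, (size u).+2 = f -> (p <= size u)%N ->
  weight_le f (contract p G (letters u)).

Lemma swap_letters s t : (size s + size t).+2 = f ->
  eqw (g (s ++ [:: false, true & t])) (g (s ++ [:: true, false & t])).
Proof.
move=> st; have := contractP (p := size s) (u := s ++ t).
rewrite size_cat => /(_ st (leq_addr _ _)).
by rewrite /contract /letters -map_take -map_drop take_size_cat // drop_size_cat // !map_cat.
Qed.

Lemma move_letter j s t : (size s + j + size t).+1 = f ->
  eqw (g (s ++ nseq j true ++ false :: t)) (g (s ++ false :: nseq j true ++ t)).
Proof.
elim: j s => [|j IH] s sjt; first exact: eqw_refl.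
apply: eqw_trans (eqw_sym (swap_letters _)); last by rewrite size_cat size_nseq; lia.
by have := IH (rcons s true); rewrite !cat_rcons /=; apply; rewrite size_rcons; lia.
Qed.

Lemma move_letter_r i s t : (size s + i + size t).+1 = f ->
  eqw (g (s ++ true :: nseq i false ++ t)) (g (s ++ nseq i false ++ true :: t)).
Proof.
elim: i s => [|i IH] s sit; first exact: eqw_refl.
apply: eqw_trans (eqw_sym (swap_letters _)) _; first by rewrite size_cat size_nseq; lia.
by have := IH (rcons s false); rewrite !cat_rcons /=; apply; rewrite size_rcons; lia.
Qed.

Lemma sort_letters s w : (size s + size w = f)%N ->
  eqw (g (s ++ w)) (g (s ++ nseq (count negb w) false ++ nseq (count id w) true)).
Proof.
elim: w s => [|b w IH] s sw; first exact: eqw_refl.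
have := IH (rcons s b); rewrite size_rcons cat_rcons => /(_ _)/eqw_trans; apply.
  by rewrite -sw /=; lia.
rewrite cat_rcons; case: b sw => /= sw; rewrite ?add0n ?add1n; last exact: eqw_refl.
apply: move_letter_r; rewrite size_nseq.
by have := count_predC id w; have -> : count (predC id) w = count negb w by []; lia.
Qed.

(** The sum of [G] over all words made of k letters, i of them [e0], followed by [s], in the
    recursion of Pascal's triangle. These are the coefficients of G (a, ..., a, s) as a polynomial
    in [a]. *)
Fixpoint powcoef k (s : seq bool) i : form R m r :=
  if k is l.+1 then
    fun X => (if i is j.+1 then powcoef l (false :: s) j X else 0) + powcoef l (true :: s) i X
  else if i is 0 then g s else fun=> 0.

Lemma powcoef_gt k s i X : (k < i)%N -> powcoef k s i X = 0.
Proof.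
elim: k s i => [|k IH] s [|i] //= ki.
by rewrite !IH ?addr0 // ltnW.
Qed.

Lemma powcoef_sum k s a X : (k + size s = f)%N ->
  G (nseq k a ++ letters s) X = \sum_(i < k.+1) a 0 0 ^+ i * a 0 1 ^+ (k - i) * powcoef k s i X.
Proof.
elim: k s => [|k IH] s ks; first by rewrite big_ord1 !expr0 !mul1r.
have -> : nseq k.+1 a ++ letters s = nseq k a ++ a :: letters s.
  by rewrite -cat_rcons -cats1 -(nseqD k 1) addn1.
rewrite (tm_row2 tG) ?size_nseq ?size_map //.
rewrite -[e0 R :: _]/(letters (false :: s)) -[e1 R :: _]/(letters (true :: s)).
rewrite !IH /= ?addnS // [RHS](eq_bigr (fun i : 'I_k.+2 =>
  a 0 0 ^+ i * a 0 1 ^+ (k.+1 - i) * (if val i is j.+1 then powcoef k (false :: s) j X else 0) +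
  a 0 0 ^+ i * a 0 1 ^+ (k.+1 - i) * powcoef k (true :: s) i X)); last first.
  by move=> i _; rewrite mulrDr.
rewrite [in RHS]big_split /= [X in _ = X + _]big_ord_recl /= mulr0 add0r
  [X in _ = _ + X]big_ord_recr /=.
rewrite powcoef_gt // mulr0 addr0 !big_distrr /=; congr (_ + _); apply: eq_bigr => i _.
  by rewrite mulrA mulrA -exprS.
by rewrite subSn -1?ltnS // mulrA mulrCA -exprS.
Qed.

Lemma powcoef_Lambda k s i : (k + size s = f)%N -> Lambda (powcoef k s i).
Proof.
elim: k s i => [|k IH] s i ks.
  by case: i => [|i]; [apply: (tm_Lambda tG); rewrite size_map|exact: Lambda0].
apply: LambdaD; last by apply: IH; rewrite /= addnS.
by case: i => [|i]; [exact: Lambda0|apply: IH; rewrite /= addnS].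
Qed.

(** Modulo contractions the order of the letters is immaterial, so that all the words in the sum
    agree with the sorted one. *)
Lemma powcoef_eqw k s i : (k + size s = f)%N ->
  eqw (powcoef k s i)
    (fun X => 'C(k, i)%:R * g (nseq i false ++ nseq (k - i) true ++ s) X).
Proof.
elim: k s i => [|k IH] s i ks.
  case: i => [|i] /=.
    by under [X in eqw _ X]eq_fun do rewrite mul1r; exact: eqw_refl.
  by under [X in eqw _ X]eq_fun do rewrite mul0r; exact: eqw_refl.
case: i => [|i].
  apply: eqw_trans (_ : eqw _ (powcoef k (true :: s) 0)) _.
    by rewrite (_ : powcoef k.+1 s 0 = powcoef k (true :: s) 0);
      [exact: eqw_refl|apply/funext => X /=; rewrite add0r].
  have := IH (true :: s) 0%N; rewrite /= addnS => /(_ ks).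
  by rewrite !bin0 !subn0 -cat_rcons -cats1 -(nseqD k 1) addn1.
have [ki|ik] := ltnP k i.+1; last first.
  have E (X : 'M_(r, m)) : 'C(k.+1, i.+1)%:R * g (nseq i.+1 false ++ nseq (k.+1 - i.+1) true ++ s) X =
    'C(k, i)%:R * g (nseq i.+1 false ++ nseq (k - i) true ++ s) X +
    'C(k, i.+1)%:R * g (nseq i.+1 false ++ nseq (k - i.+1) true ++ true :: s) X.
    rewrite binS natrD mulrDl addrC; congr (_ + _ * G (letters (_ ++ _)) X).
    rewrite -cat_rcons -cats1 -(nseqD _ 1) addn1; congr (nseq _ _ ++ _); lia.
  rewrite (funext E); apply: eqwD.
    have := IH (false :: s) i; rewrite /= addnS => /(_ ks)/eqw_trans; apply.
    apply: eqwZ; have := move_letter (j := k - i) (s := nseq i false) (t := s).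
    rewrite size_nseq => /(_ _)/eqw_trans; apply; first by lia.
    by rewrite -cat_rcons -cats1 -(nseqD i 1) addn1; exact: eqw_refl.
  by have := IH (true :: s) i.+1; rewrite /= addnS => /(_ ks).
move: ki; rewrite ltnS leq_eqVlt => /orP[/eqP<-|ki]; last first.
  have -> : powcoef k.+1 s i.+1 = fun=> 0 by apply/funext => X; apply: powcoef_gt.
  by rewrite bin_small //; under [X in eqw _ X]eq_fun do rewrite mul0r; exact: eqw_refl.
have -> : powcoef k.+1 s k.+1 = powcoef k (false :: s) k.
  by apply/funext => X /=; rewrite (powcoef_gt (true :: s) X (ltnSn k)) addr0.
have := IH (false :: s) k; rewrite /= addnS => /(_ ks).
by rewrite !binn !subnn /= -cat_rcons -cats1 -(nseqD k 1) addn1.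
Qed.


Lemma tensor_weight_le_step w : size w = f -> weight_le f (g w).
Proof.
move=> wf; apply: eqw_weight_le (sort_letters (s := [::]) wf) _; rewrite cat0s.
have cf : (count negb w + count id w = f)%N.
  by rewrite addnC -wf -(count_predC id w).
set i := count negb w; have iF : (i < f.+1)%N by rewrite ltnS -cf leq_addr.
have -> : count id w = (f - i)%N by rewrite -cf addKn.
(* The symmetrisation of [G], as a map on binary forms. The binomial coefficients cancel those of
   [pw], so that the power of [a] goes to G (a, ..., a); equivariance is then checked on powers,
   which span. *)
pose T (u : 'rV[C]_f.+1) : form R m r :=
  fun X => \sum_(j < f.+1) u 0 j / 'C(f, j)%:R * powcoef f [::] j X.
have Tpw a X : T (pw f a) X = G (nseq f a) X.
  rewrite -[nseq f a]cats0 -[[::]]/(letters [::]) powcoef_sum ?addn0 //.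
  apply: eq_bigr => j _; rewrite !mxE -[X in X / _]mulrA [X in X / _]mulrC mulfK //.
  by rewrite pnatr_eq0 -lt0n bin_gt0 -ltnS.
have Tlin z u v : T (z *: u + v) = (fun X => z * T u X + T v X).
  apply/funext => X; rewrite /T big_distrr -big_split /=; apply: eq_bigr => j _.
  by rewrite !mxE mulrDl mulrDl !mulrA.
have Tact a0 a1 a2 a3 u u' : unit_quat a0 a1 a2 a3 ->
   (forall v, binary_form u' v = binary_form u (v *m su2_mx a0 a1 a2 a3)) ->
    T u' = act (quat a0 a1 a2 a3) (T u).
  move=> q1 uu'; apply/funext => X; rewrite /act.
  have -> : u' = substu (su2_mx a0 a1 a2 a3) u.
    by apply: binary_form_inj => v; rewrite binary_form_substu uu'.
  rewrite {2}(pwcoordK u) !(T_sum Tlin); apply: eq_bigr => l _.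
  by rewrite !Tpw (tm_act tG) ?size_nseq // map_nseq.
have TL u : Lambda (T u).
  rewrite /T; elim: (index_enum _) => [|j js IH].
    by under eq_fun do rewrite big_nil; exact: Lambda0.
  under eq_fun do rewrite big_cons; apply: LambdaD IH; apply: LambdaZ.
  by apply: powcoef_Lambda; rewrite addn0.
have := powcoef_eqw (k := f) (s := [::]) i; rewrite addn0 => /(_ erefl)/(eqwZ ('C(f, i)%:R^-1)).
have C0 : 'C(f, i)%:R != 0 :> C by rewrite pnatr_eq0 -lt0n bin_gt0 -ltnS.
under [X in eqw _ X]eq_fun do rewrite mulKf // cats0.
move=> /eqw_sym/eqw_weight_le; apply.
have := weight_le_T Tlin Tact TL (delta_mx 0 (Ordinal iF)); congr weight_le.
apply/funext => X; rewrite /T (bigD1 (Ordinal iF)) //= big1 ?addr0 => [|j ji].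
  by rewrite mxE !eqxx div1r.
by rewrite mxE eqxx (negPf ji) !mul0r.
Qed.

End TensorWeight.

(** The Clebsch-Gordan induction: words agree with symmetric tensors up to contractions, and these
    are tensor maps on f - 2 arguments. *)
Lemma tensor_weight_le f G w : tensor_map f G -> size w = f -> weight_le f (G (letters w)).
Proof.
elim/ltn_ind: f G w => f IH G w tG wf; apply: tensor_weight_le_step (wf) => // p u uf pu.
move: tG IH; rewrite -uf => tG IH; apply: (@weight_leW (size u)); first by rewrite leqW.
by apply: IH => //; exact: contract_tensor_map.
Qed.

(** Antisymmetrisation of [eta] with a separate linear map in every slot; the slots can be treated
    one by one without leaving the alternating forms. *)
Definition altform (eta : form R m r) (Q : 'I_r -> 'M[C]_m) : form R m r :=
  fun X => \sum_(p : 'S_r) (-1) ^+ p * eta (\matrix_k (row (p k) X *m Q k)).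

Lemma altform_Lambda eta Q : Lambda eta -> Lambda (altform eta Q).
Proof.
move=> L; apply: LambdaI => [X k a b u v|X k l kl Xkl].
  rewrite /altform !big_distrr -big_split /=; apply: eq_bigr => p _.
  have [q ->] : exists q, k = p q by exists (p^-1%g k); rewrite permKV.
  have E w : \matrix_k0 (row (p k0) (setrow X (p q) w) *m Q k0) =
      setrow (\matrix_k0 (row (p k0) X *m Q k0)) q (w *m Q q).
    apply/row_matrixP => i; rewrite row_setrow !rowK (inj_eq perm_inj).
    by case: eqP => [->|].
  rewrite !E mulmxDl -!scalemxAl (Lambda_lin L) mulrDr.
  by congr (_ + _); rewrite mulrCA.
set S := LHS; have : S = - S.
  rewrite {1}/S /altform (reindex_inj (mulIg (tperm k l))) /= -sumrN.
  apply: eq_bigr => p _; rewrite odd_permM odd_tperm kl signr_addb expr1 mulrN1 !mulNr.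
  congr (- (_ * eta _)); apply/row_matrixP => i; rewrite !rowK permM.
  by case: tpermP => // ->; rewrite Xkl.
by move/eqP; rewrite -addr_eq0 -mulr2n mulrn_eq0 => /eqP.
Qed.

Lemma altform_lin eta (Q Q1 Q2 : 'I_r -> 'M[C]_m) k a X : Lambda eta -> Q k = a *: Q1 k + Q2 k ->
  (forall j, j != k -> Q1 j = Q j) -> (forall j, j != k -> Q2 j = Q j) ->
  altform eta Q X = a * altform eta Q1 X + altform eta Q2 X.
Proof.
move=> L Qk E1 E2; rewrite /altform big_distrr -big_split /=; apply: eq_bigr => p _.
pose Y := \matrix_i (row (p i) X *m Q i); rewrite -/Y.
have -> : Y = setrow Y k (a *: (row (p k) X *m Q1 k) + 1 *: (row (p k) X *m Q2 k)).
  by rewrite -[LHS](setrow_row Y k) rowK Qk mulmxDr scale1r scalemxAr.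
have -> : \matrix_i (row (p i) X *m Q1 i) = setrow Y k (row (p k) X *m Q1 k).
  by apply/row_matrixP => i; rewrite row_setrow !rowK; case: eqP => [->|/eqP/E1->].
have -> : \matrix_i (row (p i) X *m Q2 i) = setrow Y k (row (p k) X *m Q2 k).
  by apply/row_matrixP => i; rewrite row_setrow !rowK; case: eqP => [->|/eqP/E2->].
by rewrite (Lambda_lin L) mul1r mulrDr; congr (_ + _); rewrite mulrCA.
Qed.

(** [J] acts after [ycomb] and so does not interfere with the unit quaternions, which act before it.
    It is placed such that the letter [e1] in a slot with [J] yields [proj01], and the letter [e0]
    in a slot without it [proj10]. *)
Lemma altform_tensor_map eta (w : nat -> bool) : Lambda eta ->
  tensor_map r (fun s => altform eta
    (fun k => ycomb (nth 0 s k) *m (if w k then J else 1%:M))).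
Proof.
move=> L; split=> [s _|s t a u v X st|a0 a1 a2 a3 s X q1 sr].
- exact: altform_Lambda.
- have sr : (size s < r)%N by rewrite -st ltnS leq_addr.
  have nk (z : 'rV[C]_2) (j : 'I_r) : j != Ordinal sr ->
      nth 0 (s ++ z :: t) j = nth 0 (s ++ 0 :: t) j.
    rewrite -val_eqE /= => js; rewrite !nth_cat; case: ltnP => // sj.
    have lt : (size s < j)%N by rewrite ltn_neqAle [size s == _]eq_sym js.
    by rewrite -(subnSK lt).
  apply: (@altform_lin eta _ (fun k => ycomb (nth 0 (s ++ u :: t) k) *m (if w k then J else 1%:M))
    (fun k => ycomb (nth 0 (s ++ v :: t) k) *m (if w k then J else 1%:M)) (Ordinal sr) a X L)
    => [|j js|j js]; rewrite /= ?nk //.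
  rewrite !nth_cat ltnn subnn /= scalemxAl -mulmxDl; congr (_ *m _).
  by rewrite /ycomb !mxE !scalerDl !scalerDr !scalerA addrACA.
apply: eq_bigr => p _; apply: congr1; apply: congr1; apply/row_matrixP => k.
rewrite [LHS]rowK [RHS]rowK row_mul.
by rewrite -mulmxA (mulmxA (quat _ _ _ _)) quat_mul_ycomb (nth_map 0) ?sr // mulmxA.
Qed.

(** The identity is the sum of [proj10] and [proj01] in every slot; expanding all slots writes r!
    times [eta] as a sum of tensor maps evaluated at words. *)
Lemma Lambda_weight_le eta : Lambda eta -> weight_le r eta.
Proof.
move=> L.
have P01 w : weight_le r (altform eta (fun k => if w (val k) then p01 else p10)).
  have := tensor_weight_le (w := mkseq w r) (altform_tensor_map w L).
  rewrite size_mkseq => /(_ erefl); congr weight_le.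
  apply/funext => X; apply: eq_bigr => p _; congr (_ * eta _); apply/row_matrixP => k.
  rewrite !rowK; congr (_ *m _); rewrite /letters (nth_map false) ?size_mkseq // nth_mkseq //.
  rewrite /ycomb; case: (w k); rewrite !mxE /= ?scale1r ?scale0r ?add0r ?addr0.
    exact: yproj_J.
  by rewrite mulmx1.
(* [j] counts the slots, from the last one backwards, in which the two projections have been summed
   to the identity. *)
have P1 j w : (j <= r)%N -> weight_le r (altform eta
    (fun k => if (r - j <= k)%N then 1%:M else if w (val k) then p01 else p10)).
  elim: j w => [|j IH] w jr.
    rewrite (_ : (fun k : 'I_r => _) = fun k => if w (val k) then p01 else p10) //.
    by apply/funext => k; rewrite subn0 leqNgt ltn_ord.
  pose w' b i := if i == (r - j.+1)%N then b else w i.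
  have klt : (r - j.+1 < r)%N by lia.
  have := weight_leD (IH (w' false) (ltnW jr)) (IH (w' true) (ltnW jr)).
  congr weight_le; apply/funext => X; apply/esym; rewrite -[X in X + _]mul1r.
  pose Q b (k : 'I_r) := if (r - j <= k)%N then 1%:M else if w' b (val k) then p01 else p10.
  apply: (@altform_lin eta _ (Q false) (Q true) (Ordinal klt) 1 X L) => /= [|i|i].
  - rewrite /Q leqnn /w' /= eqxx (_ : (r - j <= r - j.+1)%N = false); last by lia.
    by rewrite scale1r -proj10_addproj01.
  - rewrite -val_eqE /= /Q /w' /= => /[dup] ne /negPf->.
    by rewrite (_ : (r - j <= i)%N = (r - j.+1 <= i)%N) //; lia.
  - rewrite -val_eqE /= /Q /w' /= => /[dup] ne /negPf->.
    by rewrite (_ : (r - j <= i)%N = (r - j.+1 <= i)%N) //; lia.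
have := weight_leZ (r`!%:R^-1) (P1 r xpredT (leqnn r)); congr weight_le.
apply/funext => X; rewrite /altform subnn /=.
rewrite (eq_bigr (fun=> eta X)) => [|p _].
  by rewrite sumr_const card_Sn -[eta X *+ _]mulr_natl mulKf // pnatr_eq0 -lt0n fact_gt0.
rewrite [X in eta X](_ : _ = row_perm p X); last first.
  by apply/row_matrixP => k; rewrite rowK mulmx1 row_row_perm.
by rewrite (Lambda_perm L) mulrA -signr_addb addbb mul1r.
Qed.

Lemma Pplus_exists (eta : form R m r) : Lambda eta -> exists alpha : form R m r,
  Lambda_plus I J K alpha /\ Lambda_lower I J K (fun X => eta X - alpha X).
Proof.
move=> /Lambda_weight_le.
elim/finite_sums_ind => [|b1 b2 [a1 [p1 l1]] [a2 [p2 l2]]|beta [k kr kb]].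
- exists (fun=> 0); split; first by apply/Lambda_plus_irreps; apply: finite_sums0.
  by under eq_fun do rewrite subrr; apply: finite_sums0.
- exists (fun X => a1 X + a2 X); split.
    by apply/Lambda_plus_irreps; apply: finite_sumsD; apply/Lambda_plus_irreps.
  by under eq_fun do rewrite opprD addrACA; apply: finite_sumsD.
have [kr'|rk] := ltnP k r.
  exists (fun=> 0); split; first by apply/Lambda_plus_irreps; apply: finite_sums0.
  under eq_fun do rewrite subr0; exact: (Lambda_lower_irreps kr' kb).
have kE : k = r by apply/eqP; rewrite eqn_leq kr rk.
exists beta; split.
  by apply/Lambda_plus_irreps; apply: finite_sums1; rewrite -kE.
by under eq_fun do rewrite subrr; apply: finite_sums0.
Qed.

(** Excludes the default value of [xget]; what is used of [Pplus] below follows from these two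
    memberships. *)
Lemma Pplus_spec (eta : form R m r) : Lambda eta ->
  Lambda_plus I J K (Pplus I J K eta) /\
  Lambda_lower I J K (fun X => eta X - Pplus I J K eta X).
Proof.
move=> /Pplus_exists[alpha ae]; rewrite /Pplus.
set S := (X in xget _ X).
by have : S (xget (fun=> 0) S) by apply: xgetPex; exists alpha.
Qed.

(** Stability under the group removes the unit quaternion; a monomial of a representation of weight
    k < r has exponent at most k, too small for r arguments of type (1,0). *)
Lemma Lambda_lower_p10 (eta : form R m r) a0 a1 a2 a3 X : Lambda_lower I J K eta ->
  unit_quat a0 a1 a2 a3 -> eta (X *m p10 *m quat a0 a1 a2 a3) = 0.
Proof.
move=> + q1; elim/finite_sums_ind => [//|b1 b2 e1 e2|beta [W [k kr [_ WE]] Wb]].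
  by rewrite e1 e2 addr0.
move: Wb; rewrite WE; elim/finite_sums_ind => [//|b1 b2 e1 e2|{}beta [V [[[VL _ _ _ Va] [T [Tlin _ VT Tact]]] _] Vb]].
  by rewrite e1 e2 addr0.
have := Va _ _ _ _ _ q1 Vb; rewrite VT => -[u _ Tu].
rewrite -[LHS]/(act (quat a0 a1 a2 a3) beta (X *m p10)) -Tu (T_delta Tlin) big1 // => i _.
rewrite (T_p10_eq0 Tlin Tact) ?mulr0 ?ltn_add2r ?(leq_ltn_trans _ kr) //.
  by move=> v; apply: VL; rewrite VT; exists v.
by rewrite -ltnS ltn_ord.
Qed.

(** The [Xi i] are coordinates for the isomorphism of [Lambda_plus] with the (r,0)-forms tensored
    with S^r(V_1). The second property recovers [eta] from them by means of the [ycomb (pt l)]; the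
    third lets them be read off from the values of [eta] on rotated (1,0)-vectors. *)
Lemma Lambda_plus_p10 (eta : form R m r) : Lambda_plus I J K eta ->
  exists Xi : 'I_r.+1 -> form R m r,
  [/\ forall i X, Xi i (X *m p10) = Xi i X,
      forall X, eta X = \sum_l \sum_i invmx (pwmx R r) i l * Xi i (X *m ycomb (pt R l))
    & forall a0 a1 a2 a3 X, unit_quat a0 a1 a2 a3 ->
      eta (X *m p10 *m quat a0 a1 a2 a3) =
      \sum_i Xi i X * ((a0 +i* a1) ^+ i * (a2 +i* a3) ^+ (r - i))].
Proof.
move=> /Lambda_plus_irreps.
elim/finite_sums_ind => [|b1 b2 [X1 [h1 h1' h1'']] [X2 [h2 h2' h2'']]|beta [V [[VL _ _ _ Va] [T [Tlin _ VT Tact]]] Vb]].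
- exists (fun=> fun=> 0); split=> //.
    by move=> X; rewrite big1 // => l _; rewrite big1 // => i _; rewrite mulr0.
  by move=> *; rewrite big1 // => i _; rewrite mul0r.
- exists (fun i X => X1 i X + X2 i X); split=> [i X|X|a0 a1 a2 a3 X q1].
  + by rewrite h1 h2.
  + rewrite h1' h2' -big_split; apply: eq_bigr => l _ /=.
    by rewrite -big_split; apply: eq_bigr => i _; rewrite mulrDr.
  + by rewrite h1'' // h2'' // -big_split; apply: eq_bigr => i _; rewrite mulrDl.
move: Vb; rewrite VT => -[u _ <-].
have TL v : Lambda (T v) by apply: VL; rewrite VT; exists v.
exists (fun i X => u 0 i * T (delta_mx 0 ord_max) X); split=> [i X|X|a0 a1 a2 a3 X q1].
- by rewrite (T_top_p10 Tlin Tact TL).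
- rewrite (T_ycomb Tlin Tact TL); apply: eq_bigr => l _.
  rewrite /pwcoord mxE big_distrl /=; apply: eq_bigr => i _.
  by rewrite mulrCA mulrA.
rewrite (T_p10_quat Tlin Tact TL) //; apply: eq_bigr => i _.
by rewrite mulrAC.
Qed.



End Decomposition.

End QuatRep.

Transparent proj10 proj01.

(** * Symplectic bases of the range of a projection *)

Section SymplecticBasis.
Variables (R : realType) (m n : nat) (p B : 'M[R[i]]_m).
Local Notation C := R[i].
Hypotheses (pp : p *m p = p) (rp : \rank p = (n + n)%N).
Hypotheses (BT : B^T = - B) (pB : p *m B = B).
Hypothesis Bnd : forall v : 'rV[C]_m, v *m p = v -> v *m B = 0 -> v = 0.

Lemma BpT : B *m p^T = B.
Proof. by apply: trmx_inj; rewrite trmx_mul trmxK BT mulmxN pB. Qed.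

Lemma skew_swap k l (X : 'M[C]_(k, m)) (Y : 'M_(l, m)) :
  X *m B *m Y^T = - (Y *m B *m X^T)^T.
Proof. by rewrite !trmx_mul trmxK BT mulNmx mulmxN opprK mulmxA. Qed.

Lemma skew0 (v : 'rV[C]_m) : v *m B *m v^T = 0.
Proof.
apply/matrixP => i j; rewrite !ord1 [RHS]mxE.
have /(congr1 (fun M : 'M_1 => M 0 0)) := skew_swap v v; rewrite [RHS]mxE [X in - X]mxE.
by move/eqP; rewrite -addr_eq0 -mulr2n mulrn_eq0 => /eqP.
Qed.

Definition symplectic k (P Q : 'M[C]_(k, m)) :=
  [/\ P *m p = P, Q *m p = Q, P *m B *m P^T = 0, Q *m B *m Q^T = 0 & P *m B *m Q^T = 1%:M].

Lemma symplectic_extend k (P Q : 'M[C]_(k, m)) : (k < n)%N -> symplectic P Q ->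
  exists v w : 'rV[C]_m, symplectic (col_mx v P : 'M_(1 + k, m)) (col_mx w Q).
Proof.
move=> kn [Pp Qp PP QQ PQ].
(* Orthogonality to [P] and [Q] amounts to 2k < 2n linear equations on the range of [p]. *)
pose N := row_base p *m B *m (col_mx P Q)^T.
have /rowV0Pn[u uN u0] : kermx N != 0.
  rewrite -mxrank_eq0 mxrank_ker subn_eq0 -ltnNge.
  by apply: leq_ltn_trans (rank_leq_col _) _; rewrite rp; lia.
pose v := u *m row_base p.
have vp : v *m p = v.
  have /submxP[D vE] : (v <= p)%MS by rewrite (submx_trans (submxMl _ _)) ?eq_row_base.
  by rewrite vE -mulmxA pp.
have v0 : v != 0.
  apply: contra_neq u0 => uv; apply: (row_free_inj (row_base_free p)).
  by rewrite mul0mx.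
have : v *m B *m (col_mx P Q)^T = 0.
  by move/sub_kermxP: uN; rewrite /v -!(mulmxA u).
rewrite tr_col_mx mul_mx_row -[0]row_mx0 => /eq_row_mx[vP vQ].
have [j vBj] : exists j, (v *m B) 0 j != 0.
  apply/existsP; apply: contraNT v0 => /existsPn vB; apply/eqP/Bnd => //.
  by apply/rowP => j; rewrite [RHS]mxE; apply/eqP; have := vB j; rewrite negbK.
have [w0 [w0p vw0]] : exists w0 : 'rV_m, w0 *m p = w0 /\ v *m B *m w0^T = 1%:M.
  exists (((v *m B) 0 j)^-1 *: delta_mx 0 j *m p); split; first by rewrite -mulmxA pp.
  rewrite trmx_mul mulmxA -(mulmxA v) BpT linearZ /= -scalemxAr trmx_delta -colE.
  by apply/matrixP => a b; rewrite !ord1 [LHS]mxE [X in _ * X]mxE mulVf // mxE.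
(* Correction of [w0] by its pairings with [P] and [Q]; the pairing with [v] stays 1, because [v] is
   orthogonal to both. *)
clearbody v; pose w := w0 - w0 *m B *m Q^T *m P + w0 *m B *m P^T *m Q.
have QP : Q *m B *m P^T = - 1%:M by rewrite skew_swap PQ trmx1.
have wP : w *m B *m P^T = 0.
  by rewrite /w !mulmxDl !mulNmx -(mulmxA _ P) -(mulmxA _ (P *m B)) PP mulmx0 subr0
    -(mulmxA _ Q) -(mulmxA _ (Q *m B)) QP mulmxN mulmx1 subrr.
have wQ : w *m B *m Q^T = 0.
  by rewrite /w !mulmxDl !mulNmx -(mulmxA _ P) -(mulmxA _ (P *m B)) PQ mulmx1
    -(mulmxA _ Q) -(mulmxA _ (Q *m B)) QQ mulmx0 addr0 subrr.
exists v, w; split.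
- by rewrite mul_col_mx vp Pp.
- rewrite mul_col_mx Qp /w !mulmxDl !mulNmx w0p.
  by rewrite -!(mulmxA _ P) -!(mulmxA _ Q) Pp Qp.
- by rewrite mul_col_mx tr_col_mx mul_col_row skew0 vP PP [P *m B *m _]skew_swap vP trmx0 oppr0 -block_mx0.
- by rewrite mul_col_mx tr_col_mx mul_col_row skew0 wQ QQ [Q *m B *m _]skew_swap wQ trmx0 oppr0 -block_mx0.
rewrite mul_col_mx tr_col_mx mul_col_row vQ PQ [P *m B *m _]skew_swap wP trmx0 oppr0.
rewrite (_ : v *m B *m w^T = 1%:M) -?scalar_mx_block //.
have -> : w^T = w0^T - (w0 *m B *m Q^T *m P)^T + (w0 *m B *m P^T *m Q)^T.
  by rewrite /w linearD linearB.
rewrite mulmxDr mulmxBr vw0 [(_ *m P)^T]trmx_mul [(_ *m Q)^T]trmx_mul !mulmxA vP vQ.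
by rewrite !mul0mx subr0 addr0.
Qed.

Lemma symplectic_exists : exists P Q : 'M[C]_(n, m), symplectic P Q.
Proof.
suff : forall k, (k <= n)%N -> exists P Q : 'M[C]_(k, m), symplectic P Q by apply.
elim=> [_|k IH kn].
  by exists 0, 0; split; rewrite ?mul0mx //; apply/matrixP => - [].
have [P [Q PQ]] := IH (ltnW kn).
have [v [w vw]] := symplectic_extend kn PQ.
by exists (col_mx v P), (col_mx w Q).
Qed.

(** Right multiplication by the left-hand side fixes the rows of [P] and [Q], which span the range
    of [p] because they are independent and their number is its rank. *)
Lemma symplectic_proj (P Q : 'M[C]_(n, m)) : symplectic P Q ->
  B *m (Q^T *m P - P^T *m Q) = p.
Proof.
move=> [Pp Qp PP QQ PQ]; set D := _ - _.
have QP : Q *m B *m P^T = - 1%:M by rewrite skew_swap PQ trmx1.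
have ZD : col_mx P Q *m B *m D = col_mx P Q.
  rewrite !mul_col_mx !mulmxBr !mulmxA PP QQ PQ QP !mul0mx mulNmx !mul1mx.
  by rewrite subr0 sub0r opprK.
have Zfree : row_free (col_mx P Q).
  apply/row_freeP; exists (B *m row_mx Q^T (- P^T)).
  rewrite mulmxA mul_col_mx mul_col_row !mulmxN PQ PP QQ QP opprK oppr0.
  by rewrite -scalar_mx_block.
have /submxP[E pE] : (p <= col_mx P Q)%MS.
  have Zp : (col_mx P Q <= p)%MS by apply/submxP; exists (col_mx P Q); rewrite mul_col_mx Pp Qp.
  rewrite -(geq_leqif (mxrank_leqif_sup Zp)).
  by rewrite rp (eqP Zfree).
transitivity (p *m B *m D); first by rewrite pB.
by rewrite {1}pE -(mulmxA E) -(mulmxA E) ZD.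
Qed.

End SymplecticBasis.

(** * The equivalence at a point *)

Section Pointwise.
Variables (R : realType) (m n : nat) (I J K : 'M[R[i]]_m).
Local Notation C := R[i].
Hypotheses (hI : I *m I = - 1%:M) (hJ : J *m J = - 1%:M).
Hypotheses (hK : I *m J = K) (hJI : J *m I = - K).
Local Notation p10 := (proj10 I).
Local Notation p01 := (proj01 I).
Local Notation yproj := (yproj I J).
Local Notation ycomb := (ycomb I J).
Local Notation ii := ('i%C : C).

(* [Om] is the (2,0)-part of the image of [om] under the raising operator of
   su(2); the quadratic form in [c] also says that [om] is of type (1,1) *)
Definition raises (om Om : form R m 2) : Prop :=
  (forall X, Om (X *m p10) = Om X) /\
  forall c0 c1 X, om (X *m p10 *m (c0%:M + c1 *: J)) = ii * c0 * c1 * Om X.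

Lemma wpow_raises om Om k c0 c1 X : raises om Om ->
  wpow om k (X *m p10 *m (c0%:M + c1 *: J)) = (ii * c0 * c1) ^+ k * wpow Om k X.
Proof.
move=> [_ E]; rewrite -mulmxA act_wpow; apply: wpow_scale => Y.
by rewrite /act mulmxA E.
Qed.

Lemma wpow_p10 (Om : form R m 2) k X : (forall X, Om (X *m p10) = Om X) ->
  wpow Om k (X *m p10) = wpow Om k X.
Proof.
move=> E; rewrite act_wpow -[RHS]mul1r -(expr1n _ k); apply: wpow_scale => Y.
by rewrite /act E mul1r.
Qed.

Lemma mid_ord k : (k < (k * 2).+1)%N.
Proof. by lia. Qed.

(** Everything is tested on X p10 (x + y J): the part of lower weight vanishes there, and [raises]
    gives om^n the value (i x y)^n Om^n X. Comparison of coefficients on the circle leaves the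
    single monomial of index n, of weight zero in S^(2n)(V_1). *)
Lemma Pplus_wpow om Om : @Lambda R m 2 om -> raises om Om -> forall X,
  Pplus I J K (wpow om n) X =
  ii ^+ n * \sum_l invmx (pwmx R (n * 2)) (Ordinal (mid_ord n)) l *
            wpow Om n (X *m ycomb (pt R l)).
Proof.
move=> L hom; have [plus lower] := Pplus_spec hI hJ hK hJI (wpow_Lambda n L).
have [Xi [_ XiE Xiq]] := Lambda_plus_p10 hI hJ hK hJI plus.
have XiD i X : Xi i X = (i == Ordinal (mid_ord n))%:R * (ii ^+ n * wpow Om n X).
  apply/eqP; rewrite -subr_eq0; apply/eqP; move: i; apply: real_circle_coef0 => x y xy.
  have q1 : unit_quat x 0 y 0 by rewrite /unit_quat expr0n /= !addr0.
  have := Lambda_lower_p10 hI X lower q1; rewrite Xiq //.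
  rewrite -mulmxA p10_mul_quat // mulmxA !complexr0 (wpow_raises _ _ _ hom).
  move/eqP; rewrite subr_eq0 => /eqP E.
  under eq_bigr do rewrite mulrBl; rewrite sumrB -E.
  apply/eqP; rewrite subr_eq0; apply/eqP.
  rewrite (bigD1 (Ordinal (mid_ord n))) //= big1 => [|i /negPf->]; last by rewrite !mul0r.
  rewrite eqxx addr0 mul1r (_ : n * 2 - n = n)%N; last by lia.
  by rewrite -mulrA !exprMn mulrAC.
move=> X; rewrite XiE big_distrr; apply: eq_bigr => l _ /=.
rewrite (bigD1 (Ordinal (mid_ord n))) //= big1 => [|i /negPf ni].
  by rewrite XiD eqxx mul1r addr0 mulrCA.
by rewrite XiD ni mul0r mulr0.
Qed.

Variables (e : 'M[C]_(n * 2, m)) (A : 'M[C]_(m, n * 2)).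
Hypotheses (eA : e *m A = 1%:M) (Ae : A *m e = p10).

Lemma e_p10 : e *m p10 = e.
Proof. by rewrite -Ae mulmxA eA mul1mx. Qed.

Lemma e_yproj : e *m yproj = 0.
Proof. by rewrite -e_p10 -mulmxA p10_yproj ?mulmx0. Qed.

Lemma J_yproj : J *m yproj = p10.
Proof. by rewrite mulmxN mulmxA -(proj10_mulJ hK hJI) -mulmxA hJ mulmxN mulmx1 opprK. Qed.

(** A basis of type (1,0) followed by its image under [J], of type (0,1); in this frame 1 + t
    [yproj] is unitriangular. *)
Definition frame : 'M[C]_(n * 2 + n * 2, m) := col_mx e (e *m J).

Lemma frame_coords s (X : 'M[C]_(s, m)) :
  X = row_mx (X *m A) (X *m yproj *m A) *m frame.
Proof.
rewrite mul_row_col !mulmxA -(mulmxA _ A) -(mulmxA (X *m _) A) Ae.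
rewrite -!(mulmxA X) (yproj_p10 hI hK hJI) (yproj_J _ hJ) -mulmxDr proj10_addproj01 mulmx1.
by [].
Qed.

(** The (1,0)-space has dimension 2n, so that the forms of type (2n,0) are multiples of a single
    one. *)
Lemma top_detform (alpha : form R m (n * 2)) : Lambda alpha ->
  (forall X, alpha (X *m p10) = alpha X) -> forall X, alpha X = alpha e * detform A X.
Proof. by move=> L E X; rewrite -E -Ae mulmxA (Lambda_det L) mulrC. Qed.

Lemma frame_swap : frame *m row_mx (yproj *m A) A = block_mx 0 1%:M 1%:M 0.
Proof.
rewrite mul_col_row !mulmxA e_yproj mul0mx eA -(mulmxA e) J_yproj e_p10 eA.
congr (block_mx 0 1%:M 1%:M).
have AE : A = p10 *m A by rewrite -Ae -mulmxA eA mulmx1.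
rewrite AE -(mulmxA e) (mulmxA J) -(proj01_mulJ hK hJI) !mulmxA -e_p10 -(mulmxA e).
by rewrite (proj10_proj01 hI) mulmx0 !mul0mx.
Qed.

Lemma det_swap_neq0 k : \det (block_mx 0 1%:M 1%:M 0 : 'M[C]_(k + k)) != 0.
Proof.
rewrite -unitfE -unitmxE; set S := block_mx _ _ _ _.
suff /mulmx1_unit[] : S *m S = 1%:M by [].
by rewrite mulmx_block !mulmx0 !mul0mx !mulmx1 !addr0 !add0r -scalar_mx_block.
Qed.

Lemma ii_neq0 : ii != 0.
Proof. by rewrite complexiE neq0Ci. Qed.

Local Notation swapmx := (block_mx 0 1%:M 1%:M 0 : 'M[C]_(n * 2 + n * 2)).

Lemma wedge_frame (alpha beta : form R m (n * 2)) : Lambda alpha -> Lambda beta ->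
  (forall X, alpha (X *m p10) = alpha X) -> (forall X, beta (X *m p10) = beta X) ->
  wedge (act yproj alpha) beta frame =
  alpha e * beta e * (laplace R (n * 2) (n * 2) * \det swapmx).
Proof.
move=> La Lb Ea Eb; rewrite -frame_swap -[\det _]/(detform _ frame) -wedge_detform.
apply: wedge_scale => X; last exact: top_detform.
by rewrite /act (top_detform La Ea) /detform mulmxA.
Qed.

(* Only the permutations sending the second half of the frame into [e]
   contribute, since [beta] is of type (2n,0). *)
Lemma wedge_frame_eq (alpha alpha' beta : form R m (n * 2)) : Lambda beta ->
  (forall X, beta (X *m p10) = beta X) ->
  (forall X, X *m p10 = 0 -> alpha X = alpha' X) ->
  wedge alpha beta frame = wedge alpha' beta frame.
Proof.
move=> Lb Eb E; congr (_ * _); apply: eq_bigr => s _.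
pose P := perm_mx s : 'M[C]_(n * 2 + n * 2).
have fp : frame *m p10 = col_mx e 0.
  rewrite mul_col_mx e_p10 -mulmxA -(proj01_mulJ hK hJI) -e_p10 -!mulmxA (mulmxA p10).
  by rewrite (proj10_proj01 hI) mul0mx mulmx0.
have Pf : row_perm s frame *m p10 = col_mx (ulsubmx P *m e) (dlsubmx P *m e).
  by rewrite row_permE -/P -mulmxA fp -{1}(submxK P) mul_block_col !mulmx0 !addr0.
have [d0|d0] := eqVneq (\det (dlsubmx P)) 0.
  rewrite -[beta _]Eb mul_dsub_mx Pf col_mxKd (Lambda_det Lb) d0 mul0r.
  by rewrite !mulr0.
rewrite (E (usubmx (row_perm s frame))) // mul_usub_mx Pf col_mxKu.
suff -> : ulsubmx P = 0 by rewrite mul0mx.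
apply/matrixP => i j; rewrite !mxE; case: (s (lshift _ i) =P lshift _ j) => [sij|//].
case/eqP: d0; rewrite (expand_det_col _ j) big1 // => k _.
rewrite !mxE; case: (s (rshift _ k) =P lshift _ j) => [skj|]; last by rewrite mul0r.
by have := perm_inj (etrans sij (esym skj)) => /eqP; rewrite eq_lrshift.
Qed.

Lemma wedge_ycomb om Om (beta : form R m (n * 2)) (t : nat) : raises om Om ->
  Lambda om -> Lambda beta -> (forall X, beta (X *m p10) = beta X) ->
  wedge (wpow om n) (act (ycomb (pt R t)) beta) frame =
  (- ii * t%:R) ^+ n * wedge (act yproj (wpow Om n)) beta frame.
Proof.
move=> hom Lo Lb Eb.
have [tau tauE] : exists tau : C, tau = t%:R by exists t%:R.
(* [yproj] has square zero, so that [B] and [B'] are inverse unipotent matrices; [B *m p10] is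
   [ycomb (pt t)]. *)
rewrite -!tauE; pose B := 1%:M + tau *: yproj; pose B' := 1%:M - tau *: yproj.
have y2 : yproj *m yproj = 0 by rewrite (yproj_yproj hI hK hJI).
have BB' : B *m B' = 1%:M.
  rewrite mulmxDl mul1mx mulmxBr mulmx1 -scalemxAl -scalemxAr y2 !scaler0 subr0.
  by rewrite subrK.
have -> : act (ycomb (pt R t)) beta = act B beta.
  apply/funext => X; rewrite /act -[RHS]Eb -mulmxA; congr (beta (X *m _)).
  rewrite mulmxDl mul1mx -(scalemxAl _ yproj) (yproj_p10 hI hK hJI).
  by rewrite ycombE !mxE /= scale1r tauE.
have {1}-> : wpow om n = act B (act B' (wpow om n)).
  by apply/funext => X; rewrite /act -mulmxA BB' mulmx1.
rewrite -act_wedge.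
(* Unitriangular in the frame: the common transformation [B] of both factors has determinant 1. *)
have -> : frame *m B = block_mx 1%:M 0 tau%:M 1%:M *m frame.
  rewrite mul_block_col !mul1mx mul0mx addr0 mul_scalar_mx mulmxDr mulmx1.
  rewrite -scalemxAr mul_col_mx e_yproj -mulmxA J_yproj e_p10 scale_col_mx scaler0.
  by rewrite add_col_mx addr0 addrC.
rewrite Lambda_det; last by apply: wedge_Lambda => //; apply/act_Lambda/wpow_Lambda.
rewrite det_lblock !det1 !mul1r.
rewrite (wedge_frame_eq (alpha' := fun X => (- ii * tau) ^+ n * act yproj (wpow Om n) X)) //.
  by rewrite -[X in X * wedge _ _ _]mulr1; apply: wedge_scale => X; rewrite ?mul1r.
move=> X Xp; rewrite /act.
(* For [X] of type (0,1) one has X = X yproj J, so that X (1 - tau yproj) has the shape required by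
   [raises], with c0 = - tau and c1 = 1. *)
have XE : X *m B' = X *m yproj *m p10 *m ((- tau)%:M + 1 *: J).
  rewrite scale1r -(mulmxA X yproj p10) (yproj_p10 hI hK hJI) [RHS]mulmxDr mul_mx_scalar.
  rewrite (scaleNr tau) addrC -(mulmxA X yproj J) (yproj_J _ hJ).
  rewrite mulmxBr mulmx1 -(scalemxAr tau); congr (_ - _).
  by rewrite -[LHS]mulmx1 -(proj10_addproj01 I) mulmxDr Xp add0r.
by rewrite XE (wpow_raises _ _ _ hom) mulr1 mulrN mulNr.
Qed.

Lemma wedge_Pplus_ring (x y z w k a b : C) :
  x * a * (y * b * (w * z * k)) = x * (y * k * (a * b)) * z * w.
Proof. by ring. Qed.

Lemma wedge_Pplus om Om : Lambda om -> raises om Om -> Lambda Om ->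
  exists2 c : C, c != 0 & forall om' Om', Lambda om' -> Lambda Om' -> raises om' Om' ->
  wedge (wpow om' n) (Pplus I J K (wpow om n)) frame = c * wpow Om n e * wpow Om' n e.
Proof.
move=> Lo hom LO.
pose k := laplace R (n * 2) (n * 2) * \det swapmx.
have k0 : k != 0 := mulf_neq0 (laplace_neq0 R _ _) (det_swap_neq0 _).
have bin0 : 'C(n * 2, n)%:R != 0 :> C by rewrite pnatr_eq0 -lt0n bin_gt0; lia.
exists (ii ^+ n * ((- ii) ^+ n * k / 'C(n * 2, n)%:R)).
  have ni0 : - ii != 0 by rewrite oppr_eq0 ii_neq0.
  exact: (mulf_neq0 (expf_neq0 n ii_neq0) (mulf_neq0 (mulf_neq0 (expf_neq0 n ni0) k0) (invr_neq0 bin0))).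
move=> om' Om' Lo' LO' hom'.
have [EO EO'] : (forall X, wpow Om n (X *m p10) = wpow Om n X) /\
    (forall X, wpow Om' n (X *m p10) = wpow Om' n X).
  by split=> X; apply: wpow_p10; [have [] := hom|have [] := hom'].
pose cf l := ii ^+ n * invmx (pwmx R (n * 2)) (Ordinal (mid_ord n)) l.
have -> : Pplus I J K (wpow om n) =
    fun X => \sum_l cf l * act (ycomb (pt R l)) (wpow Om n) X.
  apply/funext => X; rewrite (Pplus_wpow Lo hom) big_distrr; apply: eq_bigr => l _.
  by rewrite /cf -mulrA.
have wr (beta : 'I_(n * 2).+1 -> form R m (n * 2)) :
  wedge (wpow om' n) (fun X => \sum_l beta l X) frame = \sum_l wedge (wpow om' n) (beta l) frame.
  rewrite -big_distrr /= exchange_big; congr (_ * _); apply: eq_bigr => s _.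
  by rewrite big_distrr.
rewrite wr; under eq_bigr => l _.
  rewrite (wedge_scale (a := 1) (b := cf l) (alpha := wpow om' n)
    (beta := act (ycomb (pt R l)) (wpow Om n))) //; last by move=> X; rewrite mul1r.
  rewrite (wedge_ycomb _ hom') //; last exact: wpow_Lambda.
  rewrite wedge_frame //; try exact: wpow_Lambda.
  rewrite mul1r exprMn /cf -/k.
  over.
rewrite -/k.
(* Column n of [pwmx] has the entries 'C(2n, n) l^n, so that the sum is, up to this binomial
   coefficient, a diagonal entry of the product of [pwmx] with its inverse. *)
have wn : \sum_l invmx (pwmx R (n * 2)) (Ordinal (mid_ord n)) l * l%:R ^+ n = 'C(n * 2, n)%:R^-1.
  apply: (mulIf bin0); rewrite mulVf // big_distrl /=.
  pose o := Ordinal (mid_ord n).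
  transitivity ((invmx (pwmx R (n * 2)) *m pwmx R (n * 2)) o o); last first.
    by rewrite (mulVmx (pwmx_unit R (n * 2))) mxE eqxx.
  rewrite [RHS]mxE.
  apply: eq_bigr => l _; rewrite !mxE /= expr1n mulr1.
  by rewrite (_ : n * 2 - n = n)%N; [rewrite -mulrA [_ * 'C(_, _)%:R]mulrC|lia].
rewrite -wn !big_distrr !big_distrl /=; apply: eq_bigr => l _.
exact: wedge_Pplus_ring.
Qed.

(** Each equation is between forms of top degree, on the (1,0)-space or on the whole space, hence a
    single scalar equation, tested on [e] or on [frame]. By [wedge_Pplus] the second scalar equation
    is the first one times a nonzero factor. *)
Lemma pointwise_equiv om Om om' Om' (z : C) :
  Lambda om -> Lambda Om -> raises om Om -> Lambda om' -> Lambda Om' -> raises om' Om' ->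
  wpow Om n e != 0 ->
  (forall X, wpow Om' n X = z * wpow Om n X) <->
  (forall X, wedge (wpow om' n) (Pplus I J K (wpow om n)) X =
             z * wedge (wpow om n) (Pplus I J K (wpow om n)) X).
Proof.
move=> Lo LO hom Lo' LO' hom' nz.
have [c c0 cE] := wedge_Pplus Lo hom LO.
have LP : Lambda (Pplus I J K (wpow om n)).
  have [/(Lambda_plus_irreps I J K) LP _] := Pplus_spec hI hJ hK hJI (wpow_Lambda n Lo).
  exact: finite_irreps_Lambda LP.
have [[E _] [E' _]] := (hom, hom').
have topE om1 X : Lambda om1 -> wedge (wpow om1 n) (Pplus I J K (wpow om n)) X =
  \det (row_mx (X *m A) (X *m yproj *m A)) * wedge (wpow om1 n) (Pplus I J K (wpow om n)) frame.
  move=> L1; rewrite {1}(frame_coords X) Lambda_det //.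
  by apply: wedge_Lambda => //; apply: wpow_Lambda.
split=> [H X|H X].
  rewrite (topE om' X Lo') (topE om X Lo) (cE om' Om' Lo' LO' hom') (cE om Om Lo LO hom) H.
  by rewrite [RHS]mulrCA [c * _ * (z * _)]mulrCA.
have := H frame; rewrite (cE om' Om' Lo' LO' hom') (cE om Om Lo LO hom) => He.
have {}He : wpow Om' n e = z * wpow Om n e.
  by apply: (mulfI (mulf_neq0 c0 nz)); rewrite He mulrCA.
rewrite (top_detform (wpow_Lambda n LO')) => [|Y]; last exact: wpow_p10.
rewrite [in RHS](top_detform (wpow_Lambda n LO)) => [|Y]; last exact: wpow_p10.
by rewrite He mulrA.
Qed.

End Pointwise.

(** * Two-forms as skew matrices *)

Section BilinearForm.
Variables (R : realType) (m : nat).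
Local Notation C := R[i].

Lemma det_mx2 (S : comNzRingType) (M : 'M[S]_2) :
  \det M = M 0 0 * M 1 1 - M 0 1 * M 1 0.
Proof.
rewrite (expand_det_row _ 0) !big_ord_recl big_ord0 addr0 /cofactor !det_mx11 !mxE /=.
rewrite (_ : lift ord0 ord0 = 1 :> 'I_2); last exact/val_inj.
rewrite (_ : lift 1 0 = 0 :> 'I_2); last exact/val_inj.
by rewrite expr0 expr1 mul1r mulN1r mulrN.
Qed.

Definition bilform (B : 'M[C]_m) : form R m 2 :=
  fun X => (row 0 X *m B *m (row 1 X)^T) 0 0.

Lemma bilform_Lambda B : B^T = - B -> Lambda (bilform B).
Proof.
move=> BT; apply: LambdaI => [X k a b u v|X k l kl Xkl]; rewrite /bilform.
  rewrite !row_setrow; case: k => [[|[|//]]] ?; rewrite -!val_eqE /=.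
    by rewrite !mulmxDl -!scalemxAl !mxE.
  by rewrite linearD !linearZ /= mulmxDr -!scalemxAr !mxE.
have -> : row 1 X = row 0 X.
  case: k l kl Xkl => [[|[|//]]] k0 [[|[|//]]] l0; rewrite -val_eqE //= => _ e.
    by rewrite (_ : 1 = Ordinal l0) -?e; [congr row|]; apply/val_inj.
  by rewrite (_ : 1 = Ordinal k0) ?e; [congr row|]; apply/val_inj.
by rewrite skew0 // mxE.
Qed.

(** [Q^T *m P - P^T *m Q] is a generalised inverse of [B], and inserting it splits the form into
    decomposable 2-forms. *)
Lemma bilform_detform n (B : 'M[C]_m) (P Q : 'M[C]_(n, m)) (X : 'M[C]_(2, m)) :
  B^T = - B -> B *m (Q^T *m P - P^T *m Q) *m B = B ->
  bilform B X = \sum_a detform (row_mx (col a (B *m Q^T)) (col a (P *m B)^T)) X.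
Proof.
move=> BT E; rewrite /bilform -{1}E.
have -> : row 0 X *m (B *m (Q^T *m P - P^T *m Q) *m B) *m (row 1 X)^T =
   (row 0 X *m (B *m Q^T)) *m (row 1 X *m (P *m B)^T)^T
   - (row 0 X *m (P *m B)^T) *m (row 1 X *m (B *m Q^T))^T.
  rewrite !trmx_mul !trmxK BT !mulmxBr !mulmxBl !mulmxA.
  by rewrite mulmxBr mulmxBl !mulmxA !(mulmxN, mulNmx) !opprK.
rewrite !mxE -sumrB; apply: eq_bigr => a _.
have cE (N : 'M[C]_(m, n)) i : (row i X *m N) 0 a = (X *m col a N) i 0.
  by rewrite -row_mul colE mulmxA -colE !mxE.
rewrite /detform mul_mx_row det_mx2 !cE ![_^T _ _]mxE !cE.
have r0 (u v : 'M[C]_(2, 1)) i : (row_mx u v : 'M_(2, 1 + 1)) i 0 = u i 0.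
  by rewrite (_ : 0 = @lshift 1 1 0 :> 'I_2) ?(row_mxEl u v) //; apply/val_inj.
have r1 (u v : 'M[C]_(2, 1)) i : (row_mx u v : 'M_(2, 1 + 1)) i 1 = v i 0.
  by rewrite (_ : 1 = @rshift 1 1 0 :> 'I_2) ?(row_mxEr u v) //; apply/val_inj.
by rewrite !r0 !r1.
Qed.

End BilinearForm.

(** * The forms of a quaternionic Hermitian metric at a point *)

Section HermitianForms.
Variables (R : realType) (m n : nat) (I J K g : 'M[R[i]]_m).
Local Notation C := R[i].
Hypotheses (hI : I *m I = - 1%:M) (hJ : J *m J = - 1%:M).
Hypotheses (hK : I *m J = K) (hJI : J *m I = - K).
Hypotheses (gT : g^T = g) (gI : I *m g *m I^T = g) (gJ : J *m g *m J^T = g).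
Hypothesis gnd : forall v : 'rV[C]_m, v *m g = 0 -> v = 0.
Local Notation p10 := (proj10 I).
Local Notation p01 := (proj01 I).
Local Notation ii := ('i%C : C).

Definition kahler_mx : 'M[C]_m := g *m I^T.
Definition Omega_mx : 'M[C]_m := - (g *m J^T - ii *: (g *m K^T)).
Local Notation Bo := kahler_mx.
Local Notation BO := Omega_mx.

Lemma mulIg : I *m g = - (g *m I^T).
Proof. by rewrite -{1}gI !mulmxA hI mulNmx mul1mx mulNmx. Qed.

Lemma mulJg : J *m g = - (g *m J^T).
Proof. by rewrite -{1}gJ !mulmxA hJ mulNmx mul1mx mulNmx. Qed.

Lemma mulKg : K *m g = - (g *m K^T).
Proof.
rewrite -[in LHS]hK -mulmxA mulJg mulmxN mulmxA mulIg mulNmx opprK -mulmxA -trmx_mul hJI.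
by rewrite linearN mulmxN.
Qed.

Lemma kahler_skew : Bo^T = - Bo.
Proof. by rewrite /Bo trmx_mul trmxK gT mulIg. Qed.

Lemma Omega_skew : BO^T = - BO.
Proof.
rewrite /BO linearN linearB /= linearZ /= !trmx_mul !trmxK gT mulJg mulKg.
by rewrite scalerN -opprD.
Qed.

Lemma KI : K *m I = J.
Proof. by rewrite -hK -mulmxA hJI -hK mulmxN mulmxA hI mulNmx mul1mx opprK. Qed.

Lemma JK : J *m K = I.
Proof. by rewrite -[K]opprK -hJI mulmxN mulmxA hJ mulNmx mul1mx opprK. Qed.

Lemma p10_Omega : p10 *m BO = BO.
Proof.
have IB : I *m BO = ii *: BO.
  rewrite /BO mulmxN mulmxBr -scalemxAr !mulmxA mulIg !mulNmx -!mulmxA -!trmx_mul hJI KI.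
  rewrite linearN mulmxN !scalerN !opprK scalerBr scalerA sqr_iC scaleN1r opprK.
  by rewrite addrC.
rewrite /proj10 -scalemxAl mulmxBl mul1mx -scalemxAl IB scalerA sqr_iC scaleN1r opprK.
by rewrite -mulr2n -[BO *+ 2]scaler_nat scalerA mulVf ?scale1r // pnatr_eq0.
Qed.

Lemma Omega_p10 : BO *m p10^T = BO.
Proof. by apply: BpT; [exact: Omega_skew|exact: p10_Omega]. Qed.

Lemma Omega_nondegenerate (v : 'rV[C]_m) : v *m p10 = v -> v *m BO = 0 -> v = 0.
Proof.
move=> vp; rewrite /BO mulmxN => /eqP; rewrite oppr_eq0 mulmxBr subr_eq0 => /eqP vB.
have vI : v *m I = ii *: v by rewrite -{1}vp -mulmxA proj10_mulI // -scalemxAr vp.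
apply: gnd; have := congr1 (mulmx^~ J^T) vB.
have JJ : J^T *m J^T = - 1%:M by rewrite -trmx_mul hJ linearN /= trmx1.
have KJ : K^T *m J^T = I^T by rewrite -trmx_mul JK.
rewrite -scalemxAr -scalemxAl -!mulmxA JJ KJ !mulmxN mulmx1.
have -> : g *m I^T = - (I *m g) by rewrite mulIg opprK.
rewrite !mulmxN scalerN mulmxA vI -scalemxAl scalerA sqr_iC scaleN1r opprK => /eqP.
by rewrite eq_sym -addr_eq0 -mulr2n -[_ *+ 2]scaler_nat scaler_eq0 pnatr_eq0 /= => /eqP.
Qed.

Lemma scale_rotation (V : lmodType C) (c0 c1 : C) (x y : V) :
  c0 *: (c0 *: x + c1 *: - y) + c1 *: (c0 *: - y + c1 *: - x) =
  (c0 * c0 - c1 * c1) *: x - (c0 * c1) *: (y *+ 2).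
Proof.
rewrite mulr2n !scalerDr !scalerN !scalerA scalerBl (mulrC c1 c0).
by rewrite opprD addrA addrAC addrAC -!addrA; congr (_ + _); rewrite addrC -!addrA addrC -addrA.
Qed.

(** c0 + c1 J rotates [Bo] towards the form [D] of [K]: the result is (c0^2 - c1^2) Bo - 2 c0 c1 D.
    On (1,0)-vectors [Bo] vanishes, being of type (1,1), and [BO] is 2i times the restriction of
    [D]. *)
Lemma raises_metric : raises I J (bilform Bo) (bilform BO).
Proof.
have E (B U V : 'M[C]_m) (X : 'M_(2, m)) : U *m B *m U^T = V -> bilform B (X *m U) = bilform V X.
  by move=> <-; rewrite /bilform !row_mul trmx_mul !mulmxA.
split=> [X|c0 c1 X]; first by apply: E; rewrite p10_Omega Omega_p10.
rewrite -mulmxA (E Bo _ ((ii * c0 * c1) *: BO)).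
  by rewrite /bilform -scalemxAr -scalemxAl mxE.
pose G := p10 *m (g *m K^T) *m p10^T.
have pBp : p10 *m Bo *m p10^T = 0.
  have E1 : p10 *m Bo *m p10^T = - (ii *: (p10 *m g *m p10^T)).
    rewrite /Bo -[g *m I^T]opprK -mulIg mulmxN mulmxA proj10_mulI //.
    by rewrite mulNmx -!scalemxAl.
  have E2 : p10 *m Bo *m p10^T = ii *: (p10 *m g *m p10^T).
    by rewrite /Bo -!mulmxA -trmx_mul proj10_mulI // linearZ /= -!scalemxAr !mulmxA.
  move: E1; rewrite E2 => /eqP; rewrite -addr_eq0 -mulr2n -[_ *+ 2]scaler_nat scaler_eq0.
  by rewrite pnatr_eq0 => /eqP.
have iBO : ii *: BO = - (G *+ 2).
  have gJp : g *m J^T *m p10^T = - (ii *: (g *m K^T *m p10^T)).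
    have pK : p10 *m K = ii *: (p10 *m J) by rewrite -hK mulmxA proj10_mulI // -(scalemxAl ii).
    have pKT : (p10 *m K)^T = ii *: (p10 *m J)^T by rewrite pK linearZ.
    by rewrite -!mulmxA -!trmx_mul pKT -(scalemxAr ii) (scalerA ii ii) sqr_iC scaleN1r opprK.
  pose Z := g *m K^T *m p10^T.
  have BZ : BO *m p10^T = ii *: (Z + Z).
    by rewrite mulNmx mulmxBl gJp -(scalemxAl ii) -/Z -opprD opprK scalerDr.
  have pZ : p10 *m (Z + Z) = G *+ 2 by rewrite mulmxDr /Z !mulmxA -mulr2n /G !mulmxA.
  rewrite -{1}p10_Omega -{1}Omega_p10 BZ -(scalemxAr ii) (scalerA ii ii) sqr_iC scaleN1r.
  by rewrite pZ.
pose D := g *m K^T.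
have BJ : Bo *m J^T = - D by rewrite /Bo -mulmxA -trmx_mul hJI linearN mulmxN.
have JB : J *m Bo = - D by rewrite /Bo mulmxA mulJg mulNmx -mulmxA -trmx_mul hK.
have DJ : D *m J^T = Bo by rewrite /D -mulmxA -trmx_mul JK.
have UBU : (c0%:M + c1 *: J) *m Bo *m (c0%:M + c1 *: J)^T =
    (c0 * c0 - c1 * c1) *: Bo - (c0 * c1) *: (D *+ 2).
  rewrite linearD linearZ /= tr_scalar_mx mulmxDl mul_scalar_mx -scalemxAl JB.
  rewrite mulmxDr mul_mx_scalar -scalemxAr mulmxDl -!scalemxAl BJ mulNmx DJ.
  exact: scale_rotation.
have cong (W : 'M[C]_m) : p10 *m W *m Bo *m (p10 *m W)^T = p10 *m (W *m Bo *m W^T) *m p10^T.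
  by rewrite trmx_mul !mulmxA.
have pDp : p10 *m (D *+ 2) *m p10^T = G *+ 2 by rewrite mulr2n mulmxDr mulmxDl -/D -mulr2n.
rewrite cong UBU mulmxBr mulmxBl -(scalemxAr (c0 * c0 - _)) -(scalemxAl (c0 * c0 - _)) pBp scaler0 sub0r.
rewrite -(scalemxAr (c0 * c1)) -(scalemxAl (c0 * c1)) pDp.
by rewrite -mulrA (mulrC ii) -(scalerA (c0 * c1)) iBO (scalerN (c0 * c1)).
Qed.

Hypothesis mE : m = (4 * n)%N.

(** [J] exchanges the two projections, whose ranks are therefore equal, with sum 4n. *)
Lemma rank_proj10 : \rank p10 = (n + n)%N.
Proof.
have E1 : p01 = - J *m p10 *m J.
  by rewrite !mulNmx -(proj01_mulJ hK hJI) -mulmxA hJ mulmxN mulmx1 opprK.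
have E2 : p10 = - J *m p01 *m J.
  by rewrite !mulNmx -(proj10_mulJ hK hJI) -mulmxA hJ mulmxN mulmx1 opprK.
have r1 : (\rank p01 <= \rank p10)%N.
  by rewrite {1}E1 (leq_trans (mxrankM_maxl _ _)) // mxrankM_maxr.
have r2 : (\rank p10 <= \rank p01)%N.
  by rewrite {1}E2 (leq_trans (mxrankM_maxl _ _)) // mxrankM_maxr.
have := mxrank_add p10 p01; rewrite proj10_addproj01 mxrank1.
have := mulmx0_rank_max (proj10_proj01 hI).
move: (\rank p10) (\rank p01) r1 r2 => a b; lia.
Qed.

(** The rows of [e] are a symplectic basis for [Omega_mx] in the interleaved order of [unpair], and
    the columns of [A] are the dual covectors; A e = p10 is then [symplectic_proj]. *)
Lemma adapted_frame : exists (e : 'M[C]_(n * 2, m)) (A : 'M[C]_(m, n * 2)),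
  [/\ e *m A = 1%:M, A *m e = p10 & wpow (bilform BO) n e != 0].
Proof.
have [P [Q PQ]] := symplectic_exists (proj10_id hI) rank_proj10 Omega_skew p10_Omega
  Omega_nondegenerate.
have DE := symplectic_proj rank_proj10 Omega_skew p10_Omega PQ.
have [Pp Qp PP QQ PQ1] := PQ.
have QP : Q *m BO *m P^T = - 1%:M by rewrite (skew_swap Omega_skew) PQ1 trmx1.
exists (rowsub (@unpair n) (col_mx P Q)), (colsub (@unpair n) (row_mx (BO *m Q^T) (- (BO *m P^T)))).
split.
- transitivity (mxsub (@unpair n) (@unpair n)
    (col_mx P Q *m row_mx (BO *m Q^T) (- (BO *m P^T)))).
    by apply/matrixP => i j; rewrite !mxE; apply: eq_bigr => k _; rewrite !mxE.
  rewrite mul_col_row !mulmxN !mulmxA PQ1 PP QQ QP oppr0 opprK -scalar_mx_block.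
  by apply/matrixP => i j; rewrite !mxE (inj_eq (@unpair_inj n)).
- rewrite -DE mulmxBr !mulmxA.
  transitivity (row_mx (BO *m Q^T) (- (BO *m P^T)) *m col_mx P Q); last first.
    by rewrite mul_row_col (mulNmx (BO *m P^T)).
  have bij : bijective (@unpair n).
    by apply: inj_card_bij; [exact: unpair_inj|rewrite !card_ord; lia].
  apply/matrixP => i j; rewrite [LHS]mxE [RHS]mxE.
  rewrite [RHS](reindex (@unpair n)) /=; last by apply: onW_bij.
  by apply: eq_bigr => k _; rewrite !mxE.
apply: (wpow_symplectic (L := BO *m Q^T) (M := (P *m BO)^T)).
- by move=> X; apply: bilform_detform; [exact: Omega_skew|rewrite DE p10_Omega].
- by rewrite mulmxA.
- by rewrite trmx_mul Omega_skew (mulNmx BO) mulmxN mulmxA PP oppr0.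
- by rewrite mulmxA.
- by rewrite trmx_mul Omega_skew (mulNmx BO) mulmxN mulmxA QP opprK.
Qed.

End HermitianForms.

Local Open Scope classical_set_scope.
Local Open Scope ring_scope.

(** * Directional derivatives from continuous partial derivatives *)

Section DirectionalDerivatives.
Variables (R : realType) (m : nat) (U : set 'rV[R]_m).
Hypothesis oU : open U.
Implicit Types (f : 'rV[R]_m -> R) (v x y : 'rV[R]_m) (a : 'I_m).

Lemma derive_line f a x (t : R) : derivable f (x + t *: 'e_a) 'e_a ->
  is_derive t 1 (fun s : R => f (x + s *: 'e_a)) ('D_('e_a) f (x + t *: 'e_a)).
Proof.
have E : (fun h : R => h^-1 *: (((fun s : R => f (x + s *: 'e_a)) \o shift t) (h *: 1) - f (x + t *: 'e_a)))
  = (fun h => h^-1 *: ((f \o shift (x + t *: 'e_a)) (h *: 'e_a) - f (x + t *: 'e_a))).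
  apply/funext => h /=; congr (_ *: (f _ - _)).
  by rewrite -[h *: 1]/(h * 1) mulr1 scalerDl addrCA.
by move=> d; split; rewrite /derivable /derive E.
Qed.

Lemma mean_value_line f a x (t : R) :
  (forall s : R, `|s| <= `|t| -> U (x + s *: 'e_a)) ->
  (forall y, U y -> derivable f y 'e_a) ->
  exists2 s : R, `|s| <= `|t| & f (x + t *: 'e_a) - f x = 'D_('e_a) f (x + s *: 'e_a) * t.
Proof.
move=> Ux df; pose F (s : R) : R := f (x + s *: 'e_a); pose dF (s : R) : R := 'D_('e_a) f (x + s *: 'e_a).
have dFP (s : R) : `|s| <= `|t| -> is_derive s (1 : R) F (dF s).
  by move=> /Ux/df; exact: derive_line.
have F0 : f x = F 0 by rewrite /F scale0r addr0.
have key (p q : R) : p <= q -> (forall s : R, s \in `[p, q]%R -> `|s| <= `|t|) ->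
    exists2 s : R, `|s| <= `|t| & F q - F p = dF s * (q - p).
  move=> pq pqt.
  have [||s sI E] := @MVT_segment R F dF p q pq.
  - move=> s sI; apply/dFP/pqt; move: sI; rewrite !in_itv /= => /andP[? ?].
    by rewrite !ltW.
  - by apply: derivable_within_continuous => s sI; have [] := dFP _ (pqt _ sI).
  by exists s => //; exact: pqt.
rewrite F0 -/(F t); have [t0|t0] := leP 0 t.
  have [s|s st E] := key 0 t t0; last by exists s; rewrite // E subr0.
  by rewrite in_itv /= => /andP[s0 st]; rewrite !ger0_norm.
have [s|s st E] := key t 0 (ltW t0); last first.
  by exists s; rewrite // -opprB E sub0r mulrN opprK.
by rewrite in_itv /= => /andP[ts s0]; rewrite (ler0_norm s0) (ltr0_norm t0) lerN2.
Qed.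

Lemma norm_basis_le1 a : `|'e_a : 'rV[R]_m| <= 1.
Proof.
rewrite [leLHS]/Num.Def.normr /= mx_normrE; apply: bigmax_le => // -[i j] _.
by rewrite mxE normr_nat lern1 leq_b1.
Qed.

(** The derivative along [v], in a form to which a further coordinate direction can be added by the
    mean value theorem. *)
Definition expands f y v (L : R) := forall e : R, 0 < e ->
  exists2 d : R, 0 < d & forall h : R, `|h| < d -> `|f (y + h *: v) - f y - h * L| <= e * `|h|.

Lemma expands_derive f y v L : expands f y v L -> is_derive y v f L.
Proof.
move=> fL.
have c : (fun h : R => h^-1 *: ((f \o shift y) (h *: v) - f y)) @ 0^' --> L.
  apply/cvgrPdist_le => /= e e0; have [d d0 fd] := fL e e0.
  near=> h.
  have h0 : h != 0 by near: h; exact: nbhs_dnbhs_neq.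
  have hd : `|h| < d by near: h; exact: dnbhs0_lt.
  have hp : 0 < `|h| by rewrite normr_gt0.
  rewrite distrC -(ler_pM2r hp).
  have -> : h^-1 *: (f (h *: v + y) - f y) - L = h^-1 * (f (y + h *: v) - f y - h * L).
    by rewrite [RHS]mulrBr mulKf // (addrC y).
  by rewrite normrM normfV mulrAC mulVf ?normr_eq0 // mul1r; exact: fd.
split; first by apply/cvg_ex; exists L.
exact/cvg_lim.
Unshelve. all: by end_near. Qed.

Lemma expandsDe f y v L a (c : R) : U y ->
  (forall z, U z -> derivable f z 'e_a) -> {for y, continuous ('D_('e_a) f)} ->
  expands f y v L -> expands f y (v + c *: 'e_a) (L + c * 'D_('e_a) f y).
Proof.
move=> Uy df cdf fL e e0.
(* [k] bounds |c| and is positive even for c = 0. *)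
pose k := `|c| + 1.
have k0 : 0 < k by rewrite ltr_wpDl.
have [d1 d10 fd1] := fL (e / 2) (divr_gt0 e0 (ltr0n _ 2)).
have : \forall z \near y, U z /\ `|'D_('e_a) f y - 'D_('e_a) f z| <= e / (2 * k).
  near=> z; split; near: z; first exact: open_nbhs_nbhs.
  by move/cvgrPdist_le: cdf; apply; rewrite divr_gt0 // mulr_gt0.
move=> /nbhs_normP [r /= r0 yr].
exists (Num.min d1 (r / (`|v| + k))).
  by rewrite lt_min d10 divr_gt0 // ltr_wpDl.
move=> h; rewrite lt_min => /andP[hd1]; rewrite ltr_pdivlMr ?ltr_wpDl // => hr.
have near_y (s : R) : `|s| <= `|h * c| -> U (y + h *: v + s *: 'e_a) /\
    `|'D_('e_a) f y - 'D_('e_a) f (y + h *: v + s *: 'e_a)| <= e / (2 * k).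
  move=> sh; apply: yr => /=; rewrite /ball_ /= -addrA opprD addNKr normrN.
  apply: le_lt_trans hr; rewrite (le_trans (ler_normD _ _)) // mulrDr lerD //.
    by rewrite normrZ.
  rewrite normrZ (le_trans (ler_wpM2l _ (_ : _ <= 1))) //.
    exact: norm_basis_le1.
  rewrite mulr1 (le_trans sh) // normrM ler_wpM2l // /k lerDl //.
have [|s sh E] := @mean_value_line f a (y + h *: v) (h * c) _ df.
  by move=> s /near_y[].
have [_ D] := near_y s sh.
have -> : f (y + h *: (v + c *: 'e_a)) - f y - h * (L + c * 'D_('e_a) f y) =
    (f (y + h *: v) - f y - h * L) +
    (f (y + h *: v + (h * c) *: 'e_a) - f (y + h *: v) - h * c * 'D_('e_a) f y).
  rewrite scalerDr scalerA addrA; set A := f _; set B := f (y + h *: v); set D0 := 'D_ _ f y.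
  ring.
rewrite E [X in _ + (X - _)]mulrC -mulrBr (le_trans (ler_normD _ _)) // [e]splitr mulrDl lerD ?fd1 //.
rewrite normrM normrM -mulrA mulrC ler_wpM2r //.
rewrite (le_trans (ler_wpM2l _ (_ : _ <= e / (2 * k)))) //.
  by rewrite distrC.
have -> : `|c| * (e / (2 * k)) = e / 2 * (`|c| / k).
  by rewrite invfM mulrCA -!mulrA; congr (_ * _); rewrite mulrCA.
rewrite ler_piMr ?divr_ge0 ?(ltW e0) // ler_pdivrMr // mul1r lerDl //.
Unshelve. all: by end_near. Qed.

(** [Ck] speaks of coordinate directions only, whereas [lie_bracket] differentiates along arbitrary
    vectors. The direction is built up one coordinate at a time, continuity of the partial
    derivatives controlling the error. *)
Lemma Ck1_derive f y v : Ck 1 U f -> U y ->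
  is_derive y v f (\sum_a v 0 a * 'D_('e_a) f y).
Proof.
move=> [_ f1] Uy; apply: expands_derive.
rewrite [X in expands _ _ X]row_sum_delta.
elim/big_rec2: _ => [|a L w _ IH].
  by move=> e e0; exists 1 => // h _; rewrite scaler0 addr0 subrr mulr0 subr0 normr0 mulr_ge0 // ltW.
rewrite addrC [_ * _ + _]addrC; have [df [cdf _]] := f1 a; apply: expandsDe => //.
exact: cdf.
Qed.

Lemma smooth_cst (k : R) : smooth_on U (fun=> k).
Proof.
move=> l; elim: l k => [|l IH] k; split=> //.
- by move=> y _; exact: cst_continuous.
- by move=> y _; exact: cst_continuous.
move=> a; split=> [y _|]; first exact: derivable_cst.
have -> : (fun y => 'D_('e_a) (fun=> k) y) = (fun=> 0).
  by apply/funext => y; exact: derive_cst.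
exact: IH.
Qed.

End DirectionalDerivatives.

(** * Partial derivatives of complex functions and matrices *)

Section ComplexPartials.
Variables (R : realType) (m : nat) (a : 'I_m) (y : 'rV[R]_m).
Local Notation C := R[i].
Local Notation ii := ('i%C : C).

Definition is_cpartial (h : 'rV[R]_m -> C) (d : C) : Prop :=
  is_derive y 'e_a (fun z => complex.Re (h z)) (complex.Re d) /\
  is_derive y 'e_a (fun z => complex.Im (h z)) (complex.Im d).

Lemma is_cpartial_eq h d : is_cpartial h d -> cpartial a h y = d.
Proof. by case: d => p q [[_ hp] [_ hq]]; rewrite /cpartial hp hq. Qed.

Lemma is_cpartial_cst k : is_cpartial (fun=> k) 0.
Proof. by split; exact: is_derive_cst. Qed.

Lemma is_cpartial_real (f : 'rV[R]_m -> R) d : is_derive y 'e_a f d ->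
  is_cpartial (fun z => (f z)%:C) d%:C.
Proof. by move=> fd; split => //=; exact: is_derive_cst. Qed.

Lemma is_cpartialD h k d e : is_cpartial h d -> is_cpartial k e ->
  is_cpartial (fun z => h z + k z) (d + e).
Proof.
move=> [h1 h2] [k1 k2]; split.
- have -> : (fun z => complex.Re (h z + k z)) =
            (fun z => complex.Re (h z)) + (fun z => complex.Re (k z)).
    by apply/funext => z; rewrite raddfD.
  by rewrite raddfD; exact: is_deriveD.
- have -> : (fun z => complex.Im (h z + k z)) =
            (fun z => complex.Im (h z)) + (fun z => complex.Im (k z)).
    by apply/funext => z; rewrite raddfD.
  by rewrite raddfD; exact: is_deriveD.
Qed.

Lemma is_cpartialM h k d e : is_cpartial h d -> is_cpartial k e ->
  is_cpartial (fun z => h z * k z) (d * k y + h y * e).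
Proof.
have Re_mul (p q : C) : complex.Re (p * q) =
    complex.Re p * complex.Re q - complex.Im p * complex.Im q by case: p q => [? ?] [? ?].
have Im_mul (p q : C) : complex.Im (p * q) =
    complex.Re p * complex.Im q + complex.Im p * complex.Re q by case: p q => [? ?] [? ?].
have Re_add (p q : C) : complex.Re (p + q) = complex.Re p + complex.Re q by rewrite raddfD.
have Im_add (p q : C) : complex.Im (p + q) = complex.Im p + complex.Im q by rewrite raddfD.
move=> [h1 h2] [k1 k2]; split.
- have -> : (fun z => complex.Re (h z * k z)) =
      (fun z => complex.Re (h z)) * (fun z => complex.Re (k z)) -
      (fun z => complex.Im (h z)) * (fun z => complex.Im (k z)).
    by apply/funext => z; rewrite Re_mul.
  apply: (is_derive_eq (is_deriveB (is_deriveM h1 k1) (is_deriveM h2 k2))); rewrite Re_add !Re_mul.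
  rewrite -![_ *: _]/(_ * _); ring.
- have -> : (fun z => complex.Im (h z * k z)) =
      (fun z => complex.Re (h z)) * (fun z => complex.Im (k z)) +
      (fun z => complex.Im (h z)) * (fun z => complex.Re (k z)).
    by apply/funext => z; rewrite Im_mul.
  apply: (is_derive_eq (is_deriveD (is_deriveM h1 k2) (is_deriveM h2 k1))); rewrite Im_add !Im_mul.
  rewrite -![_ *: _]/(_ * _); ring.
Qed.

Lemma is_cpartial_sum n (h : 'I_n -> 'rV[R]_m -> C) d :
  (forall k, is_cpartial (h k) (d k)) ->
  is_cpartial (fun z => \sum_(k < n) h k z) (\sum_(k < n) d k).
Proof.
move=> hd; elim: n h d hd => [|n IH] h d hd.
  rewrite big_ord0 (_ : (fun=> _) = fun=> 0); first exact: is_cpartial_cst.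
  by apply/funext => z; rewrite big_ord0.
rewrite big_ord_recr (_ : (fun=> _) = fun z => \sum_(k < n) h (widen_ord (leqnSn n) k) z + h ord_max z).
  by apply: is_cpartialD => //; apply: IH.
by apply/funext => z; rewrite big_ord_recr.
Qed.

Lemma is_cpartial_near (U : set 'rV[R]_m) h k d : open U -> U y ->
  (forall z, U z -> h z = k z) -> is_cpartial h d -> is_cpartial k d.
Proof.
move=> oU Uy hk [h1 h2].
have near_eq (p : C -> R) : \near y, p (h y) = p (k y).
  by near=> z; rewrite hk //; near: z; exact: open_nbhs_nbhs.
by split; [exact: near_eq_is_derive h1|exact: near_eq_is_derive h2].
Unshelve. all: by end_near. Qed.

Definition is_mpartial p q (F : 'rV[R]_m -> 'M[C]_(p, q)) (D : 'M[C]_(p, q)) : Prop :=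
  forall i j, is_cpartial (fun z => F z i j) (D i j).

Lemma is_mpartial_unique p q (F : 'rV[R]_m -> 'M[C]_(p, q)) D D' :
  is_mpartial F D -> is_mpartial F D' -> D = D'.
Proof.
move=> FD FD'; apply/matrixP => i j.
by rewrite -(is_cpartial_eq (FD i j)) (is_cpartial_eq (FD' i j)).
Qed.

Lemma is_mpartial_cst p q (F : 'M[C]_(p, q)) : is_mpartial (fun=> F) 0.
Proof. by move=> i j; rewrite mxE; exact: is_cpartial_cst. Qed.

Lemma is_mpartialD p q (F G : 'rV[R]_m -> 'M[C]_(p, q)) D E :
  is_mpartial F D -> is_mpartial G E -> is_mpartial (fun z => F z + G z) (D + E).
Proof.
move=> FD GE i j; rewrite mxE (_ : (fun=> _) = fun z => F z i j + G z i j); first exact: is_cpartialD.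
by apply/funext => z; rewrite mxE.
Qed.

Lemma is_mpartialM p q r (F : 'rV[R]_m -> 'M[C]_(p, q)) (G : 'rV[R]_m -> 'M[C]_(q, r)) D E :
  is_mpartial F D -> is_mpartial G E ->
  is_mpartial (fun z => F z *m G z) (D *m G y + F y *m E).
Proof.
move=> FD GE i j; rewrite !mxE -big_split /=.
rewrite (_ : (fun=> _) = fun z => \sum_k F z i k * G z k j); last first.
  by apply/funext => z; rewrite mxE.
by apply: is_cpartial_sum => k; exact: is_cpartialM.
Qed.

Lemma is_mpartialZ p q (k : C) (F : 'rV[R]_m -> 'M[C]_(p, q)) D :
  is_mpartial F D -> is_mpartial (fun z => k *: F z) (k *: D).
Proof.
move=> FD i j; rewrite mxE (_ : (fun=> _) = fun z => k * F z i j); last first.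
  by apply/funext => z; rewrite mxE.
have := is_cpartialM (is_cpartial_cst k) (FD i j).
by rewrite mul0r add0r.
Qed.

Lemma is_mpartial_near (U : set 'rV[R]_m) p q (F G : 'rV[R]_m -> 'M[C]_(p, q)) D :
  open U -> U y -> (forall z, U z -> F z = G z) -> is_mpartial F D -> is_mpartial G D.
Proof.
move=> oU Uy FG FD i j.
by apply: (is_cpartial_near oU Uy _ (FD i j)) => z Uz; rewrite FG.
Qed.

Lemma is_mpartial_real p q (F : 'rV[R]_m -> 'M[R]_(p, q)) (D : 'M[R]_(p, q)) :
  (forall i j, is_derive y 'e_a (fun z => F z i j) (D i j)) ->
  is_mpartial (fun z => cmx (F z)) (cmx D).
Proof.
move=> FD i j; rewrite mxE (_ : (fun=> _) = fun z => (F z i j)%:C); first exact: is_cpartial_real.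
by apply/funext => z; rewrite mxE.
Qed.

Lemma is_mpartial_proj01 (F : 'rV[R]_m -> 'M[C]_m) D :
  is_mpartial F D -> is_mpartial (fun z => proj01 (F z)) ((2%:R^-1 * ii) *: D).
Proof.
move=> FD.
have := is_mpartialZ 2%:R^-1 (is_mpartialD (is_mpartial_cst 1%:M) (is_mpartialZ ii FD)).
by rewrite add0r scalerA.
Qed.

End ComplexPartials.

(** * The Nijenhuis tensor as a bilinear expression *)

Section Nijenhuis.
Variables (S : comNzRingType) (m : nat).
Implicit Types (D : 'I_m -> 'M[S]_m) (E : 'M[S]_m) (u v w : 'rV[S]_m).

Definition dir (V : lmodType S) (D : 'I_m -> V) w : V := \sum_a w 0 a *: D a.

Lemma dirD (V : lmodType S) (D : 'I_m -> V) v w : dir D (v + w) = dir D v + dir D w.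
Proof. by rewrite -big_split; apply: eq_bigr => a _; rewrite mxE scalerDl. Qed.

Lemma dirZ (V : lmodType S) (D : 'I_m -> V) k w : dir D (k *: w) = k *: dir D w.
Proof. by rewrite scaler_sumr; apply: eq_bigr => a _; rewrite mxE scalerA. Qed.

Lemma dir_eq0 (V : lmodType S) (D : 'I_m -> V) w :
  (forall a, D a = 0) -> dir D w = 0.
Proof. by move=> D0; rewrite /dir big1 // => a _; rewrite D0 scaler0. Qed.

Lemma dir_mulmxl p q (A : 'M[S]_(q, m)) (D : 'I_m -> 'M[S]_(m, p)) w :
  dir (fun a => A *m D a) w = A *m dir D w.
Proof. by rewrite /dir mulmx_sumr; apply: eq_bigr => a _; rewrite scalemxAr. Qed.

Lemma dir_mulmxr p q (D : 'I_m -> 'M[S]_(q, m)) (A : 'M[S]_(m, p)) w :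
  dir (fun a => D a *m A) w = dir D w *m A.
Proof. by rewrite /dir mulmx_suml; apply: eq_bigr => a _; rewrite scalemxAl. Qed.

Lemma dir_add (V : lmodType S) (D E : 'I_m -> V) w :
  dir (fun a => D a + E a) w = dir D w + dir E w.
Proof. by rewrite /dir -big_split; apply: eq_bigr => a _; rewrite scalerDr. Qed.

Lemma dir_scale (V : lmodType S) (D : 'I_m -> V) k w :
  dir (fun a => k *: D a) w = k *: dir D w.
Proof. by rewrite /dir scaler_sumr; apply: eq_bigr => a _; rewrite !scalerA mulrC. Qed.

(** The Nijenhuis tensor on constant vector fields, where [D a] is the a-th partial derivative of
    [E] and [dir D w] the derivative along [w]. Being bilinear, the expression makes sense for
    complex vectors. *)
Definition nijenhuis D E u v : 'rV[S]_m :=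
  v *m dir D (u *m E) - u *m dir D (v *m E) + u *m dir D v *m E - v *m dir D u *m E.

Lemma nijenhuis_lin D E k u w v :
  nijenhuis D E (k *: u + w) v = k *: nijenhuis D E u v + nijenhuis D E w v.
Proof.
have scale_comb (a1 a2 a3 a4 b1 b2 b3 b4 : 'rV[S]_m) :
    (k *: a1 + b1) - (k *: a2 + b2) + (k *: a3 + b3) - (k *: a4 + b4) =
    k *: (a1 - a2 + a3 - a4) + (b1 - b2 + b3 - b4).
  rewrite scalerBr scalerDr scalerBr !opprD (addrACA (k *: a1) b1).
  by rewrite (addrACA (k *: a1 - k *: a2)) (addrACA (k *: a1 - k *: a2 + k *: a3)).
rewrite /nijenhuis -scale_comb !mulmxDl -!scalemxAl !dirD !dirZ !mulmxDr !mulmxDl.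
by rewrite -!scalemxAr -!scalemxAl.
Qed.

Lemma nijenhuis_sym D E u v : nijenhuis D E v u = - nijenhuis D E u v.
Proof. by rewrite /nijenhuis !opprD !opprK; rewrite (addrC (u *m _)) addrAC. Qed.

Lemma nijenhuis0 D E v : nijenhuis D E 0 v = 0.
Proof. by have := nijenhuis_lin D E (-1) 0 0 v; rewrite scaler0 addr0 scaleN1r addNr. Qed.

Lemma nijenhuis_basis D E : (forall a b, nijenhuis D E 'e_a 'e_b = 0) ->
  forall u v, nijenhuis D E u v = 0.
Proof.
move=> NE.
have lin0 v : (forall a, nijenhuis D E 'e_a v = 0) -> forall u, nijenhuis D E u v = 0.
  move=> Nv u; rewrite [u]row_sum_delta; elim/big_rec: _ => [|a w _ IH]; first exact: nijenhuis0.
  by rewrite nijenhuis_lin Nv IH scaler0 addr0.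
move=> u v; apply: (lin0 v) => a.
by rewrite nijenhuis_sym (lin0 'e_a) ?oppr0.
Qed.

End Nijenhuis.

Lemma map_nijenhuis (S T : comNzRingType) (f : {rmorphism S -> T}) m (D : 'I_m -> 'M[S]_m) E u v :
  map_mx f (nijenhuis D E u v) =
  nijenhuis (fun a => map_mx f (D a)) (map_mx f E) (map_mx f u) (map_mx f v).
Proof.
have map_dir w : map_mx f (dir D w) = dir (fun a => map_mx f (D a)) (map_mx f w).
  rewrite /dir raddf_sum; apply: eq_bigr => a _ /=; rewrite map_mxZ mxE //.
by rewrite /nijenhuis !raddfD /= !raddfN /= !map_mxM !map_dir !map_mxM.
Qed.

(** * Integrability in coordinates *)

Section IntegrableFields.
Variables (R : realType) (m : nat) (U : set 'rV[R]_m) (y : 'rV[R]_m).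
Hypotheses (oU : open U) (Uy : U y).
Variable E : 'rV[R]_m -> 'M[R]_m.
Hypothesis sE : smooth_mx_on U E.

Definition mx_partial a : 'M[R]_m := \matrix_(i, j) 'D_('e_a) (fun z => E z i j) y.

Lemma mx_partialP a : is_mpartial a y (fun z => cmx (E z)) (cmx (mx_partial a)).
Proof.
apply: is_mpartial_real => i j; rewrite mxE; apply: DeriveDef => //.
by have [_ /(_ a)[+ _]] := sE i j 1; apply.
Qed.

Lemma derive_row a v :
  is_derive y v (fun z => 'e_a *m E z : 'rV[R]_m) ('e_a *m dir mx_partial v).
Proof.
have dE j : is_derive y v (fun z => ('e_a *m E z : 'rV[R]_m) 0 j) (('e_a *m dir mx_partial v : 'rV[R]_m) 0 j).
  rewrite (_ : (fun=> _) = fun z => E z a j); last by apply/funext => z; rewrite -rowE mxE.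
  rewrite -rowE mxE summxE.
  apply: (is_derive_eq (Ck1_derive oU v (sE a j 1) Uy)).
  by apply: eq_bigr => b _; rewrite !mxE.
have d : derivable (fun z => 'e_a *m E z : 'rV[R]_m) y v.
  by apply/derivable_mxP => i j; rewrite ord1; have [] := dE j.
apply: DeriveDef => //; rewrite derive_mx //; apply/rowP => j; rewrite mxE.
by have [_ ->] := dE j.
Qed.

(** Integrability is applied to constant coordinate fields; bilinearity of [nijenhuis] then reaches
    all complex vectors. *)
Lemma integrable_nijenhuis :
  (forall X Y : 'rV[R]_m -> 'rV[R]_m, smooth_mx_on U X -> smooth_mx_on U Y ->
    let XE := fun z => X z *m E z in
    let YE := fun z => Y z *m E z in
    lie_bracket XE YE y - lie_bracket XE Y y *m E y
      - lie_bracket X YE y *m E y - lie_bracket X Y y = 0) ->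
  forall u v : 'rV[R[i]]_m, nijenhuis (fun a => cmx (mx_partial a)) (cmx (E y)) u v = 0.
Proof.
move=> int; apply: nijenhuis_basis => a b.
have cst_smooth (w : 'rV[R]_m) : smooth_mx_on U (fun=> w) by move=> i j; exact: smooth_cst.
have := int _ _ (cst_smooth 'e_a) (cst_smooth 'e_b); rewrite /lie_bracket.
rewrite !derive_cst !sub0r !subr0 oppr0 subr0.
rewrite ![derive (fun=> _ *m _) _ _](derive_val (is_derive := derive_row _ _)) => N.
have e_cmx c : 'e_c = cmx 'e_c :> 'rV[R[i]]_m by rewrite /cmx map_delta_mx.
rewrite !e_cmx -map_nijenhuis; apply/eqP; rewrite map_mx_eq0; apply/eqP; move: N.
by rewrite /nijenhuis mulNmx opprK.
Qed.

End IntegrableFields.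

(** * First derivatives of [I] and [J] on (1,0)-vectors *)

Section ObataIdentity.
Variables (R : realType) (m : nat) (I J K : 'M[R[i]]_m).
Local Notation C := R[i].
Hypotheses (hI : I *m I = - 1%:M) (hJ : J *m J = - 1%:M).
Hypotheses (hK : I *m J = K) (hJI : J *m I = - K).
Variables dI dJ : 'I_m -> 'M[C]_m.
Hypothesis NI : forall u v, nijenhuis dI I u v = 0.
Hypothesis NJ : forall u v, nijenhuis dJ J u v = 0.
Hypothesis dII : forall u, dir dI u *m I = - (I *m dir dI u).
Hypothesis dIJ : forall u,
  J *m dir dI u = - (dir dI u *m J + I *m dir dJ u + dir dJ u *m I).
Local Notation p10 := (proj10 I).
Local Notation p01 := (proj01 I).
Local Notation ii := ('i%C : C).

Local Opaque dir.

(* Vanishing of the Nijenhuis tensors of [J] at [(u, v)] and of [I] at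
   [(u J, v J)], where [J *m dir dI _] is eliminated by the derivative of
   [I J + J I = 0]. *)
Lemma obata_identity (u v : 'rV[C]_m) : u *m p10 = u -> v *m p10 = v ->
  (u *m dir dJ v - v *m dir dJ u) *m p01 =
  (2%:R^-1 * ii) *: (u *m dir dI (v *m J) - v *m dir dI (u *m J)).
Proof.
have rearrange (a b c d : 'rV[C]_m) : a - b + c - d = 0 -> b - a = c - d.
  by move=> /eqP; rewrite -addrA addr_eq0 => /eqP ab; rewrite -[b - a]opprB ab opprK.
have pI (w : 'rV[C]_m) : w *m p10 = w -> w *m I = ii *: w.
  by move=> wp; rewrite -{1}wp -mulmxA proj10_mulI // -(scalemxAr ii) wp.
have qI (w : 'rV[C]_m) : w *m p10 = w -> w *m J *m I = (- ii) *: (w *m J).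
  by move=> wp; rewrite -mulmxA hJI -hK mulmxN mulmxA (pI _ wp) -(scalemxAl ii) scaleNr.
have p01_fix (w : 'rV[C]_m) : w *m I = - (ii *: w) -> w *m p01 = w.
  move=> wI; rewrite /proj01 -(scalemxAr 2%:R^-1) mulmxDr mulmx1 -(scalemxAr ii) wI.
  rewrite (scalerN ii) (scalerA ii ii) sqr_iC scaleN1r opprK -mulr2n -[w *+ 2]scaler_nat.
  by rewrite (scalerA 2%:R^-1) mulVf ?scale1r // pnatr_eq0.
have iI_p10 (w : 'rV[C]_m) : ii *: w + w *m I = (2%:R * ii) *: (w *m p10).
  rewrite /proj10 -(scalemxAr 2%:R^-1) mulmxBr mulmx1 -(scalemxAr ii).
  rewrite (scalerA (2%:R * ii)) mulrAC divff ?pnatr_eq0 // mul1r.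
  by rewrite scalerBr (scalerA ii ii) sqr_iC scaleN1r opprK.
have JinvP (w : 'rV[C]_m) : w *m J = 0 -> w = 0.
  by move=> wJ; rewrite -[w]opprK -[w]mulmx1 -mulmxN -hJ mulmxA wJ mul0mx oppr0.
have cancel_J (k : C) (a d : 'rV[C]_m) : a *m p01 = a ->
    (a *m J + k *: (d *m J *m p10)) *m p10 = 0 -> a + k *: (d *m p01) = 0.
  have Jp (w : 'rV[C]_m) : w *m J *m p10 = w *m p01 *m J.
    by rewrite -!mulmxA (proj01_mulJ hK hJI).
  move=> ap; rewrite mulmxDl -scalemxAl -(mulmxA (d *m J)) (proj10_id hI) !Jp ap => E.
  by apply: JinvP; rewrite mulmxDl -scalemxAl.
have i2 : 2%:R * ii != 0 by rewrite mulf_neq0 ?pnatr_eq0 // neq0Ci.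
move=> up vp.
pose x := u *m J; pose y := v *m J.
(* On the (0,1)-vectors [x] and [y] the matrix [I] is the scalar -i, so that its Nijenhuis tensor
   reduces to a multiple of this (1,0)-projection. *)
have E1 : (x *m dir dI y - y *m dir dI x) *m p10 = 0.
  have := NI x y; rewrite /nijenhuis (qI u up) (qI v vp) -/x -/y !dirZ.
  rewrite -!(scalemxAr (- ii)) -addrA -mulmxBl -scalerBr scaleNr -scalerN opprB iI_p10.
  by move=> /eqP; rewrite scaler_eq0 (negPf i2) => /eqP.
have E2 (w z : 'rV[C]_m) : w *m p10 = w -> w *m J *m dir dI z =
    - (w *m dir dI z *m J + (2%:R * ii) *: (w *m dir dJ z *m p10)).
  move=> wp; rewrite -mulmxA dIJ mulmxN; congr (- _).
  by rewrite !mulmxDr !mulmxA (pI w wp) -(scalemxAl ii) -addrA iI_p10.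
pose D := u *m dir dJ v - v *m dir dJ u.
have E3 : u *m dir dJ y - v *m dir dJ x = D *m J.
  by rewrite mulmxBl; apply: rearrange; exact: NJ.
have E4 (w z : 'rV[C]_m) : w *m p10 = w -> w *m dir dI z *m p01 = w *m dir dI z.
  by move=> wp; apply: p01_fix; rewrite -mulmxA dII mulmxN mulmxA (pI w wp) -(scalemxAl ii).
pose A := u *m dir dI y - v *m dir dI x.
have E5 : A + (2%:R * ii) *: (D *m p01) = 0.
  have Ap : A *m p01 = A by rewrite mulmxBl !E4.
  have : (A *m J + (2%:R * ii) *: (D *m J *m p10)) *m p10 = 0.
    have rearrange' (a b c d : 'rV[C]_m) : (a - b) + (c - d) = - (- (a + c) - - (b + d)).
      by rewrite opprB opprK addrACA -opprD addrC.
    transitivity (- (x *m dir dI y - y *m dir dI x) *m p10); last by rewrite mulNmx E1 oppr0.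
    congr (_ *m p10).
    rewrite -E3 (mulmxBl _ _ J) (mulmxBl _ _ p10) (scalerBr (2%:R * ii)) rearrange'.
    by congr (- (_ - _)); symmetry; [exact: E2 up|exact: E2 vp].
  exact: cancel_J Ap.
change (D *m p01 = (2%:R^-1 * ii) *: A).
have -> : A = - ((2%:R * ii) *: (D *m p01)) by apply/eqP; rewrite -addr_eq0 E5.
rewrite (scalerN (_ * ii)) (scalerA (_ * ii)) mulrACA mulVf ?pnatr_eq0 // mul1r sqr_iC.
by rewrite scaleN1r opprK.
Qed.

End ObataIdentity.

(** * Bidegrees of 1-forms and 2-forms *)

Section Bidegrees.
Variables (R : realType) (m : nat) (I : 'M[R[i]]_m).
Local Notation C := R[i].

Definition covector (w : 'cV[C]_m) : form R m 1 := fun X => (X *m w) 0 0.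

Lemma bidegree_min r (eta : form R m r) X : bidegree I 0 eta X = eta (X *m proj01 I).
Proof.
rewrite /bidegree (eq_bigl (pred1 finset.set0)); last by move=> S; rewrite cards_eq0.
rewrite big_pred1_eq; congr eta; apply/row_matrixP => k.
by rewrite rowK finset.in_set0 row_mul.
Qed.

Lemma bidegree_max r (eta : form R m r) X : bidegree I r eta X = eta (X *m proj10 I).
Proof.
rewrite /bidegree (eq_bigl (pred1 [set: 'I_r]%SET)); last first.
  move=> S; rewrite /= eqEcard finset.subsetT finset.cardsT card_ord eqn_leq.
  by have := max_card (mem S); rewrite card_ord => ->.
rewrite big_pred1_eq; congr eta; apply/row_matrixP => k.
by rewrite rowK finset.in_setT row_mul.
Qed.

Lemma bidegree_bilform (B : 'M[C]_m) X : bidegree I 1 (bilform B) X =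
  bilform (proj10 I *m B *m (proj01 I)^T + proj01 I *m B *m (proj10 I)^T) X.
Proof.
rewrite /bidegree (eq_bigl (mem [set [set k]%SET | k : 'I_2]%SET)); last first.
  move=> S; apply/cards1P/imsetP => [[k ->]|[k _ ->]]; first by exists k.
  by exists k.
rewrite big_imset /=; last by move=> k l _ _; exact: finset.set1_inj.
move: (proj10 I) (proj01 I) => p q.
have E (F : 'I_2 -> 'rV[C]_m) : bilform B (\matrix_k F k) = (F 0 *m B *m (F 1)^T) 0 0.
  by rewrite /bilform !rowK.
rewrite (big_ord_recl 1) (big_ord_recl 0) big_ord0 addr0 !E !finset.in_set1 /=.
by rewrite /bilform mulmxDr mulmxDl !trmx_mul !mulmxA [RHS]mxE.
Qed.

End Bidegrees.

(** * Exterior derivatives in degrees 0 and 1 *)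

Section ExteriorDerivative.
Variables (R : realType) (m : nat) (y : 'rV[R]_m).
Local Notation C := R[i].

Definition jacmx (D : 'I_m -> 'cV[C]_m) : 'M[C]_m := \matrix_(a, b) D a b 0.

Lemma mul_jacmx D (u : 'rV[C]_m) : u *m jacmx D = (dir D u)^T.
Proof.
apply/rowP => b; rewrite !mxE summxE; apply: eq_bigr => a _.
by rewrite !mxE.
Qed.

(** The matrix of the exterior derivative of a covector field whose a-th partial derivative is
    [D a]. *)
Definition dmx D : 'M[C]_m := jacmx D - (jacmx D)^T.

Lemma dmx_skew D : (dmx D)^T = - dmx D.
Proof. by rewrite /dmx linearB /= trmxK opprB. Qed.

Lemma mul_dmx D (u v : 'rV[C]_m) : u *m dmx D *m v^T = v *m dir D u - u *m dir D v.
Proof.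
rewrite /dmx mulmxBr mulmxBl mul_jacmx -trmx_mul -mulmxA -trmx_mul mul_jacmx trmxK.
by congr (_ - _); rewrite [LHS]mx11_scalar mxE -mx11_scalar.
Qed.

Lemma ext_d_fun (f : 'rV[R]_m -> R) X :
  ext_d (fun z _ => (f z)%:C : C) y X = covector (cmx (\col_a 'D_('e_a) f y)) X.
Proof.
rewrite /ext_d big_ord1 expr0 mul1r /covector mxE; apply: eq_bigr => a _.
by rewrite !mxE /cpartial /= derive_cst.
Qed.

Lemma ext_d_covector (w : 'rV[R]_m -> 'cV[C]_m) D X :
  (forall a, is_mpartial a y w (D a)) ->
  ext_d (fun z => covector (w z)) y X = bilform (dmx D) X.
Proof.
move=> wD.
have E (x : 'rV[C]_m) a : cpartial a (fun z => (x *m w z) 0 0) y = (x *m D a) 0 0.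
  apply: is_cpartial_eq; have := is_mpartialM (is_mpartial_cst a y x) (wD a).
  by rewrite mul0mx add0r; apply.
rewrite /bilform mul_dmx /ext_d big_ord_recl big_ord1 expr0 expr1 mul1r mulN1r.
have r0 : row' ord0 X = row 1 X.
  by apply/rowP => j; rewrite !mxE; congr (X _ _); apply/val_inj.
have r1 : row' (lift ord0 ord0) X = row 0 X.
  by apply/rowP => j; rewrite !mxE; congr (X _ _); apply/val_inj.
have T (x : 'rV[C]_m) (k : C) (d : 'cV[C]_m) : (x *m (k *: d)) 0 0 = k * (x *m d) 0 0.
  by rewrite -scalemxAr mxE.
rewrite r0 r1 [RHS]mxE [X in _ = _ + X]mxE; congr (_ - _).
- rewrite /dir mulmx_sumr summxE; apply: eq_bigr => a _.
  by rewrite T -E [row 0 X 0 a]mxE.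
- rewrite /dir mulmx_sumr summxE; apply: eq_bigr => a _.
  by rewrite T -E [row 1 X 0 a]mxE; congr (X _ _ * _); apply/val_inj.
Qed.

End ExteriorDerivative.

(** * The two Hessians at a point *)

Section HessianPair.
Variables (R : realType) (m : nat) (I J K : 'M[R[i]]_m).
Local Notation C := R[i].
Hypotheses (hI : I *m I = - 1%:M) (hJ : J *m J = - 1%:M).
Hypotheses (hK : I *m J = K) (hJI : J *m I = - K).
Local Notation p10 := (proj10 I).
Local Notation p01 := (proj01 I).
Local Notation ii := ('i%C : C).

(** [B *m J^T + J *m B] is the infinitesimal action of [J] on the form [B]: of its (1,1)-part only
    the mixed terms in c0 c1 survive, and the hypothesis makes them opposite to the (2,0)-part of
    [B']. *)
Lemma raises_bidegree (B B' : 'M[C]_m) :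
  p10 *m (B' + B *m J^T + J *m B) *m p10^T = 0 ->
  raises I J (fun X => - ii * bidegree I 1 (bilform B) X) (bidegree I 2 (bilform B')).
Proof.
have E (B0 U V : 'M[C]_m) (X : 'M_(2, m)) : U *m B0 *m U^T = V ->
    bilform B0 (X *m U) = bilform V X.
  by move=> <-; rewrite /bilform !row_mul trmx_mul !mulmxA.
move=> BB'; split=> [X|c0 c1 X]; first by rewrite !bidegree_max -mulmxA proj10_id.
rewrite bidegree_bilform bidegree_max (E _ _ _ X (erefl (p10 *m B' *m p10^T))) -(mulmxA X p10).
set U := p10 *m (_ + _).
have Up10 : U *m p10 = c0 *: p10.
  rewrite /U -mulmxA mulmxDl mul_scalar_mx -(scalemxAl c1) mulmxDr -(scalemxAr c0) -(scalemxAr c1).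
  by rewrite (proj10_id hI) -(proj01_mulJ hK hJI) mulmxA (proj10_proj01 hI) mul0mx scaler0 addr0.
have Up01 : U *m p01 = c1 *: (p10 *m J).
  rewrite /U -mulmxA mulmxDl mul_scalar_mx -(scalemxAl c1) mulmxDr -(scalemxAr c0) -(scalemxAr c1).
  rewrite (proj10_proj01 hI) scaler0 add0r -(proj10_mulJ hK hJI).
  by rewrite mulmxA (proj10_id hI).
have UB : U *m (p10 *m B *m p01^T + p01 *m B *m p10^T) *m U^T =
    (c0 * c1) *: (p10 *m (B *m J^T + J *m B) *m p10^T).
  have expand (V p q P Q : 'M[C]_m) : V *m p = P -> V *m q = Q ->
      V *m (p *m B *m q^T + q *m B *m p^T) *m V^T = P *m B *m Q^T + Q *m B *m P^T.
    by move=> <- <-; rewrite mulmxDr mulmxDl !trmx_mul !mulmxA.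
  have collect (p : 'M[C]_m) : (c0 *: p) *m B *m (c1 *: (p *m J))^T +
      (c1 *: (p *m J)) *m B *m (c0 *: p)^T = (c0 * c1) *: (p *m (B *m J^T + J *m B) *m p^T).
    have tZ (k : C) (A : 'M[C]_m) : (k *: A)^T = k *: A^T by rewrite linearZ.
    rewrite !tZ -!(scalemxAl c0) -!(scalemxAl c1) -!(scalemxAr c0) -!(scalemxAr c1).
    rewrite (scalerA c1 c0) (scalerA c0 c1) (mulrC c1) -scalerDr; congr (_ *: _).
    by rewrite trmx_mul mulmxDr mulmxDl !mulmxA.
  by rewrite (expand _ _ _ _ _ Up10 Up01) collect.
have BJ : p10 *m (B *m J^T + J *m B) *m p10^T = - (p10 *m B' *m p10^T).
  apply/eqP; rewrite -addr_eq0 -mulmxDl -mulmxDr addrC addrA; exact/eqP.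
rewrite (E _ _ _ X UB) BJ /bilform -(scalemxAr (c0 * c1)) -(scalemxAl (c0 * c1)) mxE.
by rewrite mulmxN mulNmx mxE !mulrN mulNr opprK !mulrA.
Qed.

Variables dI dJ : 'I_m -> 'M[C]_m.
Hypothesis NI : forall u v, nijenhuis dI I u v = 0.
Hypothesis NJ : forall u v, nijenhuis dJ J u v = 0.
Hypothesis dII : forall u, dir dI u *m I = - (I *m dir dI u).
Hypothesis dIJ : forall u,
  J *m dir dI u = - (dir dI u *m J + I *m dir dJ u + dir dJ u *m I).
Variables (G : 'cV[C]_m) (dG : 'I_m -> 'cV[C]_m).

(* the derivatives of the covectors of [delbar phi] and [delJ phi],
   where [G] is the gradient of [phi] *)
Definition d_delbar a : 'cV[C]_m := (2%:R^-1 * ii) *: dI a *m G + p01 *m dG a.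
Definition d_delJ a : 'cV[C]_m := - (dJ a *m (p01 *m G) + J *m d_delbar a).

Lemma dir_d_delbar u :
  dir d_delbar u = (2%:R^-1 * ii) *: dir dI u *m G + p01 *m dir dG u.
Proof. by rewrite dir_add dir_mulmxr dir_mulmxl dir_scale. Qed.

Lemma dir_d_delJ u : dir d_delJ u = - (dir dJ u *m (p01 *m G) + J *m dir d_delbar u).
Proof.
rewrite -dir_mulmxr -dir_mulmxl -dir_add -[RHS]scaleN1r -dir_scale.
by apply: eq_bigr => a _; rewrite scaleN1r.
Qed.

(** Second derivatives enter through [dG], multiplied on the left by p01. They vanish against [u]
    and [v]; those paired with u J and v J occur twice with opposite signs, since [d_delJ] contains
    J times [d_delbar]. What is left is linear in [G] and is settled by [obata_identity]. *)
Lemma hessian_pair (u v : 'rV[C]_m) : u *m p10 = u -> v *m p10 = v ->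
  u *m (dmx d_delJ + dmx d_delbar *m J^T + J *m dmx d_delbar) *m v^T = 0.
Proof.
move=> up vp.
have E (A : 'M[C]_m) : u *m (A *m J^T) *m v^T = u *m A *m (v *m J)^T.
  by rewrite trmx_mul !mulmxA.
have b_dir (w z : 'rV[C]_m) : w *m p10 = w ->
    w *m dir d_delbar z = (2%:R^-1 * ii) *: (w *m dir dI z) *m G.
  move=> wp; rewrite dir_d_delbar mulmxDr (mulmxA w p01) -{2}wp -(mulmxA w p10).
  by rewrite (proj10_proj01 hI) mulmx0 mul0mx addr0 mulmxA -scalemxAr.
have cancel (a b c d x z : 'M[C]_1) :
    - (a + b) - - (c + d) + (b - x) + (z - d) = (c - a) - (x - z).
  by apply/matrixP => i j; rewrite !mxE; ring.
have combine (k : C) (a b c d : 'rV[C]_m) (p : 'M[C]_m) : (a - b) *m p = k *: (c - d) ->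
    a *m p *m G - b *m p *m G - ((k *: c) *m G - (k *: d) *m G) = 0.
  move=> e; rewrite -(mulmxBl _ _ G) -(mulmxBl _ _ p) e -(mulmxBl _ _ G) -scalerBr.
  exact: subrr.
have EB' : u *m dmx d_delJ *m v^T =
    - (v *m dir dJ u *m p01 *m G + v *m J *m dir d_delbar u) -
    - (u *m dir dJ v *m p01 *m G + u *m J *m dir d_delbar v).
  by rewrite mul_dmx !dir_d_delJ !mulmxN !(mulmxDr v) !(mulmxDr u) !mulmxA.
have EBJ : u *m (dmx d_delbar *m J^T) *m v^T =
    v *m J *m dir d_delbar u - u *m dir d_delbar (v *m J).
  by rewrite E mul_dmx.
have EJB : u *m (J *m dmx d_delbar) *m v^T =
    v *m dir d_delbar (u *m J) - u *m J *m dir d_delbar v.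
  by rewrite mulmxA mul_dmx.
rewrite (mulmxDr u) (mulmxDr u) mulmxDl mulmxDl EB' EBJ EJB cancel (b_dir u) // (b_dir v) //.
apply: combine; exact: (obata_identity hI hJ hK hJI NI NJ dII dIJ up vp).
Qed.

Lemma hessian_pair_mx : p10 *m (dmx d_delJ + dmx d_delbar *m J^T + J *m dmx d_delbar) *m p10^T = 0.
Proof.
apply/matrixP => i j; rewrite [RHS]mxE.
have rowp k : row k p10 *m p10 = row k p10 by rewrite -row_mul proj10_id.
have entry (p N : 'M[C]_m) : (p *m N *m p^T) i j = (row i p *m N *m (row j p)^T) 0 0.
  rewrite -row_mul [LHS]mxE [RHS]mxE; apply: eq_bigr => k _.
  by rewrite [row i _ _ _]mxE ![_^T _ _]mxE [row j _ _ _]mxE.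
by rewrite entry (hessian_pair (rowp i) (rowp j)) mxE.
Qed.

End HessianPair.

(** * The Hessians of a function on the manifold *)

Section QuaternionicHessian.
Variables (R : realType) (m : nat) (M : manifold R m) (H : hypercomplex M).
Variables (phi : M -> R) (c : cidx M) (y : 'rV[R]_m).
Local Notation C := R[i].
Local Notation ii := ('i%C : C).
Local Notation U := (cimg (atlas M c)).
Hypotheses (sphi : smooth_fun phi) (Uy : U y).
Local Notation I z := (cmx (hcI H c z)).
Local Notation J z := (cmx (hcJ H c z)).
Local Notation K z := (cmx (hcK H c z)).
Local Notation p10 z := (proj10 (I z)).
Local Notation p01 z := (proj01 (I z)).
Local Notation f := (fun z => phi (cinv (atlas M c) z)).
Let G z : 'cV[C]_m := cmx (\col_a 'D_('e_a) f z).

Lemma cmx_sqr (E : 'M[R]_m) : E *m E = - 1%:M -> cmx E *m cmx E = - 1%:M.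
Proof. by move=> E2; rewrite /cmx -map_mxM E2 map_mxN map_scalar_mx. Qed.

Lemma hcI_sqr z : U z -> I z *m I z = - 1%:M.
Proof. by move=> Uz; have [/cmx_sqr] := hc_sq H Uz. Qed.

Lemma hcJ_sqr z : U z -> J z *m J z = - 1%:M.
Proof. by move=> Uz; have [_ /cmx_sqr] := hc_sq H Uz. Qed.

Lemma hcIJ z : U z -> I z *m J z = K z.
Proof. by move=> Uz; have [IJ _] := hc_IJ H Uz; rewrite /cmx -map_mxM IJ. Qed.

Lemma hcJI z : U z -> J z *m I z = - K z.
Proof. by move=> Uz; have [_ <-] := hc_IJ H Uz; rewrite /cmx -map_mxM map_mxN opprK. Qed.

Lemma delbar_fun z : delbar H (form_fun phi) c z = covector (p01 z *m G z).
Proof.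
apply/funext => X; rewrite /delbar big_ord1 bidegree_min.
rewrite (_ : (fun=> _) = (fun w _ => (f w)%:C)); last first.
  by apply/funext => w; apply/funext => Y; rewrite bidegree_min.
by rewrite ext_d_fun /covector -mulmxA.
Qed.

Lemma delJ_fun z : delJ H (form_fun phi) c z = covector (invmx (J z) *m (p01 z *m G z)).
Proof.
apply/funext => X; rewrite /delJ /actJV /act.
have -> : actJ H (form_fun phi) = form_fun phi by [].
by rewrite delbar_fun /covector !mulmxA.
Qed.

(** The two types of a 1-form are differentiated separately: the (0,1)-part contributes to bidegree
    (1,1), the (1,0)-part to bidegree (2,0). *)
Lemma del_covector (om : dform M 1) (w : 'rV[R]_m -> 'cV[C]_m) D0 D1 X :
  (forall z, om c z = covector (w z)) ->
  (forall a, is_mpartial a y (fun z => p01 z *m w z) (D0 a)) ->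
  (forall a, is_mpartial a y (fun z => p10 z *m w z) (D1 a)) ->
  del H om c y X = bidegree (I y) 1 (bilform (dmx D0)) X + bidegree (I y) 2 (bilform (dmx D1)) X.
Proof.
move=> omE wD0 wD1; rewrite /del big_ord_recl big_ord1.
have E0 : (fun z => bidegree (I z) 0 (om c z)) = (fun z => covector (p01 z *m w z)).
  by apply/funext => z; apply/funext => Y; rewrite bidegree_min omE /covector mulmxA.
have E1 : (fun z => bidegree (I z) 1 (om c z)) = (fun z => covector (p10 z *m w z)).
  by apply/funext => z; apply/funext => Y; rewrite bidegree_max omE /covector mulmxA.
have X0 : ext_d (fun z => bidegree (I z) 0 (om c z)) y = bilform (dmx D0).
  by rewrite E0; apply/funext => Y; exact: ext_d_covector.
have X1 : ext_d (fun z => bidegree (I z) 1 (om c z)) y = bilform (dmx D1).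
  by rewrite E1; apply/funext => Y; exact: ext_d_covector.
by rewrite -X0 -X1.
Qed.

Let dI := fun a => cmx (mx_partial y (hcI H c) a).
Let dJ := fun a => cmx (mx_partial y (hcJ H c) a).
Let dG a : 'cV[C]_m := cmx (\col_b 'D_('e_a) (fun z => 'D_('e_b) f z) y).

Let oU : open U := @cimg_open _ _ _ (atlas M c).

Let sI : smooth_mx_on U (hcI H c).
Proof. by have [[+ _] _ _] := hc_endo H; apply. Qed.

Let sJ : smooth_mx_on U (hcJ H c).
Proof. by have [_ [+ _] _] := hc_endo H; apply. Qed.

Let dIP a : is_mpartial a y (fun z => I z) (dI a).
Proof. exact: (mx_partialP Uy sI). Qed.

Let dJP a : is_mpartial a y (fun z => J z) (dJ a).
Proof. exact: (mx_partialP Uy sJ). Qed.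

Let dGP a : is_mpartial a y G (dG a).
Proof.
apply: is_mpartial_real => b j; rewrite mxE.
rewrite (_ : (fun=> _) = fun z => 'D_('e_b) f z); last by apply/funext => z; rewrite mxE.
apply: DeriveDef => //.
by have [_ /(_ b)[_ [_ /(_ a)[+ _]]]] := sphi c 2; apply.
Qed.

Lemma delbar_partial a : is_mpartial a y (fun z => p01 z *m G z) (d_delbar (I y) dI (G y) dG a).
Proof. exact: is_mpartialM (is_mpartial_proj01 (dIP a)) (dGP a). Qed.

Lemma delJ_partial a : is_mpartial a y (fun z => - (J z *m (p01 z *m G z)))
  (d_delJ (I y) (J y) dI dJ (G y) dG a).
Proof.
have := is_mpartialZ (-1) (is_mpartialM (dJP a) (delbar_partial a)).
rewrite scaleN1r (_ : (fun=> _) = fun z => - (J z *m (p01 z *m G z))) //.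
by apply/funext => z; rewrite scaleN1r.
Qed.

Lemma dmx0 : dmx (fun=> 0 : 'cV[C]_m) = 0.
Proof. by apply/matrixP => a b; rewrite !mxE subrr. Qed.

Lemma bilform0 X : bilform (0 : 'M[C]_m) X = 0.
Proof. by rewrite /bilform mulmx0 mul0mx mxE. Qed.

Lemma del_delbar_fun : del H (delbar H (form_fun phi)) c y =
  bidegree (I y) 1 (bilform (dmx (d_delbar (I y) dI (G y) dG))).
Proof.
apply/funext => X.
rewrite (del_covector (D0 := d_delbar (I y) dI (G y) dG) (D1 := fun=> 0) X delbar_fun).
- by rewrite bidegree_max dmx0 bilform0 addr0.
(* The identities between the projections are differentiated, so they must hold on all of [U] and
   not only at [y]. *)
- move=> a; apply: (is_mpartial_near oU Uy _ (delbar_partial a)) => z Uz.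
  by rewrite mulmxA proj01_id //; exact: hcI_sqr.
- move=> a; apply: (is_mpartial_near oU Uy _ (is_mpartial_cst a y 0)) => z Uz.
  by rewrite mulmxA proj10_proj01 ?mul0mx //; exact: hcI_sqr.
Qed.

Lemma del_delJ_fun : del H (delJ H (form_fun phi)) c y =
  bidegree (I y) 2 (bilform (dmx (d_delJ (I y) (J y) dI dJ (G y) dG))).
Proof.
apply/funext => X.
have invJ z : U z -> invmx (J z) = - J z.
  move=> Uz; have JJ : J z *m - J z = 1%:M by rewrite mulmxN hcJ_sqr // opprK.
  have uJ : J z \in unitmx by case/mulmx1_unit: JJ.
  by rewrite -[LHS]mulmx1 -JJ mulmxA mulVmx // mul1mx.
rewrite (del_covector (D0 := fun=> 0) (D1 := d_delJ (I y) (J y) dI dJ (G y) dG) X delJ_fun).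
- by rewrite dmx0 bidegree_bilform !mulmx0 !mul0mx add0r bilform0 add0r.
- move=> a; apply: (is_mpartial_near oU Uy _ (is_mpartial_cst a y 0)) => z Uz.
  rewrite invJ // mulNmx mulmxN !mulmxA (proj01_mulJ (hcIJ Uz) (hcJI Uz)) -(mulmxA (J z)).
  by rewrite proj10_proj01 ?mulmx0 ?mul0mx ?oppr0 //; exact: hcI_sqr.
- move=> a; apply: (is_mpartial_near oU Uy _ (delJ_partial a)) => z Uz.
  rewrite invJ // mulNmx mulmxN !mulmxA (proj10_mulJ (hcIJ Uz) (hcJI Uz)) -(mulmxA (J z) (p01 z) (p01 z)).
  by rewrite proj01_id //; exact: hcI_sqr.
Qed.

Let nijI u v : nijenhuis dI (I y) u v = 0.
Proof.
apply: (integrable_nijenhuis oU Uy sI) => X Y sX sY XE YE.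
by have [iI _ _] := hc_int H; exact: iI.
Qed.

Let nijJ u v : nijenhuis dJ (J y) u v = 0.
Proof.
apply: (integrable_nijenhuis oU Uy sJ) => X Y sX sY XE YE.
by have [_ iJ _] := hc_int H; exact: iJ.
Qed.

Local Opaque dir.

Let dII u : dir dI u *m I y = - (I y *m dir dI u).
Proof.
apply/eqP; rewrite -addr_eq0 -dir_mulmxr -dir_mulmxl -dir_add; apply/eqP.
apply: dir_eq0 => a.
apply: is_mpartial_unique (is_mpartialM (dIP a) (dIP a)) _.
apply: (is_mpartial_near oU Uy _ (is_mpartial_cst a y (- 1%:M))) => z Uz.
by rewrite hcI_sqr.
Qed.

Let dIJ u :
  J y *m dir dI u = - (dir dI u *m J y + I y *m dir dJ u + dir dJ u *m I y).
Proof.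
apply/eqP; rewrite -addr_eq0 addrC -!addrA.
rewrite -!dir_mulmxr -!dir_mulmxl -!dir_add; apply/eqP.
apply: dir_eq0 => a.
have E : dI a *m J y + I y *m dJ a = - (dJ a *m I y + J y *m dI a).
  rewrite -[RHS]scaleN1r; apply: is_mpartial_unique (is_mpartialM (dIP a) (dJP a)) _.
  apply: (is_mpartial_near oU Uy _ (is_mpartialZ (-1) (is_mpartialM (dJP a) (dIP a)))) => z Uz.
  by rewrite scaleN1r hcJI // opprK hcIJ.
by rewrite (addrA (dI a *m _)) E addNr.
Qed.

Lemma raises_hessian : raises (I y) (J y)
  (fun X => - ii * del H (delbar H (form_fun phi)) c y X)
  (del H (delJ H (form_fun phi)) c y).
Proof.
have Z := hessian_pair_mx (hcI_sqr Uy) (hcJ_sqr Uy) (hcIJ Uy) (hcJI Uy) nijI nijJ dII dIJ (G y) dG.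
have := raises_bidegree (hcI_sqr Uy) (hcIJ Uy) (hcJI Uy) Z.
by rewrite -del_delbar_fun -del_delJ_fun.
Qed.

Lemma bidegree_skew_Lambda (E B : 'M[C]_m) p : B^T = - B -> (0 < p <= 2)%N ->
  Lambda (bidegree E p (bilform B)).
Proof.
case: p => [|[|[|//]]] // BT _.
  have -> : bidegree E 1 (bilform B) =
      bilform (proj10 E *m B *m (proj01 E)^T + proj01 E *m B *m (proj10 E)^T).
    by apply/funext => X; exact: bidegree_bilform.
  move: (proj10 E) (proj01 E) => P Q; apply: bilform_Lambda.
  by rewrite linearD /= !trmx_mul !trmxK BT opprD addrC !mulNmx !mulmxN !mulmxA.
have -> : bidegree E 2 (bilform B) = act (proj10 E) (bilform B).
  by apply/funext => X; exact: bidegree_max.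
exact/act_Lambda/bilform_Lambda.
Qed.

Lemma del_delbar_Lambda : Lambda (del H (delbar H (form_fun phi)) c y).
Proof.
rewrite del_delbar_fun; apply: bidegree_skew_Lambda => //; exact: dmx_skew.
Qed.

Lemma del_delJ_Lambda : Lambda (del H (delJ H (form_fun phi)) c y).
Proof.
rewrite del_delJ_fun; apply: bidegree_skew_Lambda => //; exact: dmx_skew.
Qed.

End QuaternionicHessian.

(** * The metric in a chart *)

Section HermitianMetric.
Variables (R : realType) (m : nat) (M : manifold R m) (H : hypercomplex M) (g : mxfield M).
Hypothesis hg : quaternionic_hermitian H g.
Variables (c : cidx M) (y : 'rV[R]_m).
Hypothesis Uy : cimg (atlas M c) y.
Local Notation C := R[i].
Local Notation gm := (cmx (g c y)).

Lemma metric_sym : gm^T = gm.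
Proof. by have [[_ _ gT _] _] := hg; rewrite /cmx map_trmx gT. Qed.

Let scalar0 : 0%:M = 0 :> 'M[R]_m.
Proof. exact: raddf0. Qed.

Lemma metric_invI : cmx (hcI H c y) *m gm *m (cmx (hcI H c y))^T = gm.
Proof.
have [_ /(_ c y Uy 0 1 0 0)] := hg; rewrite /unit_quat !(expr0n, expr1n) /= !(addr0, add0r).
move=> /(_ erefl); rewrite !scale0r scale1r !addr0 scalar0 add0r => gI.
by rewrite /cmx map_trmx -!map_mxM gI.
Qed.

Lemma metric_invJ : cmx (hcJ H c y) *m gm *m (cmx (hcJ H c y))^T = gm.
Proof.
have [_ /(_ c y Uy 0 0 1 0)] := hg; rewrite /unit_quat !(expr0n, expr1n) /= !(addr0, add0r).
move=> /(_ erefl); rewrite !scale0r scale1r !addr0 scalar0 !add0r => gJ.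
by rewrite /cmx map_trmx -!map_mxM gJ.
Qed.

Lemma metric_nondegenerate (v : 'rV[C]_m) : v *m gm = 0 -> v = 0.
Proof.
have real_nd (a : 'rV[R]_m) : a *m g c y = 0 -> a = 0.
  move=> a0; apply/eqP; apply: contraT => an; have [[_ _ _ pos] _] := hg.
  have := pos c y Uy a an.
  by rewrite a0 mul0mx mxE ltxx.
pose a := map_mx (@complex.Re R) v; pose b := map_mx (@complex.Im R) v.
have vE : v = cmx a + 'i%C *: cmx b.
  by apply/rowP => j; rewrite !mxE [LHS]complexE.
have parts (p q : 'rV[R]_m) : cmx p + 'i%C *: cmx q = 0 -> p = 0 /\ q = 0.
  move=> E; have F j : p 0 j +i* q 0 j = 0.
    have -> : p 0 j +i* q 0 j = (cmx p + 'i%C *: cmx q) 0 j by rewrite !mxE [LHS]complexE.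
    by rewrite E mxE.
  by split; apply/rowP => j; rewrite [RHS]mxE; case: (F j).
rewrite vE mulmxDl -scalemxAl /cmx -!map_mxM => /parts[a0 b0].
by rewrite (real_nd _ a0) (real_nd _ b0) !map_mx0 scaler0 addr0.
Qed.

Lemma omegaI_bilform : omegaI H g c y = bilform (kahler_mx (cmx (hcI H c y)) gm).
Proof. by apply/funext => X; rewrite /omegaI /metric_form /bilform /kahler_mx trmx_mul !mulmxA. Qed.

Lemma Omega_bilform : Omega H g c y = bilform (Omega_mx (cmx (hcJ H c y)) (cmx (hcK H c y)) gm).
Proof.
have E (u : 'rV[C]_m) (A B : 'M[C]_m) (w : 'cV[C]_m) : (u *m - (A - 'i%C *: B) *m w) 0 0 =
    - ((u *m A *m w) 0 0 - 'i%C * (u *m B *m w) 0 0).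
  rewrite mulmxN mulNmx mulmxBr mulmxBl -scalemxAr -scalemxAl [LHS]mxE; congr (- _).
  by rewrite [LHS]mxE; congr (_ + _); rewrite [LHS]mxE; congr (- _); rewrite [LHS]mxE.
by apply/funext => X; rewrite /Omega /metric_form /bilform /Omega_mx E !trmx_mul !mulmxA.
Qed.

End HermitianMetric.

(** * Sums of forms, and the passage from points to the manifold *)

Lemma form_add_Lambda (R : realType) m r (al be : form R m r) (k : R[i]) :
  Lambda al -> Lambda be -> Lambda (fun X => al X + k * be X).
Proof.
move=> [La Aa] [Lb Ab]; split=> [X Y Z l a b e1 e2 e3|X j l jl e].
  rewrite (La X Y Z l a b) // (Lb X Y Z l a b) // !mulrDr addrACA; congr (_ + _ + (_ + _)).
  - by rewrite mulrCA.
  - by rewrite mulrCA.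
by rewrite (Aa X j l) // (Ab X j l) // mulr0 addr0.
Qed.

Lemma raises_add (R : realType) m (I J : 'M[R[i]]_m) om Om om' Om' :
  raises I J om Om -> raises I J om' Om' ->
  raises I J (fun X => om X + om' X) (fun X => Om X + Om' X).
Proof.
move=> [p q] [p' q']; split=> [X|c0 c1 X]; first by rewrite p p'.
by rewrite q q' mulrDr.
Qed.

Theorem proposition3p2 (R : realType) (n : nat) (M : manifold R (4 * n))
    (H : hypercomplex M) (g : mxfield M) (hg : quaternionic_hermitian H g)
    (f phi : M -> R) (hf : smooth_fun f) (hphi : smooth_fun phi) (A : R) :
  form_eq (form_pow (form_add (Omega H g) (del H (delJ H (form_fun phi)))) n)
           (form_mulf (fun x => A * expR (f x)) (form_pow (Omega H g) n))
  <->
  form_eq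
    (form_wedge (form_pow (form_add (omegaI H g)
                        (form_scale (- 'i%C) (del H (delbar H (form_fun phi))))) n)
            (form_Pplus H (form_pow (omegaI H g) n)))
    (form_mulf (fun x => A * expR (f x))
       (form_wedge (form_pow (omegaI H g) n) (form_Pplus H (form_pow (omegaI H g) n)))).
Proof.
suff pointwise c y : cimg (atlas M c) y ->
    (forall X, wpow (form_add (Omega H g) (del H (delJ H (form_fun phi))) c y) n X =
       (A * expR (f (cinv (atlas M c) y)))%:C * wpow (Omega H g c y) n X) <->
    (forall X, wedge (wpow (form_add (omegaI H g)
           (form_scale (- 'i%C) (del H (delbar H (form_fun phi)))) c y) n)
         (form_Pplus H (form_pow (omegaI H g) n) c y) X =
       (A * expR (f (cinv (atlas M c) y)))%:C *
       wedge (wpow (omegaI H g c y) n) (form_Pplus H (form_pow (omegaI H g) n) c y) X).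
  by split=> E c y Uy; apply/(pointwise c y Uy)/E.
move=> Uy.
have [hI hJ] := (hcI_sqr H Uy, hcJ_sqr H Uy).
have [hK hJI] := (hcIJ H Uy, hcJI H Uy).
have gT := metric_sym hg Uy.
have gI := metric_invI hg Uy.
have gJ := metric_invJ hg Uy.
have gnd := @metric_nondegenerate _ _ _ _ _ hg _ _ Uy.
have LO : Lambda (Omega H g c y).
  by rewrite (Omega_bilform H g); apply/bilform_Lambda/(Omega_skew hI hJ hK hJI gT gI gJ).
have Lo : Lambda (omegaI H g c y).
  by rewrite (omegaI_bilform H g); apply/bilform_Lambda/(kahler_skew hI gT gI).
have rO : raises (cmx (hcI H c y)) (cmx (hcJ H c y)) (omegaI H g c y) (Omega H g c y).
  rewrite (Omega_bilform H g) (omegaI_bilform H g).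
  exact: raises_metric hI hJ hK hJI gT gI gJ.
have LO' : Lambda (form_add (Omega H g) (del H (delJ H (form_fun phi))) c y).
  rewrite /form_add (_ : (fun=> _) = fun X => Omega H g c y X + 1 * del H (delJ H (form_fun phi)) c y X).
    by apply: form_add_Lambda => //; exact: del_delJ_Lambda.
  by apply/funext => X; rewrite mul1r.
have Lo' : Lambda (form_add (omegaI H g)
    (form_scale (- 'i%C) (del H (delbar H (form_fun phi)))) c y).
  by apply: form_add_Lambda => //; exact: del_delbar_Lambda.
have rO' := raises_add rO (raises_hessian H hphi Uy).
have [e [B [eB Be nz]]] := adapted_frame hI hJ hK hJI gT gI gJ gnd erefl.
rewrite -(Omega_bilform H g) in nz.
exact: (pointwise_equiv hI hJ hK hJI eB Be _ Lo LO rO Lo' LO' rO' nz).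
Qed.
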